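(* Let $d\ge 2$, $\Omega=[0,1]$, and let $\sigma>0$ satisfy $2\sigma\ge 1$. Let $a_0,a_1\in M$ (measurable functions $\Omega\to S^{d-1}$), and let $\phi_1\in G$, i.e. $\phi_1:\Omega\to\Omega$ satisfies $\phi_1(0)=0$, $\phi_1(1)=1$ and $d\phi_1>0$. Then $$\inf\Big\{U_\sigma(\phi,\alpha)\;:\;\phi(0,\cdot)=\mathrm{id},\ \phi(1,\cdot)=\phi_1,\ \alpha(0,\cdot)=a_0,\ \alpha(1,\cdot)=a_1\circ\phi_1\Big\}$$ $$=4\left(\arccos\int_\Omega\sqrt{d\phi_1(s)}\,\cos\left(\frac{\arccos\big(a_0(s)^Ta_1(\phi_1(s))\big)}{2\sigma}\right)ds\right)^2,$$ where the infimum is over all admissible trajectories $(\phi,\alpha)$ with the indicated boundary conditions. Moreover, if $2\sigma>1$, this infimum is a minimum, and it is attained at a trajectory $(\phi,\alpha)$ deduced (in the sense given in the context) from the minimizing geodesic $\gamma$ on the unit sphere of $L^2(\Omega,\mathbb{R}^2)$ joining $q_0$ to $q_1$. Finally, the function $$d_\sigma(a_0,a_1)=2\inf_{\phi_1\in G}\ \arccos\int_\Omega\sqrt{d\phi_1(s)}\,\cos\left(\frac{\arccos\big(a_0(s)^Ta_1(\phi_1(s))\big)}{2\sigma}\right)ds$$ is a distance on $M$.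
   Context: Notation. $\Omega=[0,1]$ is the range of the (normalized) arc-length variable $s$; $t\in[0,1]$ is time. For a function $h(t,s)$, $\dot h=\partial_t h$ denotes the time derivative and $dh=\partial_s h$ the derivative in $s$. $S^{d-1}$ is the unit sphere of $\mathbb{R}^d$, and $\arccos$ takes values in $[0,\pi]$. $M$ is the set of measurable functions $a:\Omega\to S^{d-1}$, with functions equal almost everywhere identified. $G$ is the group, under composition, of increasing diffeomorphisms $\psi$ of $\Omega$, understood here in the following sense: $\psi:\Omega\to\Omega$ is absolutely continuous, $\psi(0)=0$, $\psi(1)=1$, and $d\psi>0$ almost everywhere. Admissible trajectories. An admissible trajectory $(\phi,\alpha)$ consists of measurable functions $\phi:[0,1]\times\Omega\to\Omega$ and $\alpha:[0,1]\times\Omega\to S^{d-1}$ such that: $\phi(t,\cdot)\in G$ for every $t$, with derivative represented by a jointly measurable function $d\phi(t,s)$, i.e. $\phi(t,s)=\int_0^s d\phi(t,u)\,du$; and, for almost every $s\in\Omega$, $d\phi(t,s)>0$ for all $t\in[0,1]$ and the functions $t\mapsto d\phi(t,s)$ and $t\mapsto\alpha(t,s)$ are absolutely continuous on $[0,1]$. Boundary conditions on $\alpha$ are understood for almost every $s$. Energy. For an admissible trajectory, $$U_\sigma(\phi,\alpha)=\int_0^1\int_\Omega\frac{(d\dot\phi)^2}{d\phi}\,ds\,dt+\frac1{\sigma^2}\int_0^1\int_\Omega|\dot\alpha|^2\,d\phi\,ds\,dt\in[0,+\infty],$$ where $d\dot\phi=\partial_t(d\phi)$ and, in the second integral, $d\phi$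 is the function $d\phi(t,s)$ multiplying $|\dot\alpha|^2$. Geodesic and associated trajectory. Given $a_0,a_1,\phi_1$, let $\omega(s)=\arccos\big(a_0(s)^Ta_1(\phi_1(s))\big)\in[0,\pi]$. Let $a_0^\perp:\Omega\to S^{d-1}$ be measurable with $a_0^\perp(s)\perp a_0(s)$ and $a_1(\phi_1(s))=\cos\omega(s)\,a_0(s)+\sin\omega(s)\,a_0^\perp(s)$ (it is determined when $\omega(s)\in(0,\pi)$ and chosen arbitrarily otherwise). Let $q_0(s)=(1,0)$ and $q_1(s)=\sqrt{d\phi_1(s)}\,\big(\cos\tfrac{\omega(s)}{2\sigma},\sin\tfrac{\omega(s)}{2\sigma}\big)$, which are elements of the unit sphere of $L^2(\Omega,\mathbb{R}^2)$, and let $\rho=\arccos\langle q_0,q_1\rangle_{L^2}$. The minimizing geodesic is $$\gamma(t,s)=\frac{\sin((1-t)\rho)}{\sin\rho}q_0(s)+\frac{\sin(t\rho)}{\sin\rho}q_1(s)$$ (and $\gamma(t,\cdot)=q_0$ for all $t$ if $\rho=0$; when $2\sigma>1$ one has $\rho<\pi$). The trajectory $(\phi,\alpha)$ deduced from $\gamma$ is defined by writing $\gamma(t,s)=|\gamma(t,s)|\,(\cos\eta(t,s),\sin\eta(t,s))$ with $\eta$ continuous in $t$ and $\eta(0,s)=0$, and setting $$\phi(t,s)=\int_0^s|\gamma(t,u)|^2\,du,\qquad \alpha(t,s)=\cos(2\sigma\eta(t,s))\,a_0(s)+\sin(2\sigma\eta(t,s))\,a_0^\perp(s).$$ *)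

(* Defs.v *)
(* MathComp-Analysis *)
From HB Require Import structures.
From mathcomp Require Import all_boot all_order all_algebra.
From mathcomp Require Import all_classical all_reals all_analysis.

Set Implicit Arguments.
Unset Strict Implicit.
Unset Printing Implicit Defensive.

Import Order.TTheory GRing.Theory Num.Theory.
Import numFieldNormedType.Exports.

Local Open Scope classical_set_scope.
Local Open Scope ring_scope.

Local Notation mu := lebesgue_measure.

(* Functions on [0,1] are represented by total functions on R of which only
   the restriction to [0,1] matters; [unitI] is both the space domain Omega
   and the time interval. *)
Definition unitI (R : realType) : set R := `[0, 1]%classic.
Arguments unitI {R}.

(* The library norm on row vectors is the sup norm; Euclidean lengths are
   expressed with [dot]. *)
Definition dot (R : realType) (d : nat) (u v : 'rV[R]_d) : R :=
  \sum_(i < d) u 0 i * v 0 i.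

(* For V = 'rV_d the sup norm used here gives the same notion as the
   Euclidean norm. *)
Definition abs_continuous (R : realType) (V : normedModType R)
    (a b : R) (f : R -> V) : Prop :=
  forall e : R, 0 < e -> exists2 delta : R, 0 < delta &
    forall (n : nat) (u v : 'I_n -> R),
      (forall i, [/\ a <= u i, u i <= v i & v i <= b]) ->
      trivIset setT (fun i => `]u i, v i[%classic) ->
      \sum_(i < n) (v i - u i) < delta ->
      \sum_(i < n) `|f (v i) - f (u i)| < e.

(* Representatives of the elements of M: measurability into R^d is
   measurability of each coordinate. Measurable means Borel measurable, which
   gives the same almost-everywhere classes as Lebesgue measurability. *)
Record sphere_fun (R : realType) (d : nat) := SphereFun {
  sphere_fun_val :> R -> 'rV[R]_d ;
  sphere_fun_measurable :
    forall i : 'I_d, measurable_fun unitI (fun s => sphere_fun_val s 0 i) ;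
  sphere_fun_unit :
    forall s, unitI s -> dot (sphere_fun_val s) (sphere_fun_val s) = 1 }.

HB.instance Definition _ (R : realType) (d : nat) :=
  gen_eqMixin (sphere_fun R d).
HB.instance Definition _ (R : realType) (d : nat) :=
  gen_choiceMixin (sphere_fun R d).

Definition sphere_ae_eq (R : realType) (d : nat) (a b : sphere_fun R d) : bool :=
  `[< {ae mu, forall s, unitI s -> a s = b s} >].

Lemma sphere_ae_eq_refl (R : realType) (d : nat) :
  reflexive (@sphere_ae_eq R d).
Proof. by move=> a; apply/asboolP/aeW. Qed.

Lemma sphere_ae_eq_sym (R : realType) (d : nat) :
  symmetric (@sphere_ae_eq R d).
Proof.
move=> a b; have F := ae_filter_ringOfSetsType (@lebesgue_measure R).
apply/idP/idP => /asboolP ab; apply/asboolP;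
  by apply: filterS ab => s + Is => /(_ Is).
Qed.

Lemma sphere_ae_eq_trans (R : realType) (d : nat) :
  transitive (@sphere_ae_eq R d).
Proof.
move=> b a c /asboolP ab /asboolP bc; apply/asboolP.
have F := ae_filter_ringOfSetsType (@lebesgue_measure R).
by apply: filterS2 ab bc => s + + Is => /(_ Is) -> /(_ Is) ->.
Qed.

Canonical sphere_ae_eq_equiv (R : realType) (d : nat) :=
  EquivRel (@sphere_ae_eq R d) (@sphere_ae_eq_refl R d)
    (@sphere_ae_eq_sym R d) (@sphere_ae_eq_trans R d).

Local Open Scope quotient_scope.

Definition M (R : realType) (d : nat) : Type := {eq_quot (@sphere_ae_eq R d)}.
HB.instance Definition _ (R : realType) (d : nat) := Choice.on (M R d).
HB.instance Definition _ (R : realType) (d : nat) := EqQuotient.on (M R d).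

Record is_distance (R : realType) (T : Type) (D : T -> T -> R) : Prop := {
  is_distance_ge0 : forall x y, 0 <= D x y ;
  is_distance_eq0 : forall x y, D x y = 0 <-> x = y ;
  is_distance_sym : forall x y, D x y = D y x ;
  is_distance_triangle : forall x y z, D x z <= D x y + D y z }.

(* An absolutely continuous function is differentiable almost everywhere, so
   the default value of [derive1] elsewhere, and the values of psi outside
   [0,1], play no role; the same remark applies to the time derivatives in
   [energy] below. *)
Record in_G (R : realType) (psi : R -> R) : Prop := {
  in_G_range : forall s, unitI s -> unitI (psi s) ;
  in_G_ac : abs_continuous 0 1 psi ;
  in_G_0 : psi 0 = 0 ;
  in_G_1 : psi 1 = 1 ;
  in_G_gt0 : {ae mu, forall s, unitI s -> 0 < derive1 psi s} }.

(* [dphi t s] is the jointly measurable representative of the s-derivative of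
   [phi]; it is part of the data since its regularity in t for almost every s
   depends on the choice of the representative. *)
Record admissible (R : realType) (d : nat) (phi dphi : R -> R -> R)
    (alpha : R -> R -> 'rV[R]_d) : Prop := {
  adm_phi_measurable : measurable_fun (unitI `*` unitI : set (R * R))
    (fun p : R * R => phi p.1 p.2) ;
  adm_dphi_measurable : measurable_fun (unitI `*` unitI : set (R * R))
    (fun p : R * R => dphi p.1 p.2) ;
  adm_alpha_measurable : forall i : 'I_d,
    measurable_fun (unitI `*` unitI : set (R * R))
      (fun p : R * R => alpha p.1 p.2 0 i) ;
  adm_alpha_unit : forall t s, unitI t -> unitI s ->
    dot (alpha t s) (alpha t s) = 1 ;
  adm_phi_G : forall t, unitI t -> in_G (phi t) ;
  adm_dphi_integral : forall t s, unitI t -> unitI s ->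
    (phi t s)%:E = (\int[mu]_(u in `[0%R, s]) (dphi t u)%:E)%E ;
  adm_dphi_gt0 : {ae mu, forall s, unitI s ->
    forall t, unitI t -> 0 < dphi t s} ;
  adm_dphi_ac : {ae mu, forall s, unitI s ->
    abs_continuous 0 1 (fun t => dphi t s)} ;
  adm_alpha_ac : {ae mu, forall s, unitI s ->
    abs_continuous 0 1 (fun t => alpha t s)} }.

Definition joins (R : realType) (d : nat) (a0 a1 : sphere_fun R d)
    (phi1 : R -> R) (phi : R -> R -> R) (alpha : R -> R -> 'rV[R]_d) : Prop :=
  [/\ forall s, unitI s -> phi 0 s = s,
      forall s, unitI s -> phi 1 s = phi1 s,
      {ae mu, forall s, unitI s -> alpha 0 s = a0 s} &
      {ae mu, forall s, unitI s -> alpha 1 s = a1 (phi1 s)}].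

Definition energy (R : realType) (d : nat) (sigma : R) (dphi : R -> R -> R)
    (alpha : R -> R -> 'rV[R]_d) : \bar R :=
  (\int[mu]_(t in unitI) \int[mu]_(s in unitI)
      ((derive1 (dphi ^~ s) t ^+ 2 / dphi t s)%R)%:E
   + (sigma ^- 2)%:E *
     \int[mu]_(t in unitI) \int[mu]_(s in unitI)
       ((dot (derive1 (alpha ^~ s) t) (derive1 (alpha ^~ s) t)
         * dphi t s)%R)%:E)%E.

Definition energies (R : realType) (d : nat) (sigma : R)
    (a0 a1 : sphere_fun R d) (phi1 : R -> R) : set (\bar R) :=
  [set u | exists phi dphi alpha,
     [/\ admissible phi dphi alpha, joins a0 a1 phi1 phi alpha &
         u = energy sigma dphi alpha]].

Definition omega (R : realType) (d : nat) (a0 a1 : R -> 'rV[R]_d)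
    (phi1 : R -> R) (s : R) : R :=
  acos (dot (a0 s) (a1 (phi1 s))).

Definition angle (R : realType) (d : nat) (sigma : R) (a0 a1 : R -> 'rV[R]_d)
    (phi1 : R -> R) : R :=
  acos (\int[mu]_(s in unitI)
    (Num.sqrt (derive1 phi1 s) * cos (omega a0 a1 phi1 s / (2 * sigma)))).

Definition q0 (R : realType) : R -> R * R := fun _ => (1, 0).

Definition q1 (R : realType) (d : nat) (sigma : R) (a0 a1 : R -> 'rV[R]_d)
    (phi1 : R -> R) : R -> R * R := fun s =>
  (Num.sqrt (derive1 phi1 s) * cos (omega a0 a1 phi1 s / (2 * sigma)),
   Num.sqrt (derive1 phi1 s) * sin (omega a0 a1 phi1 s / (2 * sigma))).

Definition L2_dot (R : realType) (p q : R -> R * R) : R :=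
  \int[mu]_(s in unitI) ((p s).1 * (q s).1 + (p s).2 * (q s).2).

Definition geodesic (R : realType) (p q : R -> R * R) (t s : R) : R * R :=
  let rho := acos (L2_dot p q) in
  if rho == 0 then p s else
  (sin ((1 - t) * rho) / sin rho * (p s).1 + sin (t * rho) / sin rho * (q s).1,
   sin ((1 - t) * rho) / sin rho * (p s).2 + sin (t * rho) / sin rho * (q s).2).

Definition norm2 (R : realType) (p : R * R) : R :=
  Num.sqrt (p.1 ^+ 2 + p.2 ^+ 2).

Definition is_perp (R : realType) (d : nat) (a0 a1 : sphere_fun R d)
    (phi1 : R -> R) (a0p : sphere_fun R d) : Prop :=
  forall s, unitI s ->
    dot (a0p s) (a0 s) = 0 /\
    a1 (phi1 s) = cos (omega a0 a1 phi1 s) *: a0 s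
                  + sin (omega a0 a1 phi1 s) *: a0p s.

Definition deduced_from (R : realType) (d : nat) (sigma : R)
    (gamma : R -> R -> R * R) (a0 a0p : R -> 'rV[R]_d)
    (phi dphi : R -> R -> R) (alpha : R -> R -> 'rV[R]_d) : Prop :=
  exists eta : R -> R -> R,
    [/\ forall s, unitI s ->
          eta 0 s = 0 /\ {within unitI, continuous (fun t => eta t s)},
        forall t s, unitI t -> unitI s ->
          gamma t s = (norm2 (gamma t s) * cos (eta t s),
                       norm2 (gamma t s) * sin (eta t s)),
        forall t s, unitI t -> unitI s ->
          dphi t s = norm2 (gamma t s) ^+ 2,
        forall t s, unitI t -> unitI s ->
          phi t s = \int[mu]_(u in `[0, s]) (norm2 (gamma t u) ^+ 2) &
        forall t s, unitI t -> unitI s ->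
          alpha t s = cos (2 * sigma * eta t s) *: a0 s
                      + sin (2 * sigma * eta t s) *: a0p s].

(* [inf] is taken over a nonempty set (the identity is in G) which is bounded
   below by 0. *)
Definition d_sigma (R : realType) (d : nat) (sigma : R)
    (a0 a1 : sphere_fun R d) : R :=
  2 * inf [set angle sigma a0 a1 phi1 | phi1 in [set psi | in_G psi]].

(* The choice of representatives is immaterial provided [d_sigma] is invariant
   under almost-everywhere equality. *)
Definition d_sigma_M (R : realType) (d : nat) (sigma : R) (x y : M R d) : R :=
  d_sigma sigma (repr x) (repr y).

(* Main.v *)
Require Import Defs.
From HB Require Import structures.
From mathcomp Require Import all_boot all_order all_algebra.
From mathcomp Require Import all_classical all_reals all_analysis.
From mathcomp Require Import ring lra measurable_realfun.

Set Implicit Arguments.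
Unset Strict Implicit.
Unset Printing Implicit Defensive.

Import Order.TTheory GRing.Theory Num.Theory.
Import numFieldNormedType.Exports.

Local Open Scope classical_set_scope.
Local Open Scope ring_scope.

(** Write gamma(t, s) = sqrt(dphi(t, s)) (cos theta, sin theta), where theta(t, s)
is the angle between a0(s) and alpha(t, s) divided by 2 sigma. For each s,
|d_t gamma|^2 = (d_t dphi)^2 / (4 dphi) + dphi (d_t theta)^2 and
|d_t theta| <= |d_t alpha| / (2 sigma), so the energy is at least four times the
integral of |d_t gamma|^2. As phi(t, .) maps [0, 1] onto itself, gamma(t, .) has
norm 1 in L2; it joins q0 to q1, so the energy should be at least 4 rho^2, where
rho is the spherical distance of q0 and q1.

This lower bound is proved for each s separately, which avoids curves in L2.
For 0 < r < pi, an absolutely continuous x on [0, 1] satisfies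
  int x'^2 >= r^2 int x^2 + (r / sin r) ((x(0)^2 + x(1)^2) cos r - 2 x(0) x(1))
([wirtinger]). Applied to the coordinates of gamma ([polar_energy]) and
integrated in s, where the masses are 1, it gives
U / 4 >= r^2 + 2 (r / sin r) (cos r - cos rho), hence U >= 4 r^2 for r <= rho
([energy_ge_sqr]), and r tends to rho. The exchange of integrals rests on the
joint measurability of partial derivatives ([measurable_derive1]).

Conversely, an arc A(t) q0 + B(t) q of the unit sphere is lifted to a trajectory
by choosing the polar angle continuously, which is possible if the angle of q
stays below pi ([g_admissible], [g_joins]). Its energy is then four times the
squared length of the arc ([energy_le]). With q = q1 this applies when 2 sigma > 1 ([energy_attained]).
When 2 sigma = 1 the angle is first cut at pi - de, and the missing rotation is
added at an arbitrarily small cost ([energy_inf_le]).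

For the distance, symmetry is the change of variables by an inverse
reparametrization. The triangle inequality says that a certain combination of
three vectors has nonnegative squared length; this is linear in the inner
products and can be integrated over s ([angle_triangle]). If the distance of a
and b is 0, there are reparametrizations psi, uniformly close to the identity,
for which the integrals over [0, x] of a and b(psi) psi', that is, of a over
[0, x] and b over [0, psi x], are close; so a and b have the same primitives
([d_sigma_eq0]).

All this uses absolute continuity through the fundamental theorem of calculus
([abs_continuous_FTC]), deduced from the Jordan decomposition, Stieltjes
measures, the Radon-Nikodym theorem and Lebesgue differentiation. Elements of G
send their Stieltjes measure to Lebesgue measure, which gives changes of
variables, inverses and composites. *)

(** * Clamping to an interval *)

Section clamp.
Context {R : realType} (a b : R).

Definition clamp (x : R) : R := Num.max a (Num.min x b).

Lemma clamp_itv x : a <= b -> a <= clamp x <= b.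
Proof. by move=> ab; rewrite /clamp le_max lexx/= ge_max ab ge_min lexx orbT. Qed.

Lemma clampE x : a <= x <= b -> clamp x = x.
Proof. by move=> /andP[ax xb]; rewrite /clamp min_l// max_r. Qed.

Lemma clamp_le x y : x <= y -> clamp x <= clamp y.
Proof.
move=> xy; rewrite /clamp ge_max le_max lexx/= le_max; apply/orP; right.
by rewrite le_min !ge_min xy lexx orbT.
Qed.

Lemma clamp_contract x y : `|clamp x - clamp y| <= `|x - y|.
Proof.
wlog xy : x y / x <= y => [hw|].
  have [|/ltW] := leP x y; first exact: hw.
  by rewrite distrC (distrC x); exact: hw.
rewrite distrC (distrC x) !ger0_norm ?subr_ge0 ?clamp_le//.
rewrite /clamp; case: (leP x b) => xb; case: (leP y b) => yb;
 rewrite /Order.max; repeat case: ifP; lra.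
Qed.

Lemma continuous_clamp : continuous clamp.
Proof.
move=> x; apply/cvgrPdist_lt => /= e e0; exists e => //= y xy.
exact: le_lt_trans (clamp_contract _ _) xy.
Qed.

End clamp.

(** * From absolute continuity to a Stieltjes measure *)

Lemma abs_continuous_finType (R : realType) (V : normedModType R) (a b : R)
    (f : R -> V) : abs_continuous a b f ->
  forall e : R, 0 < e -> exists2 delta : R, 0 < delta &
    forall (I : finType) (u v : I -> R),
      (forall i, [/\ a <= u i, u i <= v i & v i <= b]) ->
      trivIset setT (fun i => `]u i, v i[%classic) ->
      \sum_i (v i - u i) < delta ->
      \sum_i `|f (v i) - f (u i)| < e.
Proof.
move=> acf e e0; have [delta d0 H] := acf e e0; exists delta => // I u v uv tI s.
have := H #|I| (u \o @enum_val I predT) (v \o @enum_val I predT).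
rewrite -(@big_enum_val _ _ _ _ predT (fun i => v i - u i)).
rewrite -(@big_enum_val _ _ _ _ predT (fun i => `|f (v i) - f (u i)|)).
apply => //; first by move=> i; exact: uv.
by move=> i j _ _ ij; apply/enum_val_inj/tI.
Qed.

(** A partition given by a list is turned into a monotone sequence that is
eventually constant, so that partitions of different lengths can be refined by
indices in a common range. *)
Lemma itv_partition_nat (R : realType) (a b : R) (f : R -> R) (s : seq R) :
  itv_partition a b s ->
  exists p : nat -> R, [/\ p 0%N = a, forall k, (size s <= k)%N -> p k = b,
    {homo p : i j / (i <= j)%N >-> i <= j} &
    forall K, (size s <= K)%N ->
      variation a b f s = \sum_(k < K) `|f (p k.+1) - f (p k)|].
Proof.
move=> abs; pose p := nth b (a :: s); exists p.
have pb k : (size s <= k)%N -> p k = b.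
  rewrite leq_eqVlt => /predU1P[<-|sk]; first exact: itv_partition_nth_size.
  by rewrite /p nth_default.
split => //.
- apply: homo_leq => //; first exact: le_trans.
  move=> k; have [sk|sk] := leqP (size s) k; first by rewrite !pb// leqW.
  by apply: (@nondecreasing_fun_itv_partition _ _ a b id s).
- move=> K sK; rewrite /variation/= -(big_mkord xpredT (fun k => `|f (p k.+1) - f (p k)|)).
  rewrite [RHS](big_cat_nat (leq0n _) sK)//= [X in _ = _ + X]big_nat [X in _ = _ + X]big1 ?addr0//.
  by move=> k /andP[sk _]; rewrite !pb ?subrr ?normr0// leqW.
Qed.

(** Subdividing each interval of a family of small total length keeps the total
length and the disjointness, so absolute continuity also controls the
variations along arbitrary subdivisions of the intervals. *)
Lemma abs_continuous_variation (R : realType) (a b : R) (f : R -> R) :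
  abs_continuous a b f ->
  forall e : R, 0 < e -> exists2 delta : R, 0 < delta &
    forall (n : nat) (u v : 'I_n -> R) (s : 'I_n -> seq R),
      (forall i, [/\ a <= u i, u i <= v i & v i <= b]) ->
      trivIset setT (fun i => `]u i, v i[%classic) ->
      \sum_i (v i - u i) < delta ->
      (forall i, itv_partition (u i) (v i) (s i)) ->
      \sum_i variation (u i) (v i) f (s i) < e.
Proof.
move=> acf e /(abs_continuous_finType acf)[delta d0 H]; exists delta => //.
move=> n u v s uv tI suv ps.
have /choice[p Hp] := fun i => itv_partition_nat f (ps i).
pose K := \max_i size (s i).
have sK i : (size (s i) <= K)%N by exact: leq_bigmax.
have puv i k : u i <= p i k /\ p i k <= v i.
  have [p0 pv ph _] := Hp i; split; first by rewrite -{1}p0 ph.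
  by rewrite -(pv (k + size (s i))%N) ?leq_addl// ph// leq_addr.
have := H ('I_n * 'I_K)%type (fun j => p j.1 j.2) (fun j => p j.1 j.2.+1).
rewrite -(pair_bigA _ (fun (i : 'I_n) (j : 'I_K) => p i j.+1 - p i j))/=.
rewrite -(pair_bigA _ (fun (i : 'I_n) (j : 'I_K) => `|f (p i j.+1) - f (p i j)|))/=.
have -> : \sum_i variation (u i) (v i) f (s i) =
    \sum_i \sum_(j < K) `|f (p i j.+1) - f (p i j)|.
  by apply: eq_bigr => i _; have [_ _ _] := Hp i; apply.
apply.
- move=> [i j]/=; have [ui iv vi] := uv i; have [p0 pv ph _] := Hp i; split.
  + by rewrite (le_trans ui)// (puv i j).1.
  + exact: ph.
  + by rewrite (le_trans _ vi)// (puv i j.+1).2.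
- move=> [i j] [i' j'] _ _ /= [z [/=]]; rewrite !in_itv/= => /andP[z1 z2] /andP[z3 z4].
  have ii' : i = i'.
    apply: tI => //; exists z; split; rewrite /= in_itv/=; apply/andP; split.
    + by rewrite (le_lt_trans _ z1)// (puv _ _).1.
    + by rewrite (lt_le_trans z2)// (puv _ _).2.
    + by rewrite (le_lt_trans _ z3)// (puv _ _).1.
    + by rewrite (lt_le_trans z4)// (puv _ _).2.
  subst i'; have [_ _ ph _] := Hp i; congr pair; apply/val_inj => /=.
  apply/eqP; rewrite eqn_leq; apply/andP; split; rewrite leqNgt; apply/negP => jj.
    by have := lt_trans z1 (lt_le_trans z4 (ph _ _ jj)); rewrite ltxx.
  by have := lt_trans z3 (lt_le_trans z2 (ph _ _ jj)); rewrite ltxx.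
- rewrite (le_lt_trans _ suv)// ler_sum// => i _.
  rewrite -(big_mkord xpredT (fun k => p i k.+1 - p i k)) telescope_sumr//.
  have [-> -> //] := Hp i.
Qed.

Lemma abs_continuous_small_total_variation (R : realType) (a b : R) (f : R -> R) :
  abs_continuous a b f ->
  exists2 delta : R, 0 < delta & forall u v, a <= u -> u <= v -> v <= b ->
    v - u < delta -> total_variation u v f \is a fin_num.
Proof.
move=> /abs_continuous_variation /(_ _ ltr01)[delta d0 H]; exists delta => //.
move=> u v au uv vb uvd; apply/bounded_variationP => //.
exists 1 => _ [s us <-].
have := H 1%N (fun=> u) (fun=> v) (fun=> s).
rewrite !big_ord1 => h; apply/ltW/h => //.
by move=> i j _ _ _; rewrite !ord1.
Qed.

(** The variation is finite on intervals shorter than the modulus for 1, and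
finitely many of these cover [a, b]: the induction advances by half a modulus. *)
Lemma abs_continuous_bounded_variation (R : realType) (a b : R) (f : R -> R) :
  a <= b -> abs_continuous a b f -> bounded_variation a b f.
Proof.
move=> ab acf; have [delta d0 H] := abs_continuous_small_total_variation acf.
apply/bounded_variationP => //.
have d20 : 0 < delta / 2 by rewrite divr_gt0.
suff h n x : a <= x -> x <= b -> x - a <= n%:R * (delta / 2) ->
    total_variation a x f \is a fin_num.
  apply: (h (Num.bound ((b - a) / (delta / 2)))) => //.
  by rewrite -ler_pdivrMr// ltW// archi_boundP// divr_ge0 ?subr_ge0// ltW.
elim: n x => [|n IH] x ax xb.
  rewrite mul0r subr_le0 => xa; have -> : x = a by apply/le_anti; rewrite xa.
  by rewrite total_variationxx.
move=> xan; pose y := Num.max a (x - delta / 2).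
have ay : a <= y by rewrite le_max lexx.
have yx : y <= x by rewrite ge_max ax gerBl ltW.
rewrite (total_variationD _ ay yx) fin_numD; apply/andP; split.
  apply: IH => //; first exact: le_trans yx xb.
  rewrite lerBlDr ge_max lerDr mulr_ge0 ?(ltW d20)//=.
  by move: xan; rewrite -natr1 mulrDl mul1r; lra.
apply: H => //; rewrite ltrBlDr -ltrBlDl.
by rewrite lt_max; apply/orP; right; lra.
Qed.

(** The variation of f over an interval is almost reached by a subdivision, to
which [abs_continuous_variation] applies. *)
Lemma abs_continuous_total_variation (R : realType) (a b : R) (f : R -> R) :
  a <= b -> abs_continuous a b f ->
  abs_continuous a b (fun x => fine (total_variation a x f)).
Proof.
move=> ab acf e e0; have bvf := abs_continuous_bounded_variation ab acf.
have e20 : 0 < e / 2 by rewrite divr_gt0.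
have [delta d0 H] := abs_continuous_variation acf e20; exists delta => //.
move=> n u v uv tI suv.
have TVfin x y : a <= x -> x <= y -> y <= b -> total_variation x y f \is a fin_num.
  move=> ax xy yb; apply/bounded_variationP => //.
  apply: (bounded_variationl xy yb); exact: (bounded_variationr ax (le_trans xy yb)).
have TVE i : `|fine (total_variation a (v i) f) - fine (total_variation a (u i) f)|
    = fine (total_variation (u i) (v i) f).
  have [ui iv vi] := uv i.
  rewrite (total_variationD f ui iv) fineD ?TVfin// ?(le_trans iv)//.
  by rewrite addrC addKr ger0_norm// fine_ge0// total_variation_ge0.
under eq_bigr do rewrite TVE.
(* Each of the n intervals may lose e / 2 / (n + 1). *)
have n0 : 0 < e / 2 / n.+1%:R by rewrite divr_gt0.
have /choice[s Hs] : forall i, exists s, itv_partition (u i) (v i) s /\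
   fine (total_variation (u i) (v i) f) <= variation (u i) (v i) f s + e / 2 / n.+1%:R.
  move=> i; have [ui iv vi] := uv i.
  have := ub_ereal_sup_adherent n0 (TVfin _ _ ui iv vi).
  case=> _ [_ [s ps <-] <-]; rewrite -/(total_variation _ _ _) => tvs.
  exists s; split => //; rewrite -lerBlDr -lee_fin EFinB fineK ?TVfin//.
  exact: ltW.
apply: (@le_lt_trans _ _ (\sum_i (variation (u i) (v i) f (s i) + e / 2 / n.+1%:R))).
  by apply: ler_sum => i _; exact: (Hs i).2.
rewrite big_split/= sumr_const card_ord [ltRHS]splitr ltr_leD//.
  by apply: H => // i; exact: (Hs i).1.
by rewrite -[leLHS]mulr_natr -[leLHS]mulrA ger_pMr// mulrC ler_pdivrMr// mul1r ler_nat.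
Qed.

Lemma abs_continuous_uniform (R : realType) (V : normedModType R) (a b : R) (f : R -> V) :
  abs_continuous a b f -> forall e : R, 0 < e ->
  exists2 delta : R, 0 < delta & forall u v, a <= u <= b -> a <= v <= b ->
    `|v - u| < delta -> `|f v - f u| < e.
Proof.
move=> acf e e0; have [delta d0 H] := acf e e0; exists delta => // u v.
wlog uv : u v / u <= v => [hw uab vab|/andP[au ub] /andP[av vb]].
  have [|/ltW vu] := leP u v; first by move=> uv; exact: hw.
  by rewrite distrC [in X in _ -> X]distrC; apply: hw.
rewrite ger0_norm ?subr_ge0// => vud.
have := H 1%N (fun=> u) (fun=> v); rewrite !big_ord1; apply => //.
by move=> i j _ _ _; rewrite !ord1.
Qed.

(** A nondecreasing absolutely continuous g defines a Lebesgue-Stieltjes measure,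
once extended by constants outside [a, b]. A null set lies in an open set of
small measure, which is a countable union of disjoint intervals; absolute
continuity bounds the increments of g over them. Hence the Stieltjes measure
is dominated by Lebesgue measure. *)
Section stieltjes_of_abs_continuous.
Context {R : realType} (a b : R) (g : R -> R).
Hypotheses (ab : a < b) (acg : abs_continuous a b g)
  (ndg : {in `[a, b] &, {homo g : x y / x <= y}}).
Local Notation mu := (@lebesgue_measure R).

Let clamp := clamp a b.
Let clamp_itv x : a <= clamp x <= b. Proof. exact/clamp_itv/ltW. Qed.
Let clampE x : a <= x <= b -> clamp x = x. Proof. exact: clampE. Qed.
Let clamp_le x y : x <= y -> clamp x <= clamp y. Proof. exact: clamp_le. Qed.
Let clamp_contract x y : `|clamp x - clamp y| <= `|x - y|. Proof. exact: clamp_contract. Qed.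

Let G x := g (clamp x).

Let G_nd : {homo G : x y / x <= y}.
Proof.
by move=> x y xy; apply: ndg; rewrite ?in_itv/= ?clamp_itv//; exact: clamp_le.
Qed.

Let G_cts : continuous G.
Proof.
move=> x; apply/cvgrPdist_lt => /= e e0.
have [delta d0 H] := abs_continuous_uniform acg e0.
exists delta => //= y xy; apply: H; rewrite ?clamp_itv//.
exact: le_lt_trans (clamp_contract _ _) xy.
Qed.

Let G_rc : right_continuous G. Proof. exact/right_continuousW. Qed.

Let Gc : cumulative R R := HB.pack G (isCumulative.Build R _ R G G_nd G_rc).

Let nu0 : {measure set (measurableTypeR R) -> \bar R} := lebesgue_stieltjes_measure Gc.

Let nu0E x y : x <= y -> nu0 `]x, y]%classic = (G y - G x)%:E.
Proof.
move=> xy; rewrite /nu0/= /lebesgue_stieltjes_measure /measure_extension.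
rewrite measurable_mu_extE/=; last exact: is_ocitv.
by rewrite wlength_itv_bnd.
Qed.

Let open_itv_hull (J : set R) : open J -> is_interval J -> J `<=` `]a - 1, b + 1[ ->
  exists u v, [/\ u <= v, J `<=` `]u, v] & `]u, v[ `<=` J].
Proof.
move=> oJ iJ Jab; have [->|/set0P[x0 Jx0]] := eqVneq J set0.
  by exists a, a; split => //; rewrite set_itvoo0.
have hl : has_inf J.
  by split; [exists x0|exists (a - 1) => x /Jab/=; rewrite in_itv/= => /andP[/ltW]].
have hu : has_sup J.
  by split; [exists x0|exists (b + 1) => x /Jab/=; rewrite in_itv/= => /andP[_ /ltW]].
have JE : J = `]inf J, sup J[%classic.
  have := interval_bounded_interior iJ hl.2 hu.2.
  rewrite ((interior_id J).1 oJ) => JE; rewrite {1}JE.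
  by apply/seteqP; split => x /=; rewrite in_itv.
exists (inf J), (sup J); split.
- by apply: (@le_trans _ _ x0); [apply: ge_inf => //; case: hl|apply: ub_le_sup => //; case: hu].
- by rewrite {1}JE; exact: subset_itv_oo_oc.
- by rewrite [X in _ `<=` X]JE.
Qed.

Let nu0_dom A : measurable A -> mu A = 0%E -> A `<=` `]a, b] -> nu0 A = 0%E.
Proof.
move=> mA A0 Aab; apply/eqP; rewrite eq_le measure_ge0 andbT.
apply/lee_addgt0Pr => e e0; rewrite add0e.
have [delta d0 H] := acg e0.
have muA : (mu A < +oo)%E by rewrite A0.
have [U0 [oU0 AU0 muU0]] := lebesgue_regularity_outer mA muA d0.
pose U := U0 `&` `]a - 1, b + 1[%classic.
have oU : open U by apply: openI => //; exact: itv_open.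
have AU : A `<=` U.
  move=> x Ax; split; first exact: AU0.
  by have := Aab x Ax; rewrite /= !in_itv/= => /andP[? ?]; apply/andP; split; lra.
have muU : (mu U < delta%:E)%E.
  apply: le_lt_trans muU0; apply: (@le_trans _ _ (mu A + mu (U0 `\` A))%E); last first.
    by rewrite [X in (X + _)%E](A0 : _ = 0%E) add0e.
  apply: le_trans (measureU2 _ _ _) => //; last first.
    by apply: measurableD => //; exact: open_measurable.
  apply: le_measure; rewrite ?inE; [exact: open_measurable| |].
    by apply: measurableU => //; apply: measurableD => //; exact: open_measurable.
  by move=> x [U0x _]; have [|] := pselect (A x); [left|right].
pose I := open_disjoint_itv oU.
have IU i : I i `<=` U by rewrite [X in _ `<=` X](open_disjoint_itv_bigcup oU); exact: bigcup_sup.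
have mI i : measurable (I i) by apply: open_measurable; exact: open_disjoint_itv_open.
have /choice[w Hw] : forall i, exists uv : R * R,
    [/\ uv.1 <= uv.2, I i `<=` `]uv.1, uv.2] & `]uv.1, uv.2[ `<=` I i].
  move=> i; have [u [v uv]] := open_itv_hull (@open_disjoint_itv_open _ _ oU i)
    (@open_disjoint_itv_is_interval _ _ oU i) (subset_trans (@IU i) (@subIsetr _ _ _)).
  by exists (u, v).
apply: (@le_trans _ _ (nu0 U)).
  by apply: le_measure; rewrite ?inE//; exact: open_measurable.
have mUE (m : {measure set (measurableTypeR R) -> \bar R}) :
    m U = (\sum_(i <oo) m (I i))%E.
  rewrite {1}(open_disjoint_itv_bigcup oU) measure_bigcup.
  - by apply: eq_eseriesl => i; rewrite in_setT.
  - by move=> i _; exact: mI.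
  - exact: open_disjoint_itv_trivIset.
rewrite mUE; apply: lime_le; first exact: is_cvg_nneseries.
apply: nearW => n; rewrite big_mkord.
apply: (@le_trans _ _ (\sum_(i < n) (G (w i).2 - G (w i).1)%:E)%E).
  apply: lee_sum => i _; rewrite -nu0E; last by case: (Hw i).
  by have [_ s _] := Hw i; apply: le_measure => //; rewrite inE; [exact: mI|exact: measurable_itv].
rewrite sumEFin lee_fin; apply/ltW.
have -> : \sum_(i < n) (G (w i).2 - G (w i).1) =
    \sum_(i < n) `|g (clamp (w i).2) - g (clamp (w i).1)|.
  by apply: eq_bigr => i _; rewrite ger0_norm// subr_ge0; apply: G_nd; case: (Hw i).
apply: (H n (fun i => clamp (w i).1) (fun i => clamp (w i).2)).
- move=> i; have [w12 _ _] := Hw i; split; rewrite ?clamp_le//.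
  + by case/andP: (clamp_itv (w i).1).
  + by case/andP: (clamp_itv (w i).2).
- move=> i j _ _ [z []] /=; rewrite !in_itv/= => /andP[iz zi] /andP[jz zj].
  have clz : clamp z = z.
    apply: clampE; rewrite (le_trans _ (ltW iz)) ?(le_trans (ltW zi))//.
      by case/andP: (clamp_itv (w i).2).
    by case/andP: (clamp_itv (w i).1).
  have lt k : clamp (w k).1 < z -> z < clamp (w k).2 -> I k z.
    have [_ _ s] := Hw k; move=> kz zk; apply: s; rewrite /= in_itv/=; apply/andP; split.
      by rewrite ltNge; apply/negP => /clamp_le; rewrite clz leNgt kz.
    by rewrite ltNge; apply/negP => /clamp_le; rewrite clz leNgt zk.
  by apply/val_inj; apply: (@open_disjoint_itv_trivIset _ _ oU) => //; exists z; split; exact: lt.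
- rewrite -lte_fin; apply: le_lt_trans muU; rewrite -sumEFin.
  apply: (@le_trans _ _ (\sum_(i < n) mu (I i))%E).
    apply: lee_sum => i _; have [w12 _ s] := Hw i.
    apply: (@le_trans _ _ (mu `](w i).1, (w i).2[%classic)).
      rewrite lebesgue_measure_itv/= lte_fin; case: ifPn => [_|].
        rewrite -EFinB lee_fin (le_trans (ler_norm _))// (le_trans (clamp_contract _ _))//.
        by rewrite ger0_norm// subr_ge0.
      rewrite -leNgt => w21; have -> : (w i).1 = (w i).2 by apply/le_anti; rewrite w12.
      by rewrite subrr.
    by apply: le_measure => //; rewrite inE; [exact: measurable_itv|exact: mI].
  by rewrite mUE -(big_mkord xpredT (mu \o I)); apply: nneseries_lim_ge.
Qed.

Let nu0_lty : (nu0 `]a, b]%classic < +oo)%E.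
Proof. by rewrite nu0E ?ltry// ltW. Qed.

Let nu : {finite_measure set (measurableTypeR R) -> \bar R} :=
  @mfrestr _ (measurableTypeR R) R `]a, b]%classic nu0 (measurable_itv `]a, b]) nu0_lty.

Lemma stieltjes_of_abs_continuous :
  exists nu : {finite_measure set (measurableTypeR R) -> \bar R},
    [/\ nu `<< mu,
        forall x y, a <= x -> x <= y -> y <= b -> nu `]x, y]%classic = (g y - g x)%:E &
        nu (~` `]a, b]%classic) = 0%E].
Proof.
exists nu; split.
- apply/null_content_dominatesP => A mA A0; apply: nu0_dom.
  + exact: measurableI.
  + by apply: (subset_measure0 _ _ _ A0) => //; exact: measurableI.
  + exact: subIsetr.
- move=> x y ax xy yb; rewrite /nu/= /mfrestr /mrestr setIidl; last first.
    by move=> z/=; rewrite !in_itv/= => /andP[xz zy]; apply/andP; split; lra.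
  by rewrite nu0E// /G !clampE// ?ax ?yb ?(le_trans xy)// (le_trans ax).
- by rewrite /nu/= /mfrestr /mrestr setICl measure0.
Qed.

End stieltjes_of_abs_continuous.

(** * The fundamental theorem of calculus *)

(** The density of g is the Radon-Nikodym derivative of its Stieltjes measure. *)
Lemma nondecreasing_abs_continuous_density (R : realType) (a b : R) (g : R -> R) :
  a < b -> abs_continuous a b g -> {in `[a, b] &, {homo g : x y / x <= y}} ->
  exists h : R -> R, [/\ (@lebesgue_measure R).-integrable setT (EFin \o h),
    forall x, 0 <= h x &
    forall x, a <= x <= b -> g x = g a + \int[lebesgue_measure]_(t in `[a, x]) h t].
Proof.
move=> ab acg ndg; have [nu [nud nuE _]] := stieltjes_of_abs_continuous ab acg ndg.
have [f [f0 ffin fint fE]] := radon_nikodym_sigma_finite nud.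
have fK : EFin \o (fine \o f) = f by apply/funext => x /=; rewrite fineK.
exists (fine \o f); split; first by rewrite fK.
- by move=> x; rewrite /= fine_ge0.
- move=> x /andP[ax xb].
  rewrite -Rintegral_itv_obnd_cbnd; last first.
    by apply: (@integrableS _ _ _ _ setT) => //; rewrite fK.
  rewrite /Rintegral (_ : (\int[_]_(t in _) _)%E = nu `]a, x]%classic); last first.
    by rewrite fE//; apply: eq_integral => t _; rewrite /= fineK.
  rewrite nuE// ?lexx//=.
  by rewrite addrC subrK.
Qed.

Lemma derive1_integral_ae (R : realType) (a b : R) (F h : R -> R) :
  (@lebesgue_measure R).-integrable setT (EFin \o h) ->
  (forall x, a <= x <= b -> F x = F a + \int[lebesgue_measure]_(t in `[a, x]) h t) ->
  {ae lebesgue_measure, forall x, a < x < b -> derivable F x 1 /\ derive1 F x = h x}.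
Proof.
move=> ih hE; set mu := @lebesgue_measure R.
have loch : locally_integrable setT h by apply: open_integrable_locally => //; exact: openT.
have iy y : mu.-integrable [set` Interval (BLeft a) (BRight y)] (EFin \o h).
  exact: integrableS ih.
have := FTC1 iy loch.
apply: filterS; first exact: (ae_filter_ringOfSetsType mu).
move=> x /= H /andP[ax xb]; have [|d1 d2] := H; first by rewrite (_ : (_ < _)%O = (a <= x)) ?ltW.
have nE : {near x, F =1 (fun y => F a + \int[mu]_(t in `[a, y]) h t)}.
  near=> y; apply: hE; apply/andP; split.
  - by near: y; exact: lt_le_nbhsr.
  - by near: y; exact: lt_le_nbhsl.
have d3 : derivable (fun y => F a + \int[mu]_(t in `[a, y]) h t) x 1 by exact: derivableD.
split.
  by apply: near_eq_derivable d3; apply: filterS nE => y ->.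
rewrite derive1E (near_eq_derive _ nE)//.
rewrite (_ : (fun y => _) = cst (F a) + (fun y => \int[mu]_(t in `[a, y]) h t))//.
by rewrite deriveD// derive_cst add0r -derive1E.
Unshelve. all: by end_near. Qed.

(** Jordan decomposition: both the variation function and its difference with F
are nondecreasing and absolutely continuous, hence have densities. Lebesgue
differentiation identifies the difference of these with the derivative. *)
Lemma abs_continuous_FTC (R : realType) (a b : R) (F : R -> R) :
  a < b -> abs_continuous a b F ->
  exists h : R -> R, [/\ (@lebesgue_measure R).-integrable setT (EFin \o h),
    forall x, a <= x <= b -> F x = F a + \int[lebesgue_measure]_(t in `[a, x]) h t &
    {ae lebesgue_measure, forall x, a < x < b -> derivable F x 1 /\ derive1 F x = h x}].
Proof.
move=> ab acF; set mu := @lebesgue_measure R.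
have bvF := abs_continuous_bounded_variation (ltW ab) acF.
pose V x := fine (total_variation a x F).
have acV : abs_continuous a b V by exact: abs_continuous_total_variation (ltW ab) acF.
have TVfin x y : a <= x -> x <= y -> y <= b -> total_variation x y F \is a fin_num.
  move=> ax xy yb; apply/bounded_variationP => //.
  by apply: (bounded_variationl xy yb); exact: (bounded_variationr ax (le_trans xy yb)).
have VB x y : a <= x -> x <= y -> y <= b -> `|F y - F x| <= V y - V x.
  move=> ax xy yb; rewrite /V (total_variationD F ax xy) fineD ?TVfin ?(le_trans xy)//.
  rewrite [leRHS]addrC addKr -lee_fin fineK ?TVfin//.
  exact: total_variation_ge.
have acVF : abs_continuous a b (fun x => V x - F x).
  move=> e e0; have e20 : 0 < e / 2 by rewrite divr_gt0.
  have [d1 d10 H1] := acV _ e20; have [d2 d20 H2] := acF _ e20.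
  exists (Num.min d1 d2); first by rewrite lt_min d10.
  move=> n u v uv tI; rewrite lt_min => /andP[s1 s2].
  rewrite [ltRHS]splitr; apply: le_lt_trans (ltrD (H1 _ _ _ uv tI s1) (H2 _ _ _ uv tI s2)).
  rewrite -big_split/= ler_sum// => i _.
  have -> : V (v i) - F (v i) - (V (u i) - F (u i)) =
    (V (v i) - V (u i)) - (F (v i) - F (u i)) by ring.
  exact: ler_normB.
have ndV : {in `[a, b] &, {homo V : x y / x <= y}}.
  move=> x y; rewrite !in_itv/= => /andP[ax _] /andP[_ yb] xy.
  by rewrite -subr_ge0 (le_trans _ (VB _ _ ax xy yb)).
have ndVF : {in `[a, b] &, {homo (fun x => V x - F x) : x y / x <= y}}.
  move=> x y; rewrite !in_itv/= => /andP[ax _] /andP[_ yb] xy.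
  by have /ler_normlP[_] := VB _ _ ax xy yb; lra.
have [h1 [ih1 _ h1E]] := nondecreasing_abs_continuous_density ab acV ndV.
have [h2 [ih2 _ h2E]] := nondecreasing_abs_continuous_density ab acVF ndVF.
pose h x := h1 x - h2 x.
have ih : mu.-integrable setT (EFin \o h).
  rewrite [X in _.-integrable _ X](_ : _ = (EFin \o h1) \- (EFin \o h2))%E//.
  exact: integrableB.
have hE x : a <= x <= b -> F x = F a + \int[mu]_(t in `[a, x]) h t.
  move=> axb; rewrite RintegralB//; [|exact: integrableS ih1|exact: integrableS ih2].
  by have := h1E _ axb; have := h2E _ axb; rewrite -/mu; lra.
exists h; split => //; exact: derive1_integral_ae.
Qed.

(** * Measurability of partial derivatives *)

Lemma dnbhs0_invS (R : realType) : (fun n => n.+1%:R^-1 : R) @ \oo --> (0 : R)^'.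
Proof.
move=> A [e/= e0 eA]; suff : \forall n \near \oo, A (n.+1%:R^-1) by [].
have := near_infty_natSinv_lt (PosNum e0); apply: filterS => n ne.
by apply: eA; rewrite /= ?invr_neq0// sub0r normrN ger0_norm.
Qed.

(** By continuity off 0, convergence at 0 is a Cauchy condition on rational
increments, which involves countably many measurable sets. On that set the
limit is the limit along 1 / (n + 1), elsewhere it is the default point. *)
Lemma measurable_lim_dnbhs0 (R : realType) (d : measure_display)
    (T : measurableType d) (Q : R -> T -> R) :
  (forall h, measurable_fun setT (Q h)) ->
  (forall x h, h != 0 -> {for h, continuous (Q ^~ x)}) ->
  measurable_fun setT (fun x => lim (Q h x @[h --> 0^'])).
Proof.
move=> mQ cQ.
pose rq i : R := ratr (odflt 0 (@unpickle rat i)).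
pose small n i := (rq i != 0) && (`|rq i| < n.+1%:R^-1).
pose D := \bigcap_k \bigcup_n \bigcap_i \bigcap_j
  [set x | small n i && small n j ==> (`|Q (rq i) x - Q (rq j) x| <= k.+1%:R^-1)].
have mD : measurable D.
  apply: bigcapT_measurable => k; apply: bigcupT_measurable => n.
  apply: bigcapT_measurable => i; apply: bigcapT_measurable => j.
  case: (small n i && small n j) => /=; last first.
    by rewrite (_ : [set _ | _] = setT)//; apply/seteqP; split.
  rewrite (_ : [set _ | _] = setT `&`
    (fun x => `|Q (rq i) x - Q (rq j) x| <= k.+1%:R^-1) @^-1` [set true]).
    apply: (@measurable_fun_ler _ _ _ setT _ (cst k.+1%:R^-1)) => //.
    by apply: measurableT_comp => //; exact: measurable_funB.
  by rewrite setTI; apply/seteqP; split => x /=.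
(* D is the set where the rational values satisfy the Cauchy criterion at 0. *)
have cvgD x : cvg (Q h x @[h --> 0^']) -> D x.
  move=> /cvg_ex[l /cvgrPdist_lt Hl] k _.
  have k0 : (0 : R) < k.+1%:R^-1 / 2 by rewrite divr_gt0.
  have [e/= e0 He] := Hl _ k0.
  have [n ne] : exists n, n.+1%:R^-1 < e.
    by have [n _ /(_ n (leqnn n))] := near_infty_natSinv_lt (PosNum e0); exists n.
  exists n => // i _ j _ /=; apply/implyP => /andP[/andP[i0 ile] /andP[j0 jle]].
  have Hi : `|l - Q (rq i) x| < k.+1%:R^-1 / 2.
    by apply: He => //=; rewrite sub0r normrN (lt_trans ile).
  have Hj : `|l - Q (rq j) x| < k.+1%:R^-1 / 2.
    by apply: He => //=; rewrite sub0r normrN (lt_trans jle).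
  apply: ltW; rewrite (splitr k.+1%:R^-1) (_ : _ - _ = (l - Q (rq j) x) - (l - Q (rq i) x)); last by ring.
  by rewrite (le_lt_trans (ler_normB _ _))// ltrD.
have Dcvg x : D x -> cvg (Q h x @[h --> 0^']).
  move=> Dx; apply: cauchy_cvg; apply: cauchy_exP => e e0.
  have [k ke] : exists k, k.+1%:R^-1 < e.
    by have [n _ /(_ n (leqnn n))] := near_infty_natSinv_lt (PosNum e0); exists n.
  have [n _ Hn] := Dx k I.
  have [i Hi] : exists i, rq i = n.+2%:R^-1.
    by exists (pickle (n.+2%:R^-1 : rat)); rewrite /rq pickleK/= fmorphV rmorph_nat.
  have si : small n i.
    by rewrite /small Hi invr_neq0//= ger0_norm// ltf_pV2 ?posrE// ltr_nat.
  exists (Q (rq i) x); exists n.+1%:R^-1; first by rewrite /= invr_gt0.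
  move=> h /= hn h0; rewrite sub0r normrN in hn.
  rewrite /ball/=; apply: le_lt_trans ke; rewrite leNgt; apply/negP => kQ.
  have cQi : {for h, continuous (fun h => `|Q (rq i) x - Q h x|)}.
    by apply: cvg_norm; apply: cvgB; [exact: cvg_cst|exact: cQ].
  have nQ : \forall h' \near h, [/\ k.+1%:R^-1 < `|Q (rq i) x - Q h' x|,
      `|h'| < n.+1%:R^-1 & h' != 0].
    near=> h'; split; near: h'.
    - exact: (cvgr_gt _ cQi).
    - by apply: (cvgr_lt _ (cvg_norm (@cvg_id _ (nbhs h)))).
    - by apply: (@cvgr_neq0 _ _ _ (nbhs h) _ id h (@cvg_id _ _) h0).
  have : nbhs h _ := nQ; rewrite nbhsE => [[W [oW Wh] WH]].
  have [z [Wz [q _ qz]]] := @dense_rat R W (ex_intro _ h Wh) oW.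
  have [z1 z2 z3] := WH _ Wz.
  have := Hn i I (pickle q) I; rewrite /= si/= /small.
  have -> : rq (pickle q) = z by rewrite /rq pickleK.
  by rewrite z3 z2/= leNgt z1.
rewrite -(setUv D); apply/measurable_funU => //; first exact: measurableC.
split.
- apply: (@measurable_fun_cvg _ _ _ D (fun n => Q n.+1%:R^-1)).
    by move=> n; exact: measurable_funTS.
  move=> x /Dcvg cx; exact: (cvg_comp (fun n => n.+1%:R^-1) (Q ^~ x) (@dnbhs0_invS R) cx).
- apply: (@eq_measurable_fun _ _ _ _ _ (cst point)) => // x.
  by rewrite inE => Dx; apply/esym/dvgP => /cvgD.
Unshelve. all: by end_near. Qed.

(** Joint measurability of a partial derivative, which is a limit of difference
quotients along the rationals wherever it exists. *)
Lemma measurable_derive1 (R : realType) (d : measure_display)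
    (T : measurableType d) (F : R -> T -> R) :
  measurable_fun setT (fun p : R * T => F p.1 p.2) ->
  (forall s, continuous (F ^~ s)) ->
  measurable_fun setT (fun p : R * T => derive1 (F ^~ p.2) p.1).
Proof.
move=> mF cF.
pose Q (h : R) (p : R * T) := h^-1 * (F (h + p.1) p.2 - F p.1 p.2).
apply: (@measurable_lim_dnbhs0 _ _ _ Q).
- move=> h; apply: measurable_funM => //; apply: measurable_funB => //.
  apply: (measurableT_comp mF (g := fun p : R * T => (h + p.1, p.2))) => //.
  apply/measurable_fun_pairP; split; last exact: measurable_snd.
  by apply: measurable_funD => //; exact: measurable_fst.
- move=> p k k0; apply: cvgM; first exact: cvgV.
  apply: cvgB; last exact: cvg_cst.
  apply: (cvg_comp (fun k => k + p.1) (F ^~ p.2)); last exact: cF.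
  by apply: cvgD; [exact: cvg_id|exact: cvg_cst].
Qed.

(** * Absolutely continuous functions: permanence properties *)

Local Notation mu := lebesgue_measure.

Lemma abs_continuous_dominated (R : realType) (V1 V2 W : normedModType R)
    (a b K : R) (f : R -> V1) (g : R -> V2) (F : R -> W) : 0 <= K ->
  abs_continuous a b f -> abs_continuous a b g ->
  (forall u v, a <= u -> u <= v -> v <= b ->
    `|F v - F u| <= K * (`|f v - f u| + `|g v - g u|)) ->
  abs_continuous a b F.
Proof.
move=> K0 acf acg HF e e0.
pose e' := e / (2 * (K + 1)).
have K1 : 0 < K + 1 by rewrite ltr_wpDl.
have e'0 : 0 < e' by rewrite divr_gt0// mulr_gt0.
have [d1 d10 H1] := acf _ e'0; have [d2 d20 H2] := acg _ e'0.
exists (Num.min d1 d2); first by rewrite lt_min d10.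
move=> n u v uv tI; rewrite lt_min => /andP[/(H1 n u v uv tI) s1 /(H2 n u v uv tI) s2].
apply: (@le_lt_trans _ _ (\sum_(i < n) (K * (`|f (v i) - f (u i)| + `|g (v i) - g (u i)|)))).
  by apply: ler_sum => i _; have [? ? ?] := uv i; exact: HF.
rewrite -mulr_sumr big_split/=.
apply: (@le_lt_trans _ _ (K * (e' + e'))); first by rewrite ler_wpM2l// lerD// ltW.
have -> : e = (K + 1) * (e' + e') by rewrite /e'; field; rewrite gt_eqF.
by rewrite ltr_pM2r ?addr_gt0// ltrDl.
Qed.

Lemma abs_continuous_lipschitz (R : realType) (V : normedModType R)
    (a b K : R) (F : R -> V) : 0 <= K ->
  (forall u v, a <= u -> u <= v -> v <= b -> `|F v - F u| <= K * (v - u)) ->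
  abs_continuous a b F.
Proof.
move=> K0 HF e e0; have K1 : 0 < K + 1 by rewrite ltr_wpDl.
exists (e / (K + 1)); first by rewrite divr_gt0.
move=> n u v uv tI; rewrite ltr_pdivlMr// mulrC => s; apply: le_lt_trans s.
apply: (@le_trans _ _ (\sum_(i < n) (K * (v i - u i)))).
  by apply: ler_sum => i _; have [? ? ?] := uv i; exact: HF.
rewrite -mulr_sumr ler_wpM2r ?lerDl// sumr_ge0// => i _.
by have [_ + _] := uv i; rewrite subr_ge0.
Qed.

Lemma abs_continuous_within (R : realType) (a b : R) (F : R -> R) :
  a < b -> abs_continuous a b F -> {within `[a, b], continuous F}.
Proof.
move=> ab acF; have H := abs_continuous_uniform acF.
apply/(continuous_within_itvP _ ab); split.
- move=> x; rewrite in_itv/= => /andP[ax xb].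
  apply/cvgrPdist_lt => e e0; have [d d0 Hd] := H e e0; near=> y.
  apply: Hd; last by near: y; exists d.
  + apply/andP; split; near: y; [exact: lt_le_nbhsr|exact: lt_le_nbhsl].
  + by rewrite !ltW.
- apply/cvgrPdist_lt => e e0; have [d d0 Hd] := H e e0; near=> y.
  rewrite distrC; apply: Hd; first by rewrite lexx ltW.
  + by apply/andP; split; near: y; [exact: nbhs_right_ge|exact: nbhs_right_le].
  + rewrite ger0_norm; last by rewrite subr_ge0; near: y; exact: nbhs_right_ge.
    rewrite ltrBlDl; near: y; apply: nbhs_right_lt; by rewrite ltrDl.
- apply/cvgrPdist_lt => e e0; have [d d0 Hd] := H e e0; near=> y.
  apply: Hd; last 2 first.
  + by rewrite lexx ltW.
  + rewrite ger0_norm; last by rewrite subr_ge0; near: y; exact: nbhs_left_le.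
    rewrite ltrBlDl -ltrBlDr; near: y; apply: nbhs_left_gt; by rewrite ltrBlDr ltrDl.
  + by apply/andP; split; near: y; [exact: nbhs_left_ge|exact: nbhs_left_le].
Unshelve. all: by end_near. Qed.

Lemma abs_continuous_bounded (R : realType) (a b : R) (F : R -> R) :
  a < b -> abs_continuous a b F -> exists2 M, 0 <= M & forall x, a <= x <= b -> `|F x| <= M.
Proof.
move=> ab acF; have cF := abs_continuous_within ab acF.
have [c1 _ H1] := EVT_max (ltW ab) cF; have [c2 _ H2] := EVT_min (ltW ab) cF.
exists (`|F c1| + `|F c2|) => // x xab.
have h1 := H1 x; have h2 := H2 x; rewrite in_itv/= xab in h1 h2.
have := h1 isT; have := h2 isT.
have := ler_norm (F c1); have := ler_norm (- F c2); rewrite normrN => *.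
by rewrite ler_norml; apply/andP; split; have := normr_ge0 (F c1); have := normr_ge0 (F c2); lra.
Qed.

Lemma abs_continuousM (R : realType) (a b : R) (f g : R -> R) : a < b ->
  abs_continuous a b f -> abs_continuous a b g -> abs_continuous a b (fun x => f x * g x).
Proof.
move=> ab acf acg.
have [M1 M10 HM1] := abs_continuous_bounded ab acf.
have [M2 M20 HM2] := abs_continuous_bounded ab acg.
apply: (@abs_continuous_dominated _ _ _ _ _ _ (M1 + M2) f g) => //; first exact: addr_ge0.
move=> u v au uv vb.
have -> : f v * g v - f u * g u = (f v - f u) * g v + f u * (g v - g u) by ring.
rewrite (le_trans (ler_normD _ _))// !normrM.
have h2 := HM2 v; have h1 := HM1 u; rewrite au (le_trans uv)// in h1.
rewrite vb (le_trans au)// in h2.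
have := ler_wpM2l (normr_ge0 (f v - f u)) (h2 isT).
have := ler_wpM2r (normr_ge0 (g v - g u)) (h1 isT).
have := mulr_ge0 M10 (normr_ge0 (f v - f u)).
have := mulr_ge0 M20 (normr_ge0 (g v - g u)).
lra.
Qed.

Lemma EFin_Rintegral (d : measure_display) (T : measurableType d) (R : realType)
    (m : {measure set T -> \bar R}) (D : set T) (f : T -> R) :
  measurable D -> m.-integrable D (EFin \o f) ->
  (\int[m]_(x in D) f x)%:E = (\int[m]_(x in D) (f x)%:E)%E.
Proof. by move=> mD intf; rewrite /Rintegral fineK//; exact: integrable_fin_num. Qed.

(** This is the absolute continuity of the Lebesgue integral; the increments of F
need only be bounded by integrals of |h|. *)
Lemma abs_continuous_integral (R : realType) (a b : R) (h F : R -> R) :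
  (@lebesgue_measure R).-integrable `[a, b] (EFin \o h) ->
  (forall u v, a <= u -> u <= v -> v <= b ->
    (`|F v - F u|%:E <= \int[lebesgue_measure]_(x in `]u, v[) `|h x|%:E)%E) ->
  abs_continuous a b F.
Proof.
move=> ih HF e e0;
pose hab := h \_ `[a, b].
have ihab : mu.-integrable setT (EFin \o hab).
  by rewrite /hab -restrict_EFin; apply/integrable_restrict => //=; rewrite setTI.
have [d [d0 Hd]] := integral_normr_continuous ihab e0.
exists d => // n u v uv tI suv.
pose A := \big[setU/set0]_(i < n) `]u i, v i[%classic.
have mA : measurable A by exact: bigsetU_measurable.
have muA : (mu A < d%:E)%E.
  have [_ muA] : measurable A /\ (mu A <= \sum_(i < n) mu `]u i, v i[%classic)%E.
    rewrite /A; apply: (big_ind2 (fun X y => measurable X /\ (mu X <= y)%E)).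
    - by split; [exact: measurable0|rewrite measure0].
    - move=> X x Y y [mX Xx] [mY Yy]; split; first exact: measurableU.
      by rewrite (le_trans (measureU2 _ _ _))// leeD.
    - by move=> i _; split.
  rewrite (le_lt_trans muA)// (eq_bigr (fun i => (v i - u i)%:E)) ?sumEFin ?lte_fin//.
  move=> i _; rewrite lebesgue_measure_itv/= lte_fin; have [_ + _] := uv i.
  by rewrite le_eqVlt => /predU1P[->|->]; rewrite ?ltxx ?subrr.
rewrite -lte_fin; have := Hd A mA muA; rewrite -lte_fin; apply: le_lt_trans.
have mhab : measurable_fun setT hab by case/integrableP : ihab => /measurable_EFinP.
have mnhab D : measurable_fun D (fun x => `|hab x|%:E).
  by apply/measurable_EFinP; apply: measurable_funTS; exact: measurableT_comp.
rewrite EFin_Rintegral//; last by apply: (@integrable_norm _ _ _ mu _ hab); exact: integrableS ihab.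
rewrite ge0_integral_bigsetU//=.
- rewrite -sumEFin; apply: lee_sum => i _; have [aui uvi vib] := uv i.
  apply: (le_trans (HF _ _ aui uvi vib)).
  rewrite le_eqVlt; apply/orP; left; apply/eqP/eq_integral => x.
  rewrite inE/= in_itv/= => /andP[ux xv]; rewrite /hab patchE mem_set//=.
  by rewrite in_itv/= (le_trans aui (ltW ux)) (le_trans (ltW xv)).
- exact: index_enum_uniq.
- by move=> i j _ _; exact: tI.
- exact: mnhab.
Qed.

(** * Increasing absolutely continuous homeomorphisms *)

#[local] Instance ae_lebesgue_filter (R : realType) :
  Filter (almost_everywhere (@lebesgue_measure R)).
Proof. exact: ae_filter_ringOfSetsType. Qed.

Lemma ae_itv_false (R : realType) (a b : R) :
  {ae mu, forall x, a < x < b -> False} -> b <= a.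
Proof.
move=> [N [mN N0 HN]]; rewrite leNgt; apply/negP => ab.
have : (mu `]a, b[%classic <= mu N)%E.
  apply: le_measure; rewrite ?inE//.
  by move=> x; rewrite /= in_itv/= => xab; apply: HN => /= /(_ xab).
by rewrite N0 lebesgue_measure_itv/= lte_fin ab lee_fin leNgt subr_gt0 ab.
Qed.

Lemma measurable_unitI (R : realType) : measurable (@unitI R).
Proof. exact: measurable_itv. Qed.

Lemma sub_unitI (R : realType) (x : R) : 0 <= x <= 1 -> `[0, x] `<=` @unitI R.
Proof.
move=> /andP[_ x1] s; rewrite /unitI/= !in_itv/= => /andP[-> sx]/=; exact: le_trans x1.
Qed.

Lemma ae_unitI_oo (R : realType) (P : R -> Prop) :
  {ae mu, forall x, 0 < x < 1 -> P x} -> {ae mu, forall x, unitI x -> P x}.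
Proof.
move=> aeP; have n1 (c : R) : (@lebesgue_measure R).-negligible [set c].
  by exists [set c]; split => //; exact: lebesgue_measure_set1.
apply: negligibleS (negligibleU aeP (negligibleU (n1 0) (n1 1))).
move=> x /= nP; have [/andP[x0 x1]|x01] := boolP (0 < x < 1).
  by left => /= H; apply: nP => _; exact: H.
right; have [xI|xI] := pselect (unitI x); last by exfalso; apply: nP.
move: xI x01; rewrite /unitI/= in_itv/= => /andP[].
rewrite le_eqVlt => /predU1P[<- _ _|->]; first by left.
by rewrite le_eqVlt => /predU1P[->|->//]; right.
Qed.

Lemma measure_setI_conull (d : measure_display) (T : measurableType d) (R : realType)
    (m : {measure set T -> \bar R}) (A D : set T) :
  measurable A -> measurable D -> m (~` D) = 0%E -> m A = m (A `&` D).
Proof.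
move=> mA mD D0; apply/eqP; rewrite eq_le; apply/andP; split; last first.
  by apply: le_measure; rewrite ?inE//; exact: measurableI.
apply: (@le_trans _ _ (m (A `&` D) + m (~` D))%E); last by rewrite D0 adde0.
apply: le_trans (measureU2 _ _ _); [|exact: measurableI|exact: measurableC].
apply: le_measure; rewrite ?inE//.
  by apply: measurableU; [exact: measurableI|exact: measurableC].
by move=> x Ax; have [Dx|Dx] := pselect (D x); [left|right].
Qed.

(** An element psi of G is a homeomorphism of [0, 1] that sends its own Stieltjes
measure, of density psi', to Lebesgue measure. Change of variables, and the
fact that null sets have null preimages, both follow from this image measure
identity. *)
Section in_G_theory.
Context {R : realType} (psi : R -> R).
Hypothesis Gpsi : in_G psi.

(** Strictness comes from the derivative being positive almost everywhere on an
interval of positive length. *)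
Lemma in_G_lt x y : 0 <= x -> x < y -> y <= 1 -> psi x < psi y.
Proof.
move=> x0 xy y1; have [h [ih hE dh]] := abs_continuous_FTC ltr01 (in_G_ac Gpsi).
have h0 : {ae mu, forall t, 0 < t < 1 -> 0 < h t}.
  apply: filterS2 dh (in_G_gt0 Gpsi) => t + + t01 => /(_ t01)[_ <-]; apply.
  by rewrite /unitI/= in_itv/=; case/andP: t01 => /ltW -> /ltW ->.
rewrite hE ?x0 ?(ltW (lt_le_trans xy _))// [ltRHS]hE ?y1 ?(le_trans x0 (ltW xy))//.
rewrite ltrD2l -subr_gt0 Rintegral_itvB; last 3 first.
- exact: integrableS ih.
- by rewrite bnd_simp.
- by rewrite bnd_simp ltW.
have hn : {ae mu, forall t, `]x, y]%classic t -> `|(h t)%:E|%E = (h t)%:E}.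
  apply: filterS (ae_unitI_oo h0) => t + /=; rewrite in_itv/= => ht /andP[xt ty].
  rewrite gtr0_norm// ht// /unitI/= in_itv/=.
  by rewrite (le_trans x0 (ltW xt)) (le_trans ty).
have mh D : measurable D -> measurable_fun D (EFin \o h).
  by move=> mD; apply: measurable_funTS; case/integrableP : ih.
rewrite -lte_fin EFin_Rintegral//; last exact: integrableS ih.
have <- : (\int[mu]_(t in `]x, y]) `|(h t)%:E| = \int[mu]_(t in `]x, y]) (h t)%:E)%E.
  apply: ae_eq_integral => //; last exact: mh.
  by apply: measurableT_comp => //; exact: mh.
rewrite lt_neqAle integral_ge0 ?andbT//; apply/eqP => /esym.
move/(ae_eq_integral_abs mu (measurable_itv `]x, y]) (mh _ (measurable_itv _))).1 => hz.
have : y <= x; last by rewrite leNgt xy.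
apply: ae_itv_false; apply: filterS2 hz h0 => t /= + + /andP[xt ty].
rewrite in_itv/= xt ltW// => /(_ isT)[->].
by rewrite (le_lt_trans x0 xt) (lt_le_trans ty)// ltxx => /(_ isT).
Qed.

Lemma in_G_le x y : 0 <= x -> x <= y -> y <= 1 -> psi x <= psi y.
Proof.
move=> x0; rewrite le_eqVlt => /predU1P[->//|xy] y1; apply/ltW; exact: in_G_lt.
Qed.

Lemma in_G_ltE x y : 0 <= x <= 1 -> 0 <= y <= 1 -> (psi x < psi y) = (x < y).
Proof.
move=> /andP[x0 x1] /andP[y0 y1]; apply/idP/idP; last by move=> h; exact: in_G_lt.
by apply: contraTT; rewrite -!leNgt => h; exact: in_G_le.
Qed.

Lemma in_G_inj x y : 0 <= x <= 1 -> 0 <= y <= 1 -> psi x = psi y -> x = y.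
Proof.
move=> /andP[x0 x1] /andP[y0 y1] xy; case: (ltgtP x y) => // h.
- by have := in_G_lt x0 h y1; rewrite xy ltxx.
- by have := in_G_lt y0 h x1; rewrite xy ltxx.
Qed.

Lemma in_G_01 x : 0 <= x <= 1 -> 0 <= psi x <= 1.
Proof. by move=> x01; have := @in_G_range _ _ Gpsi x; rewrite /unitI/= !in_itv/=; exact. Qed.

Lemma in_G_continuous : {within `[0, 1], continuous psi}.
Proof. exact: (abs_continuous_within ltr01 (in_G_ac Gpsi)). Qed.

Lemma in_G_surj u : 0 <= u <= 1 -> exists2 x, 0 <= x <= 1 & psi x = u.
Proof.
move=> u01; have [|x xI <-] := IVT (@ler01 R) in_G_continuous (v := u).
  by rewrite (in_G_0 Gpsi) (in_G_1 Gpsi) min_l// max_r.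
by exists x => //; rewrite in_itv in xI.
Qed.

Let clamp := clamp (0 : R) 1.
Let clamp01 x : 0 <= clamp x <= 1. Proof. exact: clamp_itv. Qed.
Let clampE x : 0 <= x <= 1 -> clamp x = x. Proof. exact: clampE. Qed.

Let clamp_lt x v : 0 < v <= 1 -> (clamp x < v) = (x < v).
Proof.
by move=> /andP[v0 v1]; rewrite gt_max v0/= gt_min; case: (leP 1 v) => v2; lra.
Qed.

Let clamp_ge x v : 0 < v <= 1 -> (v <= clamp x) = (v <= x).
Proof. by move=> /andP[v0 v1]; rewrite le_max leNgt v0/= le_min v1 andbT. Qed.

Let clamp_itv x y : `]x, y] `&` `]0, 1] = `]clamp x, clamp y]%classic.
Proof.
apply/seteqP; split => z /=; rewrite !in_itv/=.
  by move=> [/andP[xz zy] z01]; rewrite clamp_lt// clamp_ge// xz.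
move=> /andP[xz zy]; have z01 : 0 < z <= 1.
  by case/andP: (clamp01 x) (clamp01 y) => x0 _ /andP[_ y1]; rewrite (le_lt_trans x0)// (le_trans zy).
by move: xz zy; rewrite clamp_lt// clamp_ge// => -> ->.
Qed.

(* The extension of psi by constants outside the unit interval is monotone,
   hence Borel. *)
Let psic x := psi (clamp x).

Let psic_nd : {homo psic : x y / x <= y}.
Proof.
move=> x y xy; have /andP[x0 x1] := clamp01 x; have /andP[y0 y1] := clamp01 y.
by apply: in_G_le => //; exact: clamp_le.
Qed.

Let mpsic : measurable_fun setT psic.
Proof. by apply: nondecreasing_measurable => // x y _ _; exact: psic_nd. Qed.

Lemma in_G_measurable : measurable_fun unitI psi.
Proof.
apply: (eq_measurable_fun psic); last exact: measurable_funTS.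
by move=> x; rewrite inE /unitI/= in_itv/= => x01; rewrite /psic clampE.
Qed.

Let psic_preimage (nu : {measure set (measurableTypeR R) -> \bar R}) x y :
  nu (~` `]0%R, 1%R]%classic) = 0%E ->
  (forall x y, 0 <= x -> x <= y -> y <= 1 -> nu `]x, y]%classic = (psi y - psi x)%:E) ->
  nu (psic @^-1` `]x, y]) = mu (`]x, y] `&` `]0, 1]).
Proof.
move=> nu0 nuE; have [yx|xy] := leP y x.
  by rewrite set_itv_ge ?bnd_simp -?leNgt// preimage_set0 set0I !measure0.
have [p p01 px] := in_G_surj (clamp01 x); have [q q01 qy] := in_G_surj (clamp01 y).
have cxy : clamp x <= clamp y by exact/clamp_le/ltW.
have pq : p <= q.
  rewrite leNgt; apply/negP => qp; case/andP: p01 => _ p1; case/andP: q01 => q0 _.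
  by have := in_G_lt q0 qp p1; rewrite px qy ltNge cxy.
have mpre : measurable (psic @^-1` `]x, y]).
  by rewrite -[X in measurable X]setTI; exact: mpsic.
rewrite (@measure_setI_conull _ (measurableTypeR R) _ nu _ _ mpre (measurable_itv `]0, 1]) nu0).
have -> : psic @^-1` `]x, y] `&` `]0, 1] = `]p, q]%classic.
  apply/seteqP; split => s /=; rewrite !in_itv/=.
    move=> [/andP[xs sy] /andP[s0 s1]]; have s01 : 0 <= s <= 1 by rewrite ltW.
    have ps01 : 0 < psi s <= 1.
      by rewrite -{1}(in_G_0 Gpsi) in_G_lt//=; case/andP: (in_G_01 s01).
    rewrite /psic clampE// in xs sy.
    by rewrite -in_G_ltE// px clamp_lt// xs/= leNgt -in_G_ltE// qy -leNgt clamp_ge.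
  move=> /andP[ps sq]; have s0 : 0 < s by case/andP: p01 => /le_lt_trans ->.
  have s1 : s <= 1 by case/andP: q01 => _; exact: le_trans.
  have s01 : 0 <= s <= 1 by rewrite ltW.
  have ps01 : 0 < psi s <= 1.
    by rewrite -{1}(in_G_0 Gpsi) in_G_lt//=; case/andP: (in_G_01 s01).
  rewrite s0 s1; split => //; rewrite /psic clampE//.
  move: ps sq; rewrite -in_G_ltE// px clamp_lt// => ->/=.
  by rewrite leNgt -in_G_ltE// qy -leNgt clamp_ge.
rewrite nuE//; [|by case/andP: p01|by case/andP: q01].
rewrite clamp_itv lebesgue_measure_itv/= lte_fin px qy; case: ltP => // h.
have -> : clamp x = clamp y by apply/le_anti; rewrite cxy.
by rewrite subrr.
Qed.

Let pushforward_unitI (nu : {measure set (measurableTypeR R) -> \bar R}) A :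
  measurable A -> nu (~` `]0%R, 1%R]%classic) = 0%E ->
  (forall x y, 0 <= x -> x <= y -> y <= 1 -> nu `]x, y]%classic = (psi y - psi x)%:E) ->
  nu (psic @^-1` A) = mu (A `&` `]0, 1]).
Proof.
move=> mA nu0 nuE.
have mpsicR : @measurable_fun _ _ (measurableTypeR R) (measurableTypeR R) setT psic.
  exact: mpsic.
pose m2 : {measure set (measurableTypeR R) -> \bar R} :=
  mrestr (@lebesgue_measure R) (measurableC (measurable_itv `]0%R, 1%R])).
pose m1 : {measure set (measurableTypeR R) -> \bar R} :=
  @pushforward _ _ (measurableTypeR R) (measurableTypeR R) _ nu psic.
pose m : {measure set (measurableTypeR R) -> \bar R} := measure_add (m1 mpsicR) m2.
have mE B : m B = (nu (psic @^-1` B) + mu (B `&` ~` `]0%R, 1%R]))%E.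
  by rewrite [LHS]measure_addE.
have mpre B : measurable B -> measurable (psic @^-1` B).
  by move=> mB; rewrite -[X in measurable X]setTI; exact: mpsic.
have H : forall B, measurable B -> mu B = m B.
  apply: lebesgue_measure_unique => _ [[x y] _ <-] /=; rewrite mE.
  by rewrite psic_preimage// addeC -setDE; apply: measureDI.
have := H (A `&` `]0, 1]) (measurableI _ _ mA (measurable_itv _)); rewrite mE.
rewrite -setIA setICr setI0 measure0 adde0 => ->.
rewrite [LHS](@measure_setI_conull _ (measurableTypeR R) _ nu _ _ (mpre _ mA) (measurable_itv `]0, 1]) nu0).
rewrite [RHS](@measure_setI_conull _ (measurableTypeR R) _ nu _ _ _ (measurable_itv `]0, 1]) nu0); last first.
  by apply: mpre; exact: measurableI.
congr (nu _); apply/seteqP; split => s /= [ps s01]; split => //; last by case: ps.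
split => //; move: s01; rewrite !in_itv/= => /andP[s0 s1].
have s01 : 0 <= s <= 1 by rewrite ltW.
rewrite /psic clampE//; case/andP: (in_G_01 s01) => _ ->; rewrite andbT.
by rewrite -{1}(in_G_0 Gpsi) in_G_lt.
Qed.

Lemma in_G_density : exists nu : {finite_measure set (measurableTypeR R) -> \bar R},
  [/\ nu `<< mu,
      {ae mu, forall s, unitI s -> derivable psi s 1 /\
        Radon_Nikodym_SigmaFinite.f nu mu s = (derive1 psi s)%:E},
      nu (~` `]0%R, 1%R]%classic) = 0%E,
      forall x, 0 <= x <= 1 -> nu `]0%R, x]%classic = (psi x)%:E &
      forall A, measurable A -> nu (psic @^-1` A) = mu (A `&` `]0, 1])].
Proof.
have nd : {in `[0, 1] &, {homo psi : x y / x <= y}}.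
  by move=> x y; rewrite !in_itv/= => /andP[x0 _] /andP[_ y1] xy; exact: in_G_le.
have [nu [nud nuE nu0]] := stieltjes_of_abs_continuous ltr01 (in_G_ac Gpsi) nd.
exists nu; split => //; last by move=> A mA; exact: pushforward_unitI.
- set f := Radon_Nikodym_SigmaFinite.f nu mu.
  have fK : EFin \o (fine \o f) = f.
    by apply/funext => x /=; rewrite fineK//; exact: Radon_Nikodym_SigmaFinite.f_fin_num.
  have fint := Radon_Nikodym_SigmaFinite.f_integrable nud.
  have psiE x : 0 <= x <= 1 -> psi x = psi 0 + \int[mu]_(t in `[0, x]) (fine \o f) t.
    move=> /andP[x0 x1]; rewrite -Rintegral_itv_obnd_cbnd; last first.
      by apply: (@integrableS _ _ _ _ setT) => //; rewrite fK.
    rewrite /Rintegral (_ : (\int[_]_(t in _) _)%E = nu `]0, x]%classic); last first.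
      rewrite (Radon_Nikodym_SigmaFinite.f_integral nud)//; apply: eq_integral => t _.
      by rewrite -[RHS]/(f t) -fK.
    by rewrite nuE// ?lexx//= addrC subrK.
  have /= := @derive1_integral_ae R 0 1 psi (fine \o f).
  rewrite fK => /(_ fint psiE) H; apply: ae_unitI_oo; apply: filterS H => s + s01.
  move=> /(_ s01)[ds ->]; split => //=; rewrite fineK//.
  exact: Radon_Nikodym_SigmaFinite.f_fin_num.
- move=> x /andP[x0 x1]; by rewrite nuE// ?lexx// (in_G_0 Gpsi) subr0.
Qed.

Let psic_cts : continuous psic.
Proof.
have H := abs_continuous_uniform (in_G_ac Gpsi).
move=> x; apply/cvgrPdist_lt => /= e e0; have [delta d0 Hd] := H _ e0.
exists delta => //= y xy; apply: Hd; rewrite ?clamp01//.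
exact: le_lt_trans (clamp_contract _ _ _ _) xy.
Qed.

Lemma in_G_derive1_measurable : measurable_fun unitI (derive1 psi).
Proof.
have H : measurable_fun setT (fun p : R * unit => derive1 psic p.1).
  apply: (@measurable_derive1 _ _ unit (fun t _ => psic t)) => [|_]; last exact: psic_cts.
  by apply: (measurableT_comp mpsic); exact: measurable_fst.
have mD : measurable_fun setT (derive1 psic).
  apply: (measurableT_comp H (g := fun t : R => (t, tt))).
  by apply/measurable_fun_pairP; split => /=; [exact: measurable_id|exact: measurable_cst].
rewrite /unitI; apply: (measurable_fun_itv_cc (b0 := false) (b1 := true)).
apply: (eq_measurable_fun (derive1 psic)); last exact: measurable_funTS.
move=> x; rewrite inE/= in_itv/= => /andP[x0 x1].
rewrite !derive1E; apply: near_eq_derive; near=> y; rewrite /psic clampE//.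
by apply/andP; split; near: y; [exact: lt_le_nbhsr|exact: lt_le_nbhsl].
Unshelve. all: by end_near. Qed.

(** The preimage of a null set has measure zero for the Stieltjes measure, whose
density is positive almost everywhere, so it is a null set as well. *)
Lemma in_G_ae_comp (P : R -> Prop) : {ae mu, forall u, unitI u -> P u} ->
  {ae mu, forall s, unitI s -> P (psi s)}.
Proof.
move=> [N [mN N0 HN]]; have [nu [nud dpsi nu0 nuE nup]] := in_G_density.
have mpN : measurable (psic @^-1` N) by rewrite -[X in measurable X]setTI; exact: mpsic.
have muN : nu (psic @^-1` N) = 0%E.
  by rewrite nup//; apply: (subset_measure0 _ _ _ N0) => //; exact: measurableI.
have RN0 := Radon_Nikodym_SigmaFinite.f_ge0 nud.
have mRN : measurable_fun (psic @^-1` N) (Radon_Nikodym_SigmaFinite.f nu mu).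
  by apply: measurable_funTS; apply: measurable_int (Radon_Nikodym_SigmaFinite.f_integrable nud).
have : (\int[mu]_(x in psic @^-1` N) `|Radon_Nikodym_SigmaFinite.f nu mu x| = 0)%E.
  rewrite -[RHS]muN (Radon_Nikodym_SigmaFinite.f_integral nud)//.
  by apply: eq_integral => x _; rewrite gee0_abs.
move/(ae_eq_integral_abs mu mpN mRN).1 => H.
apply: filterS3 H dpsi (in_G_gt0 Gpsi) => s Hs ds ds0 sI.
apply: contrapT => nP; have s01 : 0 <= s <= 1 by move: sI; rewrite /unitI/= in_itv.
have := Hs (ltac:(rewrite /= /psic clampE//; apply: HN => /= /(_ (in_G_range Gpsi sI)); exact: nP)).
have [_ ->] := ds sI; move=> [d0]; by have := ds0 sI; rewrite d0 ltxx.
Qed.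

Lemma in_G_change_of_variables (f : R -> \bar R) x : 0 <= x <= 1 ->
  measurable_fun setT f -> (forall u, (0 <= f u)%E) ->
  (\int[mu]_(s in `]0%R, x]) (f (psi s) * (derive1 psi s)%:E) =
   \int[mu]_(u in `]0%R, psi x]) f u)%E.
Proof.
move=> x01 mf f0; have [nu [nud dpsi nu0 nuE nup]] := in_G_density.
have mpsicR : @measurable_fun _ _ (measurableTypeR R) (measurableTypeR R) setT psic.
  exact: mpsic.
have mpre B : measurable B -> measurable (psic @^-1` B).
  by move=> mB; rewrite -[X in measurable X]setTI; exact: mpsic.
pose m1 : {measure set (measurableTypeR R) -> \bar R} :=
  @pushforward _ _ (measurableTypeR R) (measurableTypeR R) _ nu psic.
transitivity (\int[m1 mpsicR]_(u in `]0%R, psi x]) f u)%E; last first.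
  apply: eq_measure_integral => A mA AD; rewrite [LHS]nup// setIidl// => u /AD/=.
  rewrite !in_itv/= => /andP[-> upx]; rewrite (le_trans upx)//.
  by case/andP: (in_G_01 x01).
rewrite (ge0_integral_pushforward mpsicR)//; last exact: measurable_funTS.
rewrite (@ge0_negligible_integral _ (measurableTypeR R) _ nu _ (~` `]0%R, 1%R])) //; last 4 first.
- exact: measurableC.
- exact: mpre.
- by apply: measurable_funTS; exact: measurableT_comp.
- by move=> y _; exact: f0.
have -> : psic @^-1` `]0, psi x] `\` ~` `]0, 1] = `]0, x]%classic.
  rewrite setDE setCK; case/andP: (x01) => x0 x1.
  apply/seteqP; split => s /=; rewrite !in_itv/=.
    move=> [/andP[_ sx] /andP[s0 s1]]; rewrite s0/=.
    have s01 : 0 <= s <= 1 by rewrite ltW.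
    by move: sx; rewrite /psic clampE// leNgt in_G_ltE// -leNgt.
  move=> /andP[s0 sx]; have s1 := le_trans sx x1.
  have s01 : 0 <= s <= 1 by rewrite ltW.
  rewrite s0 s1 /psic clampE//; split => //; rewrite -{1}(in_G_0 Gpsi) in_G_lt//=.
  by rewrite in_G_le// ltW.
have mfp D : measurable_fun D (f \o psic).
  by apply: measurable_funTS; exact: measurableT_comp.
rewrite -(Radon_Nikodym_SigmaFinite.change_of_variables nud)//; last 2 first.
  by move=> y; exact: f0.
  exact: mfp.
apply: ae_eq_integral => //.
- apply: emeasurable_funM; last first.
    apply/measurable_EFinP; apply: (@measurable_funS _ _ _ _ unitI) in_G_derive1_measurable.
      exact: measurable_unitI.
    move=> s/=; rewrite /unitI/= !in_itv/= => /andP[s0 sx]; case/andP: x01 => _ x1; lra.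
  apply: (eq_measurable_fun (f \o psic)) => // s.
  rewrite inE/= in_itv/= => /andP[s0 sx]; rewrite /psic clampE//.
  by case/andP: x01 => _ x1; apply/andP; split; lra.
- apply: emeasurable_funM; first exact: mfp.
  apply: measurable_funTS; exact: measurable_int (Radon_Nikodym_SigmaFinite.f_integrable nud).
- apply: filterS dpsi => s + /=; rewrite in_itv/= => ds /andP[s0 sx].
  have s01 : 0 <= s <= 1 by case/andP: x01 => _ x1; apply/andP; split; lra.
  by rewrite /psic/= clampE//; have [_ ->] := ds (ltac:(by rewrite /unitI/= in_itv)).
Qed.
End in_G_theory.

Lemma measurable_invr (R : realType) : measurable_fun setT (fun x : R => x^-1).
Proof.
have D0 : measurable [set x : R | x != 0].
  by rewrite (_ : [set _ | _] = ~` [set 0]); [exact: measurableC|apply/seteqP; split => x /= /eqP].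
rewrite -(setUv [set x : R | x != 0]); apply/measurable_funU => //; first exact: measurableC.
split.
- apply: open_continuous_measurable_fun; first exact: open_neq.
  by move=> x; rewrite inE/= => x0; exact: inv_continuous.
- apply: (@eq_measurable_fun _ _ _ _ _ (cst (0 : R))) => // x.
  by rewrite inE/= => /negP; rewrite negbK => /eqP ->; rewrite invr0.
Qed.

Lemma measurable_sqrtr (R : realType) : measurable_fun setT (@Num.sqrt R).
Proof. by apply: continuous_measurable_fun; exact: sqrt_continuous. Qed.

Lemma in_G_id (R : realType) : in_G (@idfun R).
Proof.
split => //.
- apply: (@abs_continuous_lipschitz _ _ _ _ 1) => // u v _ uv _.
  by rewrite mul1r ger0_norm// subr_ge0.
- by apply: aeW => s _; rewrite derive1_id.
Qed.

(** The inverse has the candidate density 1 / psi'(chi u): changing variables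
shows that its integral over [0, psi x] is x, so chi is absolutely continuous
with that derivative. *)
Lemma in_G_inverse (R : realType) (psi : R -> R) : in_G psi ->
  exists chi, [/\ in_G chi, forall u, unitI u -> psi (chi u) = u,
    forall s, unitI s -> chi (psi s) = s &
    {ae mu, forall s, unitI s -> 0 < derive1 psi s /\
      derive1 chi (psi s) = (derive1 psi s)^-1}].
Proof.
move=> Gpsi; pose clamp := clamp (0 : R) 1.
have clamp01 x : 0 <= clamp x <= 1 by exact: clamp_itv.
have /choice[chi Hchi] : forall u, exists x, 0 <= x <= 1 /\ psi x = clamp u.
  by move=> u; have [x ? ?] := in_G_surj Gpsi (clamp01 u); exists x.
have chi01 u : 0 <= chi u <= 1 by case: (Hchi u).
have psichi u : 0 <= u <= 1 -> psi (chi u) = u.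
  by move=> u01; rewrite (Hchi u).2 /clamp clampE.
have chipsi s : 0 <= s <= 1 -> chi (psi s) = s.
  by move=> s01; apply: (in_G_inj Gpsi) => //; rewrite psichi//; exact: in_G_01.
have chi_nd : {homo chi : x y / x <= y}.
  move=> x y xy; rewrite leNgt -(in_G_ltE Gpsi)// (Hchi x).2 (Hchi y).2 -leNgt.
  exact: clamp_le.
have mchi : measurable_fun setT chi.
  by apply: nondecreasing_measurable => // x y _ _; exact: chi_nd.
have mDchi : measurable_fun setT (fun u => derive1 psi (chi u)).
  apply: (@measurable_comp _ _ _ _ _ _ unitI) mchi; first exact: measurable_unitI.
    by move=> _ [u _ <-]; rewrite /unitI/= in_itv; exact: chi01.
  exact: in_G_derive1_measurable.
(* The value 1 on the exceptional set only serves to keep k positive. *)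
pose k u := if 0 < derive1 psi (chi u) then (derive1 psi (chi u))^-1 else 1.
have k0 u : 0 < k u by rewrite /k; case: ifP => // h; rewrite invr_gt0.
have mk : measurable_fun setT k.
  apply: measurable_fun_ifT => //; first exact: measurable_fun_ltr.
  by apply: (measurableT_comp (@measurable_invr R)).
have kE : {ae mu, forall s, unitI s -> k (psi s) * derive1 psi s = 1}.
  apply: filterS (in_G_gt0 Gpsi) => s + sI => /(_ sI) ds.
  by rewrite /k chipsi ?ds ?mulVf ?gt_eqF.
have intk x : 0 <= x <= 1 -> (\int[mu]_(u in `]0%R, psi x]) (k u)%:E = x%:E)%E.
  move=> x01; rewrite -(in_G_change_of_variables Gpsi x01); last 2 first.
    exact/measurable_EFinP. by move=> u; rewrite lee_fin ltW.
  rewrite (ae_eq_integral (cst 1%E)) //.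
  - rewrite integral_cst// mul1e [LHS](lebesgue_measure_itv `]0, x])/= lte_fin.
    case/andP: x01; rewrite le_eqVlt => /predU1P[<-|-> _]; rewrite ?ltxx//.
    by rewrite sube0.
  - apply: (eq_measurable_fun (fun s => (k (psi s) * derive1 psi s)%:E)) => //.
    have s1 : `]0, x] `<=` @unitI R.
      move=> s; rewrite /unitI/= !in_itv/= => /andP[s0 sx]; rewrite ltW//=.
      by case/andP: x01 => _; exact: le_trans.
    apply/measurable_EFinP/measurable_funM.
      apply: (measurableT_comp mk); exact: (measurable_funS (@measurable_unitI R) s1 (in_G_measurable Gpsi)).
    exact: (measurable_funS (@measurable_unitI R) s1 (in_G_derive1_measurable Gpsi)).
  - apply: filterS kE => s + /=; rewrite in_itv/= => ks /andP[s0 sx].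
    rewrite -EFinM ks// /unitI/= in_itv/= ltW//=.
    by case/andP: x01 => _; exact: le_trans.
have intkchi u : 0 <= u <= 1 -> (\int[mu]_(t in `]0%R, u]) (k t)%:E = (chi u)%:E)%E.
  by move=> u01; rewrite -{1}(psichi u)// intk.
have ik : mu.-integrable `[0, 1] (EFin \o k).
  apply/integrableP; split; first by apply/measurable_EFinP; exact: measurable_funTS.
  under eq_integral do rewrite /= gtr0_norm//.
  rewrite -integral_itv_obnd_cbnd; last by apply/measurable_EFinP; exact: measurable_funTS.
  by rewrite intkchi ?ltry// lexx ler01.
have chiB u v : 0 <= u -> u <= v -> v <= 1 ->
    (\int[mu]_(t in `]u, v[) (k t)%:E = (chi v - chi u)%:E)%E.
  move=> u0; rewrite le_eqVlt => /predU1P[<- _|uv v1].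
    by rewrite set_itvoo0 integral_set0 subrr.
  rewrite integral_itv_bndo_bndc; last by apply/measurable_EFinP; exact: measurable_funTS.
  have v0 : 0 <= v by rewrite (le_trans u0)// ltW.
  have := intkchi v; rewrite v0 v1 => /(_ isT).
  rewrite (@itv_bndbnd_setU _ _ _ (BRight u))//; last by rewrite bnd_simp ltW.
  rewrite ge0_integral_setU//=; last 3 first.
  - by apply/measurable_EFinP; exact: measurable_funTS.
  - by move=> t _; rewrite lee_fin ltW.
  - apply/disj_setPLR => z/=; rewrite !in_itv/= => /andP[_ zu].
    by apply/negP; rewrite negb_and -leNgt zu.
  rewrite intkchi ?u0 ?(le_trans (ltW uv))//.
  by move=> /(congr1 (fun x => x - (chi u)%:E)%E); rewrite [X in (X - _)%E = _ -> _]addeC addeK.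
have chi0 : chi 0 = 0 by rewrite -{1}(in_G_0 Gpsi) chipsi// lexx ler01.
have chi1 : chi 1 = 1 by rewrite -{1}(in_G_1 Gpsi) chipsi// lexx ler01.
have dchi : {ae mu, forall u, unitI u -> derive1 chi u = k u}.
  have ik' : mu.-integrable setT (EFin \o (k \_ `[0, 1])).
    by rewrite -restrict_EFin; apply/integrable_restrict => //=; rewrite setTI.
  have := derive1_integral_ae ik' (F := chi) (a := 0) (b := 1).
  move=> H; apply: ae_unitI_oo; apply: filterS (H _) => [u + u01|x x01].
    move=> /(_ u01)[_ ->]; rewrite patchE mem_set//= in_itv/=.
    by case/andP: u01 => /ltW -> /ltW ->.
  rewrite chi0 add0r; apply: EFin_inj; rewrite -intkchi//.
  rewrite EFin_Rintegral//; last exact: integrableS ik'.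
  rewrite -integral_itv_obnd_cbnd; last by apply: measurable_funTS; case/integrableP: ik'.
  apply: eq_integral => t; rewrite inE/= in_itv/= => /andP[t0 tx].
  rewrite patchE mem_set//= in_itv/= ltW//=; case/andP: x01 => _; exact: le_trans.
exists chi; split.
- split => //.
  + by move=> s _; rewrite /unitI/= in_itv; exact: chi01.
  + apply: (abs_continuous_integral ik) => u v u0 uv v1.
    rewrite ger0_norm ?subr_ge0 ?chi_nd// -chiB//.
    rewrite le_eqVlt; apply/orP; left; apply/eqP/eq_integral => t _.
    by rewrite gtr0_norm.
  + by apply: filterS dchi => u + uI => ->.
- by move=> u; rewrite /unitI/= in_itv; exact: psichi.
- by move=> u; rewrite /unitI/= in_itv; exact: chipsi.
- apply: filterS3 (in_G_ae_comp Gpsi dchi) kE (in_G_gt0 Gpsi) => s h1 h2 h3 sI.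
  split; first exact: h3.
  by rewrite h1// -[LHS]mulr1 -(mulfV (lt0r_neq0 (h3 sI))) mulrA h2// mul1r.
Qed.

Lemma in_G_derivable (R : realType) (psi : R -> R) : in_G psi ->
  {ae mu, forall s, unitI s -> derivable psi s 1}.
Proof.
move=> /in_G_density[nu [_ + _ _ _]]; apply: filterS => s + sI => /(_ sI)[].
by [].
Qed.

(** The inner function maps disjoint intervals of small total length to disjoint
intervals of small total length, so absolute continuity is preserved. The chain
rule holds where both derivatives exist, almost everywhere by [in_G_ae_comp]. *)
Lemma in_G_comp (R : realType) (psi1 psi2 : R -> R) : in_G psi1 -> in_G psi2 ->
  in_G (psi2 \o psi1) /\ {ae mu, forall s, unitI s ->
    derive1 (psi2 \o psi1) s = derive1 psi2 (psi1 s) * derive1 psi1 s}.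
Proof.
move=> G1 G2.
have chain : {ae mu, forall s, unitI s ->
    derive1 (psi2 \o psi1) s = derive1 psi2 (psi1 s) * derive1 psi1 s}.
  apply: filterS2 (in_G_derivable G1) (in_G_ae_comp G1 (in_G_derivable G2)) => s + + sI.
  by move=> /(_ sI) d1 /(_ sI) d2; exact: derive1_comp.
split; last exact: chain.
split.
- by move=> s sI; apply: (in_G_range G2); exact: (in_G_range G1).
- move=> e e0; have [d2 d20 H2] := in_G_ac G2 e0; have [d1 d10 H1] := in_G_ac G1 d20.
  exists d1 => // n u v uv tI suv.
  have uv1 i : [/\ 0 <= psi1 (u i), psi1 (u i) <= psi1 (v i) & psi1 (v i) <= 1].
    have [ui iv vi] := uv i.
    have /andP[? _] : 0 <= psi1 (u i) <= 1 by rewrite in_G_01// ui (le_trans iv).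
    have /andP[_ ?] : 0 <= psi1 (v i) <= 1 by rewrite in_G_01// vi (le_trans ui).
    by split => //; exact: in_G_le.
  apply: H2 => //.
  + move=> i j _ _ [z [/=]]; rewrite !in_itv/= => /andP[iz zi] /andP[jz zj].
    have z01 : 0 <= z <= 1.
      have [h1 _ _] := uv1 i; have [_ _ h2] := uv1 i.
      by apply/andP; split; lra.
    have [w w01 wz] := in_G_surj G1 z01; rewrite -wz in iz zi jz zj.
    have u01 k : 0 <= u k <= 1 by have [? ? ?] := uv k; apply/andP; split; lra.
    have v01 k : 0 <= v k <= 1 by have [? ? ?] := uv k; apply/andP; split; lra.
    rewrite !in_G_ltE// in iz zi jz zj.
    by apply: tI => //; exists w; split; rewrite /= in_itv/=; apply/andP.
  + rewrite (le_lt_trans _ (H1 n u v uv tI suv))// ler_sum// => i _.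
    exact: ler_norm.
- by rewrite /= (in_G_0 G1) (in_G_0 G2).
- by rewrite /= (in_G_1 G1) (in_G_1 G2).
- apply: filterS3 chain (in_G_gt0 G1) (in_G_ae_comp G1 (in_G_gt0 G2)) => s + + + sI.
  by move=> /(_ sI) -> /(_ sI) h1 /(_ sI) h2; rewrite mulr_gt0.
Qed.

Lemma bounded_itv_integrable (R : realType) (a b M : R) (f : R -> R) :
  measurable_fun `[a, b] f -> (forall x, a <= x <= b -> `|f x| <= M) ->
  (@lebesgue_measure R).-integrable `[a, b] (EFin \o f).
Proof.
move=> mf fM; apply: measurable_bounded_integrable => //.
- by rewrite [X in (X < _)%E](lebesgue_measure_itv `[a, b])/= lte_fin; case: ifP; rewrite -?EFinB ltry.
- exists M; split; first exact: num_real.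
  by move=> y My u /=; rewrite in_itv/= => /fM h; rewrite (le_trans h)// ltW.
Qed.

Lemma in_G_integrable_derive1 (R : realType) (psi : R -> R) x :
  in_G psi -> 0 <= x <= 1 ->
  (@lebesgue_measure R).-integrable `[0, x] (EFin \o derive1 psi) /\
  \int[mu]_(s in `[0, x]) derive1 psi s = psi x.
Proof.
move=> G1 x01.
have s1 := sub_unitI x01.
have md := measurable_funS (@measurable_unitI R) s1 (in_G_derive1_measurable G1).
have cov := in_G_change_of_variables G1 x01 (f := cst 1%E) (ltac:(exact: measurable_cst)) (fun=> lee01).
have intE : (\int[mu]_(s in `[0%R, x]) (derive1 psi s)%:E = (psi x)%:E)%E.
  rewrite -integral_itv_obnd_cbnd; last first.
    by apply/measurable_EFinP; apply: measurable_funS md => //; exact: subset_itv_oc_cc.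
  transitivity (\int[mu]_(s in `]0%R, x]) (cst 1 (psi s) * (derive1 psi s)%:E))%E.
    by apply: eq_integral => s _; rewrite mul1e.
  rewrite cov integral_cst//= mul1e [LHS](lebesgue_measure_itv `]0, psi x])/= lte_fin.
  case/andP: (in_G_01 G1 x01); rewrite le_eqVlt => /predU1P[<-|-> _]; rewrite ?ltxx//.
  by rewrite sube0.
have nE : (\int[mu]_(s in `[0%R, x]) `|(derive1 psi s)%:E| =
    \int[mu]_(s in `[0%R, x]) (derive1 psi s)%:E)%E.
  apply: ae_eq_integral => //.
  - by apply: measurableT_comp => //; exact/measurable_EFinP.
  - exact/measurable_EFinP.
  - by apply: filterS (in_G_gt0 G1) => s + /s1 sI => /(_ sI) ds; rewrite gee0_abs// lee_fin ltW.
split; first by apply/integrableP; split; [exact/measurable_EFinP|rewrite nE intE ltry].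
by rewrite /Rintegral intE.
Qed.

Lemma integrable_addr (d : measure_display) (T : measurableType d) (R : realType)
    (m : {measure set T -> \bar R}) (D : set T) (f g : T -> R) : measurable D ->
  m.-integrable D (EFin \o f) -> m.-integrable D (EFin \o g) ->
  m.-integrable D (EFin \o (fun x => f x + g x)).
Proof. by move=> mD iF iG; exact: (integrableD mD iF iG). Qed.

Lemma integrable_mulr (d : measure_display) (T : measurableType d) (R : realType)
    (m : {measure set T -> \bar R}) (D : set T) (k : R) (f : T -> R) : measurable D ->
  m.-integrable D (EFin \o f) -> m.-integrable D (EFin \o (fun x => k * f x)).
Proof. by move=> mD iF; exact: (integrableZl mD k iF). Qed.

Lemma in_G_change_of_variables_ge0 (R : realType) (psi g : R -> R) (x : R) :
  in_G psi -> 0 <= x <= 1 -> (forall u, unitI u -> 0 <= g u) ->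
  (@lebesgue_measure R).-integrable unitI (EFin \o g) ->
  (@lebesgue_measure R).-integrable `[0, x] (fun s => (g (psi s) * derive1 psi s)%:E) /\
  \int[mu]_(s in `[0, x]) (g (psi s) * derive1 psi s) =
  \int[mu]_(u in `[0, psi x]) g u.
Proof.
move=> G1 x01 g0 ig; have mg : measurable_fun unitI g by case/integrableP : ig => /measurable_EFinP.
have px01 := in_G_01 G1 x01.
have sub := @sub_unitI R.
have mgp : measurable_fun `[0, x] (fun s => g (psi s)).
  apply: (@measurable_funS _ _ _ _ unitI); [exact: measurable_unitI|exact: sub|].
  apply: (measurable_comp (@measurable_unitI R) _ mg (in_G_measurable G1)).
  by move=> _ [s sI <-]; exact: (in_G_range G1).
have md := measurable_funS (@measurable_unitI R) (sub _ x01) (in_G_derive1_measurable G1).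
have mgd : measurable_fun `[0, x] (fun s => g (psi s) * derive1 psi s) by exact: measurable_funM.
have ig1 : (@lebesgue_measure R).-integrable `[0, psi x] (EFin \o g).
  by apply: integrableS ig => //; [exact: measurable_unitI|exact: sub].
have mgI : measurable_fun setT (fun u => ((g \_ unitI) u)%:E).
  by apply/measurable_EFinP; apply/(measurable_restrictT _ _).1 => //; exact: measurable_unitI.
have gI0 u : (0 <= ((g \_ unitI) u)%:E)%E.
  by rewrite lee_fin /patch; case: ifPn => // /[!inE]; exact: g0.
have covE : (\int[mu]_(s in `[0%R, x]) (g (psi s) * derive1 psi s)%:E =
    \int[mu]_(u in `[0%R, psi x]) (g u)%:E)%E.
  have := in_G_change_of_variables G1 x01 mgI gI0.
  rewrite -integral_itv_obnd_cbnd; last first.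
    by apply/measurable_EFinP; apply: measurable_funS mgd => //; exact: subset_itv_oc_cc.
  rewrite -integral_itv_obnd_cbnd; last first.
    by apply/measurable_EFinP; apply: (measurable_funS (@measurable_unitI R) _ mg) => u /subset_itv_oc_cc; exact: sub.
  move=> H; transitivity (\int[mu]_(s in `]0%R, x]) (((g \_ unitI) (psi s))%:E * (derive1 psi s)%:E))%E.
    apply: eq_integral => s; rewrite inE => /subset_itv_oc_cc/(sub _ x01) sI.
    by rewrite patchE mem_set//; exact: (in_G_range G1).
  rewrite H; apply: eq_integral => u; rewrite inE => /subset_itv_oc_cc/(sub _ px01) uI.
  by rewrite patchE mem_set.
have nE : (\int[mu]_(s in `[0%R, x]) `|(g (psi s) * derive1 psi s)%:E| =
    \int[mu]_(s in `[0%R, x]) (g (psi s) * derive1 psi s)%:E)%E.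
  apply: ae_eq_integral => //.
  - by apply: measurableT_comp => //; exact/measurable_EFinP.
  - exact/measurable_EFinP.
  - apply: filterS (in_G_gt0 G1) => s + /(sub _ x01) sI => /(_ sI) ds.
    by rewrite gee0_abs// lee_fin mulr_ge0 ?(ltW ds)// g0//; exact: (in_G_range G1).
split; last by rewrite /Rintegral covE.
apply/integrableP; split; first exact/measurable_EFinP.
by rewrite nE covE; apply: integrable_lty.
Qed.

(** Splitting f as (f + |f|) - |f| reduces to nonnegative functions. *)
Lemma in_G_change_of_variables_real (R : realType) (psi f : R -> R) (x : R) :
  in_G psi -> 0 <= x <= 1 -> (@lebesgue_measure R).-integrable unitI (EFin \o f) ->
  (@lebesgue_measure R).-integrable `[0, x] (fun s => (f (psi s) * derive1 psi s)%:E) /\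
  \int[mu]_(s in `[0, x]) (f (psi s) * derive1 psi s) =
  \int[mu]_(u in `[0, psi x]) f u.
Proof.
move=> G1 x01 iF; have px01 := in_G_01 G1 x01.
have mI := @measurable_unitI R.
have iN : (@lebesgue_measure R).-integrable unitI (EFin \o (fun u => `|f u|)).
  exact: integrable_norm iF.
have iS : (@lebesgue_measure R).-integrable unitI (EFin \o (fun u => f u + `|f u|)).
  exact: integrable_addr.
have [i1 e1] := in_G_change_of_variables_ge0 G1 x01 (fun u _ => normr_ge0 (f u)) iN.
have S0 u : unitI u -> 0 <= f u + `|f u| by have := ler_norm (- f u); rewrite normrN; lra.
have [i2 e2] := in_G_change_of_variables_ge0 G1 x01 S0 iS.
have sub := @sub_unitI R.
have pE : (fun s => (f (psi s) * derive1 psi s)%:E) =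
    ((fun s => ((f (psi s) + `|f (psi s)|) * derive1 psi s)%:E) \-
     (fun s => (`|f (psi s)| * derive1 psi s)%:E))%E.
  by apply/funext => s; rewrite /= -EFinB; congr EFin; ring.
split; first by rewrite pE; exact: integrableB.
transitivity (\int[mu]_(s in `[0, x]) ((f (psi s) + `|f (psi s)|) * derive1 psi s -
    `|f (psi s)| * derive1 psi s)).
  by apply: eq_Rintegral => s _; ring.
rewrite RintegralB// e1 e2 -RintegralB//.
- by apply: eq_Rintegral => s _; rewrite addrK.
- by apply: integrableS iS => //; exact: sub.
- by apply: integrableS iN => //; exact: sub.
Qed.

(** * Primitives *)

Definition primitive (R : realType) (h : R -> R) (x : R) : R :=
  \int[mu]_(s in `[0, x]) h s.

Lemma unitI_primitive (R : realType) (h : R -> R) :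
  (@lebesgue_measure R).-integrable unitI (EFin \o h) ->
  abs_continuous 0 1 (primitive h) /\
  {ae mu, forall x, unitI x -> derivable (primitive h) x 1 /\
    derive1 (primitive h) x = h x}.
Proof.
move=> ih; have mI := @measurable_unitI R.
split.
  apply: (abs_continuous_integral ih) => u v u0 uv v1.
  have iv : (@lebesgue_measure R).-integrable `[0, v] (EFin \o h).
    by apply: (integrableS _ _ _ ih) => //; apply: sub_unitI; rewrite (le_trans u0).
  have iuv : (@lebesgue_measure R).-integrable `]u, v] (EFin \o h).
    apply: (integrableS _ _ _ iv) => //; apply: subset_itvr.
    by rewrite bnd_simp.
  rewrite /primitive Rintegral_itvB ?bnd_simp//.
  have iuv' : (@lebesgue_measure R).-integrable `]u, v[ (EFin \o h).
    by apply: (integrableS _ _ _ iuv) => //; apply: subset_itvl; rewrite bnd_simp.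
  rewrite -(@Rintegral_itv_bndo_bndc _ (BRight u) v)//.
  rewrite -[leRHS](@EFin_Rintegral _ _ _ mu _ (fun x => `|h x|))//.
    by rewrite lee_fin; exact: le_normr_Rintegral.
  exact: integrable_norm iuv'.
pose hI := h \_ (@unitI R).
have ihI : (@lebesgue_measure R).-integrable setT (EFin \o hI).
  by rewrite /hI -restrict_EFin; apply/integrable_restrict => //=; rewrite setTI.
have FE x : 0 <= x <= 1 -> primitive h x = primitive h 0 + \int[mu]_(s in `[0, x]) hI s.
  move=> x01; rewrite /primitive [X in _ = X + _](_ : _ = 0) ?add0r.
    by apply: eq_Rintegral => s; rewrite inE => /(sub_unitI x01) sI; rewrite /hI patchE mem_set.
  by rewrite set_itv1 Rintegral_set1.
have ae1 := derive1_integral_ae ihI FE.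
 apply: ae_unitI_oo; apply: filterS ae1 => x + x01 => /(_ x01)[dx ->]; split => //.
by rewrite /hI patchE mem_set// /unitI/= in_itv/=; case/andP: x01 => /ltW -> /ltW.
Qed.

(** * Inverse cosine and spherical triangles *)

Lemma ler_cos (R : realType) (x y : R) : 0 <= x <= pi -> 0 <= y <= pi ->
  (cos x <= cos y) = (y <= x).
Proof. by move=> x0 y0; rewrite !leNgt ltr_cos// in_itv/=. Qed.

Lemma le_acos (R : realType) (x y : R) : -1 <= x <= 1 -> -1 <= y <= 1 ->
  (acos x <= acos y) = (y <= x).
Proof.
move=> x1 y1; rewrite -ler_cos ?acos_ge0 ?acos_lepi// !acosK//.
Qed.

Lemma acos_lerP (R : realType) (x z : R) : -1 <= x <= 1 -> 0 <= z <= pi ->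
  (acos x <= z) = (cos z <= x).
Proof.
by move=> x1 z0; rewrite -ler_cos ?acos_ge0 ?acos_lepi// acosK.
Qed.

(** The inverse cosine is monotone on [-1, 1], and clamping its argument makes it
monotone on the line. *)
Lemma measurable_acos (R : realType) (d : measure_display) (T : measurableType d)
    (D : set T) (f : T -> R) : measurable D -> measurable_fun D f ->
  (forall x, D x -> -1 <= f x <= 1) -> measurable_fun D (fun x => acos (f x)).
Proof.
move=> mD mf f1; pose clamp (x : R) := Num.max (- 1) (Num.min x 1).
have clamp1 x : -1 <= clamp x <= 1.
  rewrite /clamp le_max lexx/= ge_max ge_min lexx orbT andbT.
  by rewrite (le_trans _ ler01)// lerN10.
have clampE x : -1 <= x <= 1 -> clamp x = x.
  by move=> /andP[ax xb]; rewrite /clamp min_l// max_r.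
have mac : measurable_fun setT (fun x => acos (clamp x)).
  apply: nonincreasing_measurable => // x y xy; rewrite le_acos//.
  rewrite /clamp ge_max le_max lexx/= le_max; apply/orP; right.
  by rewrite le_min !ge_min xy lexx orbT.
apply: (eq_measurable_fun (fun x => acos (clamp (f x)))).
  by move=> x; rewrite inE => /f1 h; rewrite clampE.
exact: (measurableT_comp mac).
Qed.

(** The law of cosines in disguise. If x, y, z are the pairwise inner products of
three unit vectors a, b, c, in the order ab, bc, ac, the hypothesis says that
sin(be) a - sin(al + be) b + sin(al) c has a nonnegative squared length. This
form of the triangle inequality is linear in x, y, z and can therefore be
integrated. *)
Lemma spherical_triangle (R : realType) (al be x y z : R) :
  0 < al -> 0 < be -> al + be < pi ->
  cos al <= x -> cos be <= y ->
  0 <= sin be ^+ 2 + sin al ^+ 2 + sin (al + be) ^+ 2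
       + 2 * (sin al * sin be) * z - 2 * (sin be * sin (al + be)) * x
       - 2 * (sin al * sin (al + be)) * y ->
  cos (al + be) <= z.
Proof.
move=> al0 be0 albe xal ybe.
have sa : 0 < sin al by rewrite sin_gt0_pi// al0/=; lra.
have sb : 0 < sin be by rewrite sin_gt0_pi// be0/=; lra.
have sab : 0 < sin (al + be) by rewrite sin_gt0_pi// addr_gt0.
have h1 : sin be * sin (al + be) * cos al <= sin be * sin (al + be) * x.
  by rewrite ler_wpM2l// mulr_ge0// ltW.
have h2 : sin al * sin (al + be) * cos be <= sin al * sin (al + be) * y.
  by rewrite ler_wpM2l// mulr_ge0// ltW.
have e1 : sin be * sin (al + be) * cos al + sin al * sin (al + be) * cos be
   = sin (al + be) ^+ 2 by rewrite sinD; ring.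
have e2 : sin (al + be) ^+ 2 - sin al ^+ 2 - sin be ^+ 2 =
    2 * (sin al * sin be) * cos (al + be).
  rewrite sinD cosD; have ca := cos2sin2 al; have cb := cos2sin2 be.
  rewrite (_ : _ ^+ 2 - _ - _ = sin al ^+ 2 * cos be ^+ 2 + cos al ^+ 2 * sin be ^+ 2 +
    2 * sin al * cos be * cos al * sin be - sin al ^+ 2 - sin be ^+ 2); last by ring.
  by rewrite ca cb; ring.
move=> N0; have : 2 * (sin al * sin be) * cos (al + be) <= 2 * (sin al * sin be) * z.
  by rewrite -e2; lra.
by rewrite ler_pM2l// mulr_gt0// mulr_gt0.
Qed.

Section dot_theory.
Context {R : realType} {d : nat}.
Implicit Types a b c : 'rV[R]_d.

Lemma dotC a b : dot a b = dot b a.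
Proof. by apply: eq_bigr => i _; rewrite mulrC. Qed.

Lemma dot_comb3_ge0 a b c (p q r : R) :
  0 <= p ^+ 2 * dot a a + q ^+ 2 * dot b b + r ^+ 2 * dot c c +
    2 * (p * q) * dot a b + 2 * (p * r) * dot a c + 2 * (q * r) * dot b c.
Proof.
rewrite /dot !mulr_sumr -!big_split/= sumr_ge0// => i _.
rewrite (_ : _ + _ = (p * a 0 i + q * b 0 i + r * c 0 i) ^+ 2) ?sqr_ge0//.
by ring.
Qed.

Lemma dot_unit a b : dot a a = 1 -> dot b b = 1 -> -1 <= dot a b <= 1.
Proof.
move=> a1 b1; have := dot_comb3_ge0 a b 0 1 1 0; have := dot_comb3_ge0 a b 0 1 (-1) 0.
by rewrite a1 b1 => h1 h2; apply/andP; split; lra.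
Qed.

Lemma acos_dot_triangle a b c : dot a a = 1 -> dot b b = 1 -> dot c c = 1 ->
  acos (dot a c) <= acos (dot a b) + acos (dot b c).
Proof.
move=> a1 b1 c1; have ab := dot_unit a1 b1; have bc := dot_unit b1 c1; have ac := dot_unit a1 c1.
have ab0 := acos_ge0 ab; have bc0 := acos_ge0 bc.
have [h|h] := leP pi (acos (dot a b) + acos (dot b c)).
  by rewrite (le_trans (acos_lepi ac)).
apply/ler_addgt0Pr => e e0.
pose e' := Num.min (e / 2) ((pi - (acos (dot a b) + acos (dot b c))) / 3).
have e'0 : 0 < e' by rewrite lt_min divr_gt0//= divr_gt0// subr_gt0.
have e'e : e' <= e / 2 by rewrite ge_min lexx.
have e'p : e' <= (pi - (acos (dot a b) + acos (dot b c))) / 3 by rewrite ge_min lexx orbT.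
apply: (@le_trans _ _ (acos (dot a b) + e' + (acos (dot b c) + e'))); last by lra.
rewrite acos_lerP//; last by apply/andP; split; lra.
apply: (@spherical_triangle _ _ _ (dot a b) (dot b c)); [lra|lra|lra| | |].
- by rewrite -acos_lerP//; [lra|apply/andP; split; lra].
- by rewrite -acos_lerP//; [lra|apply/andP; split; lra].
have := dot_comb3_ge0 a b c (sin (acos (dot b c) + e'))
  (- sin (acos (dot a b) + e' + (acos (dot b c) + e'))) (sin (acos (dot a b) + e')).
by rewrite a1 b1 c1; lra.
Qed.

Lemma dot_subE a b : dot a a = 1 -> dot b b = 1 ->
  2 * (1 - dot a b) = \sum_(j < d) (b 0 j - a 0 j) ^+ 2.
Proof.
move=> a1 b1; transitivity (dot a a + dot b b - 2 * dot a b); first by rewrite a1 b1; ring.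
by rewrite /dot mulr_sumr -big_split -sumrB/=; apply: eq_bigr => j _; ring.
Qed.

Lemma dot_unit_eq a b : dot a a = 1 -> dot b b = 1 -> dot a b = 1 -> a = b.
Proof.
move=> a1 b1 ab1; apply/rowP => i.
have : \sum_(i < d) (b 0 i - a 0 i) ^+ 2 = 0 by rewrite -dot_subE// ab1 subrr mulr0.
move/eqP; rewrite psumr_eq0; last by move=> j _; exact: sqr_ge0.
by move=> /allP/(_ i (mem_index_enum _)); rewrite sqrf_eq0 subr_eq0 => /eqP ->.
Qed.
End dot_theory.

(** Triangle inequality in a cone, for points at distances u, v, w from the apex.
Put f = min (th1 + th2) pi, so that th3 <= f and f - th1 <= th2. Replacing th3
by f and th2 by f - th1 decreases the form, which becomes the squared length
of a combination of plane vectors with polar angles 0, th1 and f. *)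
Lemma cone_triangle (R : realType) (p q r u v w th1 th2 th3 : R) :
  0 <= p -> 0 <= q -> 0 <= r -> 0 <= u -> 0 <= v -> 0 <= w ->
  0 <= th1 <= pi -> 0 <= th2 <= pi -> 0 <= th3 <= pi -> th3 <= th1 + th2 ->
  0 <= (p * u) ^+ 2 + (r * w) ^+ 2 + (q * v) ^+ 2 + 2 * (p * r) * (u * w * cos th3)
    - 2 * (p * q) * (u * v * cos th1) - 2 * (q * r) * (v * w * cos th2).
Proof.
move=> p0 q0 r0 u0 v0 w0 /andP[t10 t1p] /andP[t20 t2p] /andP[t30 t3p] t123.
pose f := Num.min (th1 + th2) pi.
have f0 : 0 <= f <= pi.
  by rewrite /f le_min addr_ge0// pi_ge0/= ge_min lexx orbT.
have tf : th3 <= f by rewrite /f le_min t123.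
have t1f : th1 <= f by rewrite /f le_min lerDl t20.
have ft2 : f - th1 <= th2 by rewrite lerBlDl /f ge_min lexx.
have c3 : cos f <= cos th3 by rewrite ler_cos// t30.
have c2 : cos th2 <= cos (f - th1).
  by rewrite ler_cos ?t20// subr_ge0 t1f/= (le_trans ft2).
have h3 : 2 * (p * r) * (u * w * cos f) <= 2 * (p * r) * (u * w * cos th3).
  by rewrite ler_wpM2l ?mulr_ge0// ler_wpM2l ?mulr_ge0.
have h2 : 2 * (q * r) * (v * w * cos th2) <= 2 * (q * r) * (v * w * cos (f - th1)).
  by rewrite ler_wpM2l ?mulr_ge0// ler_wpM2l ?mulr_ge0.
apply: (@le_trans _ _ ((p * u + r * w * cos f - q * v * cos th1) ^+ 2 +
    (r * w * sin f - q * v * sin th1) ^+ 2)); first by rewrite addr_ge0// sqr_ge0.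
have e : (p * u + r * w * cos f - q * v * cos th1) ^+ 2 +
    (r * w * sin f - q * v * sin th1) ^+ 2 =
  (p * u) ^+ 2 + (r * w) ^+ 2 * (cos f ^+ 2 + sin f ^+ 2)
   + (q * v) ^+ 2 * (cos th1 ^+ 2 + sin th1 ^+ 2) + 2 * (p * r) * (u * w * cos f)
   - 2 * (p * q) * (u * v * cos th1) - 2 * (q * r) * (v * w * cos (f - th1)).
  by rewrite cosB; ring.
by rewrite e !cos2Dsin2 !mulr1; lra.
Qed.

(** * The correlation of two directions along a reparametrization *)

Lemma sqrtr_le_half (R : realType) (x : R) : Num.sqrt x <= (1 + `|x|) / 2.
Proof.
have [x0|x0] := leP 0 x; last first.
  by rewrite ltr0_sqrtr// divr_ge0// addr_ge0.
rewrite ger0_norm//; have := sqr_ge0 (Num.sqrt x - 1).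
have := sqr_sqrtr x0; set r := Num.sqrt x => e; rewrite -e.
have -> : (r - 1) ^+ 2 = r ^+ 2 - 2 * r + 1 by ring.
by lra.
Qed.

Lemma Rintegral_ae_eq (d : measure_display) (T : measurableType d) (R : realType)
    (m : {measure set T -> \bar R}) (D : set T) (f g : T -> R) : measurable D ->
  measurable_fun D f -> measurable_fun D g -> {ae m, forall x, D x -> f x = g x} ->
  \int[m]_(x in D) f x = \int[m]_(x in D) g x.
Proof.
move=> mD mf mg fg; congr fine; apply: ae_eq_integral => //; try exact/measurable_EFinP.
by have F := ae_filter_ringOfSetsType m; apply: filterS fg => x fgx Dx; rewrite /= fgx.
Qed.

Lemma integrable_dominated (d : measure_display) (T : measurableType d) (R : realType)
    (m : {measure set T -> \bar R}) (D : set T) (f g : T -> R) : measurable D ->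
  measurable_fun D f -> (forall x, D x -> `|f x| <= g x) ->
  m.-integrable D (EFin \o g) -> m.-integrable D (EFin \o f).
Proof.
move=> mD mf fg; apply: le_integrable => //; first exact/measurable_EFinP.
by move=> x Dx; rewrite /= lee_fin (le_trans (fg _ Dx))// ler_norm.
Qed.

Lemma Rintegral_unitI_cst (R : realType) (k : R) : \int[mu]_(s in unitI) k = k.
Proof.
rewrite Rintegral_cst; last exact: measurable_unitI.
rewrite [X in k * fine X](lebesgue_measure_itv `[0, 1])/= lte_fin ltr01 /=.
by rewrite subr0 mulr1.
Qed.

Lemma integrable_unitI_cst (R : realType) (k : R) :
  (@lebesgue_measure R).-integrable unitI (EFin \o cst k).
Proof. exact: (@bounded_itv_integrable _ _ _ `|k|). Qed.

Section correlation.
Context {R : realType}.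
Implicit Types psi k : R -> R.

Lemma in_G_derive1_unitI psi : in_G psi ->
  (@lebesgue_measure R).-integrable unitI (EFin \o derive1 psi) /\
  \int[mu]_(s in unitI) derive1 psi s = 1.
Proof.
move=> G1; have [] := in_G_integrable_derive1 G1 (x := 1); first by rewrite ler01 lexx.
by rewrite (in_G_1 G1).
Qed.

Lemma in_G_norm_derive1_unitI psi : in_G psi ->
  (@lebesgue_measure R).-integrable unitI (EFin \o (fun s => `|derive1 psi s|)) /\
  \int[mu]_(s in unitI) `|derive1 psi s| = 1.
Proof.
move=> G1; have [i1 e1] := in_G_derive1_unitI G1; have mI := @measurable_unitI R.
have i2 : (@lebesgue_measure R).-integrable unitI (EFin \o (fun s => `|derive1 psi s|)).
  exact: integrable_norm i1.
split => //; rewrite -[RHS]e1; apply: Rintegral_ae_eq => //.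
- by case/integrableP : i2 => /measurable_EFinP.
- exact: in_G_derive1_measurable.
- by apply: filterS (in_G_gt0 G1) => s + sI => /(_ sI) ?; rewrite gtr0_norm.
Qed.

Lemma sqrt_derive1_integrable psi k : in_G psi -> measurable_fun unitI k ->
  (forall s, unitI s -> `|k s| <= 1) ->
  (@lebesgue_measure R).-integrable unitI (EFin \o (fun s => Num.sqrt (derive1 psi s) * k s)) /\
  -1 <= \int[mu]_(s in unitI) (Num.sqrt (derive1 psi s) * k s) <= 1.
Proof.
move=> G1 mk k1; have mI := @measurable_unitI R; have [i1 e1] := in_G_norm_derive1_unitI G1.
have mf : measurable_fun unitI (fun s => Num.sqrt (derive1 psi s) * k s).
  apply: measurable_funM => //; apply: (measurableT_comp (@measurable_sqrtr R)).
  exact: in_G_derive1_measurable.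
have iB : (@lebesgue_measure R).-integrable unitI (EFin \o (fun s => 2^-1 * (1 + `|derive1 psi s|))).
  by apply: integrable_mulr => //; apply: integrable_addr => //; exact: integrable_unitI_cst.
have bd s : unitI s -> `|Num.sqrt (derive1 psi s) * k s| <= 2^-1 * (1 + `|derive1 psi s|).
  move=> sI; rewrite normrM (ger0_norm (sqrtr_ge0 _)) mulrC.
  rewrite (le_trans (ler_wpM2r (sqrtr_ge0 _) (k1 _ sI)))// mul1r mulrC.
  exact: sqrtr_le_half.
have iF : (@lebesgue_measure R).-integrable unitI (EFin \o (fun s => Num.sqrt (derive1 psi s) * k s)).
  exact: (@integrable_dominated _ _ _ (@lebesgue_measure R) _ _ _ _ _ bd iB).
split => //; rewrite -ler_norml (le_trans (le_normr_Rintegral _ _))//.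
have <- : \int[mu]_(s in unitI) (2^-1 * (1 + `|derive1 psi s|)) = 1.
  rewrite RintegralZl//; last by apply: integrable_addr => //; exact: integrable_unitI_cst.
  rewrite RintegralD//; last exact: integrable_unitI_cst.
  by rewrite Rintegral_unitI_cst e1 -(natrD _ 1 1) mulVf.
apply: le_Rintegral => //; exact: integrable_norm iF.
Qed.

End correlation.

Section distance.
Context {R : realType} {d : nat} (sigma : R).
Hypotheses (sigma0 : 0 < sigma) (sigma1 : 1 <= 2 * sigma).
Implicit Types (a b c : sphere_fun R d) (psi : R -> R).

Let mI := @measurable_unitI R.

Lemma dot_range a b psi s : in_G psi -> unitI s -> -1 <= dot (a s) (b (psi s)) <= 1.
Proof.
move=> G1 sI; apply: dot_unit; first exact: sphere_fun_unit.
by apply: sphere_fun_unit; exact: (in_G_range G1).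
Qed.

Lemma omega_range a b psi s : in_G psi -> unitI s -> 0 <= omega a b psi s <= pi.
Proof.
by move=> G1 sI; have h := dot_range a b G1 sI; rewrite /omega acos_ge0// acos_lepi.
Qed.

Lemma div2sigma_range x : 0 <= x <= pi -> 0 <= x / (2 * sigma) <= pi.
Proof.
move=> /andP[x0 xp]; have s2 : 0 < 2 * sigma by rewrite mulr_gt0.
rewrite divr_ge0 ?(ltW s2)//= ler_pdivrMr// (le_trans xp)// ler_pMr//.
exact: pi_gt0.
Qed.

Lemma omega_measurable a b psi : in_G psi -> measurable_fun unitI (omega a b psi).
Proof.
move=> G1; apply: measurable_acos => //; last by move=> s sI; exact: dot_range.
apply: measurable_sum => i; apply: measurable_funM; first exact: sphere_fun_measurable.
apply: (measurable_comp mI _ (sphere_fun_measurable b i) (in_G_measurable G1)).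
by move=> _ [s sI <-]; exact: (in_G_range G1).
Qed.

Lemma measurable_cosr : measurable_fun setT (@cos R).
Proof. by apply: continuous_measurable_fun; exact: continuous_cos. Qed.

Lemma cos_theta_measurable a b psi : in_G psi ->
  measurable_fun unitI (fun s => cos (omega a b psi s / (2 * sigma))).
Proof.
move=> G1; apply: (measurableT_comp measurable_cosr).
by apply: measurable_funM => //; exact: omega_measurable.
Qed.

(** The inner product of the two end points q0 and q1 in L2; the angle is its
inverse cosine. *)
Definition corr a b psi : R := \int[mu]_(s in unitI)
    (Num.sqrt (derive1 psi s) * cos (omega a b psi s / (2 * sigma))).

Lemma corr_integrable a b psi : in_G psi ->
  (@lebesgue_measure R).-integrable unitI (EFin \o (fun s =>
    Num.sqrt (derive1 psi s) * cos (omega a b psi s / (2 * sigma)))).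
Proof.
move=> G1; have [] := sqrt_derive1_integrable G1 (cos_theta_measurable a b G1) => //.
by move=> s _; exact: cos_max.
Qed.

Lemma corr_range a b psi : in_G psi -> -1 <= corr a b psi <= 1.
Proof.
move=> G1; have [] := sqrt_derive1_integrable G1 (cos_theta_measurable a b G1) => //.
by move=> s _; exact: cos_max.
Qed.

Lemma angle_range a b psi : in_G psi -> 0 <= angle sigma a b psi <= pi.
Proof.
by move=> G1; have h := corr_range a b G1; rewrite /angle acos_ge0// acos_lepi.
Qed.

Lemma angle_set_nonempty a b :
  [set angle sigma a b psi | psi in [set psi | in_G psi]] !=set0.
Proof. by exists (angle sigma a b idfun); exists idfun => //; exact: in_G_id. Qed.

Lemma angle_set_lbound a b :
  has_lbound [set angle sigma a b psi | psi in [set psi | in_G psi]].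
Proof. by exists 0 => _ [psi G1 <-]; case/andP: (angle_range a b G1). Qed.

Lemma d_sigma_ge0 a b : 0 <= d_sigma sigma a b.
Proof.
rewrite mulr_ge0// lb_le_inf//; first exact: angle_set_nonempty.
by move=> _ [psi G1 <-]; case/andP: (angle_range a b G1).
Qed.

Lemma d_sigma_le a b psi : in_G psi -> d_sigma sigma a b <= 2 * angle sigma a b psi.
Proof.
by move=> G1; rewrite ler_wpM2l// ge_inf//; [exact: angle_set_lbound|exists psi].
Qed.

Lemma d_sigma_lt a b (e : R) : d_sigma sigma a b < 2 * e ->
  exists2 psi, in_G psi & angle sigma a b psi < e.
Proof.
rewrite ltr_pM2l// => /(inf_lt (angle_set_nonempty a b))[_ [psi G1 <-] h].
by exists psi.
Qed.

Lemma angle_ae_eq a b a' b' psi : in_G psi -> sphere_ae_eq a a' -> sphere_ae_eq b b' ->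
  angle sigma a b psi = angle sigma a' b' psi.
Proof.
move=> G1 /asboolP aa' /asboolP bb'; congr acos; apply: Rintegral_ae_eq => //.
- by case/integrableP : (corr_integrable a b G1) => /measurable_EFinP.
- by case/integrableP : (corr_integrable a' b' G1) => /measurable_EFinP.
- apply: filterS2 aa' (in_G_ae_comp G1 bb') => s + + sI.
  by move=> /(_ sI) e1 /(_ sI) e2; rewrite /omega e1 e2.
Qed.

Lemma d_sigma_ae_eq a b a' b' : sphere_ae_eq a a' -> sphere_ae_eq b b' ->
  d_sigma sigma a b = d_sigma sigma a' b'.
Proof.
move=> aa' bb'; congr (2 * inf _); apply/seteqP; split => _ [psi G1 <-]; exists psi => //.
  by apply/esym; exact: angle_ae_eq.
exact: angle_ae_eq.
Qed.

(** Changing variables along psi turns the weight sqrt(chi') into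
sqrt(chi'(psi)) psi' = sqrt(psi'), chi being the inverse of psi. *)
Lemma angle_sym a b psi : in_G psi ->
  exists2 chi, in_G chi & angle sigma b a chi = angle sigma a b psi.
Proof.
move=> G1; have [chi [Gchi psichi chipsi dchi]] := in_G_inverse G1.
exists chi => //; congr acos.
have [_ ] := in_G_change_of_variables_real G1 (x := 1) (ltac:(by rewrite ler01 lexx))
  (corr_integrable b a Gchi).
rewrite (in_G_1 G1) -/unitI => <-; apply/esym; apply: Rintegral_ae_eq => //.
- by case/integrableP : (corr_integrable a b G1) => /measurable_EFinP.
- have [+ _] := in_G_change_of_variables_real G1 (x := 1) (ltac:(by rewrite ler01 lexx))
    (corr_integrable b a Gchi).
  by case/integrableP => /measurable_EFinP.
- apply: filterS dchi => s + sI => /(_ sI)[d0 ->].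
  rewrite /omega chipsi// dotC sqrtrV ?ltW// mulrAC; congr (_ * _).
  rewrite -{3}(sqr_sqrtr (ltW d0)) expr2 mulKf// gt_eqF// sqrtr_gt0//.
Qed.

Lemma d_sigma_sym a b : d_sigma sigma a b = d_sigma sigma b a.
Proof.
have h a' b' : d_sigma sigma a' b' <= d_sigma sigma b' a'.
  rewrite leNgt; apply/negP => lt.
  have [|psi G1 h] := @d_sigma_lt b' a' (d_sigma sigma a' b' / 2); first by rewrite mulrC divfK.
  have [chi Gchi e] := angle_sym b' a' G1.
  have := d_sigma_le a' b' Gchi; rewrite e; lra.
by apply/le_anti; rewrite !h.
Qed.

(** * Triangle inequality *)

Lemma Rintegral_lin (D : set R) (f g : R -> R) (k : R) : measurable D ->
  (@lebesgue_measure R).-integrable D (EFin \o f) ->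
  (@lebesgue_measure R).-integrable D (EFin \o g) ->
  (@lebesgue_measure R).-integrable D (EFin \o (fun x => f x + k * g x)) /\
  \int[mu]_(x in D) (f x + k * g x) = \int[mu]_(x in D) f x + k * \int[mu]_(x in D) g x.
Proof.
move=> mD iF iG.
have iK : (@lebesgue_measure R).-integrable D (EFin \o (fun x => k * g x)) by exact: integrable_mulr.
by split; [exact: integrable_addr|rewrite RintegralD// RintegralZl].
Qed.

Lemma Rintegral_ge0_ae (D : set R) (f : R -> R) : measurable D ->
  (@lebesgue_measure R).-integrable D (EFin \o f) ->
  {ae mu, forall x, D x -> 0 <= f x} -> 0 <= \int[mu]_(x in D) f x.
Proof.
move=> mD iF f0.
have mf : measurable_fun D f by case/integrableP : iF => /measurable_EFinP.
have -> : \int[mu]_(x in D) f x = \int[mu]_(x in D) `|f x|.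
  apply: Rintegral_ae_eq => //; first exact: measurableT_comp.
  by apply: filterS f0 => x + Dx => /(_ Dx) ?; rewrite ger0_norm.
by apply: Rintegral_ge0.
Qed.

(** The form of [cone_triangle] with weights sin(be), sin(al), sin(al + be) is
nonnegative at almost every s, for the densities 1, psi1', (psi2 o psi1)' and
the angles between a(s), b(psi1 s), c(psi2 (psi1 s)). Its integral is the
hypothesis of [spherical_triangle], since the correlation of b and c becomes,
under the change of variables psi1, the integral of the mixed term. *)
Lemma angle_triangle a b c psi1 psi2 (al be : R) : in_G psi1 -> in_G psi2 ->
  0 < al -> 0 < be -> al + be < pi ->
  angle sigma a b psi1 <= al -> angle sigma b c psi2 <= be ->
  angle sigma a c (psi2 \o psi1) <= al + be.
Proof.
move=> G1 G2 al0 be0 ab h1 h2; have [G3 chain] := in_G_comp G1 G2.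
have al1 : 0 <= al <= pi by lra.
have be1 : 0 <= be <= pi by lra.
have abp : 0 <= al + be <= pi by lra.
rewrite /angle acos_lerP//; last exact: corr_range.
rewrite /angle acos_lerP// in h1; last exact: corr_range.
rewrite /angle acos_lerP// in h2; last exact: corr_range.
apply: (spherical_triangle al0 be0 ab h1 h2).
have o01 : (0 : R) <= 1 <= (1 : R) by rewrite ler01 lexx.
have [i2 e2] := in_G_change_of_variables_real G1 o01 (corr_integrable b c G2).
rewrite (in_G_1 G1) -/unitI in i2 e2.
have [id1 ed1] := in_G_derive1_unitI G1.
have [id3 ed3] := in_G_derive1_unitI G3.
set p := sin be; set r := sin al; set q := sin (al + be).
have p0 : 0 <= p by apply: sin_ge0_pi.
have r0 : 0 <= r by apply: sin_ge0_pi.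
have q0 : 0 <= q by apply: sin_ge0_pi.
have [j1 k1] := Rintegral_lin (r ^+ 2) mI (integrable_unitI_cst (p ^+ 2)) id3.
have [j2 k2] := Rintegral_lin (q ^+ 2) mI j1 id1.
have [j3 k3] := Rintegral_lin (2 * (p * r)) mI j2 (corr_integrable a c G3).
have [j4 k4] := Rintegral_lin (- (2 * (p * q))) mI j3 (corr_integrable a b G1).
have [j5 k5] := Rintegral_lin (- (2 * (q * r))) mI j4 i2.
suff : 0 <= p ^+ 2 + r ^+ 2 * 1 + q ^+ 2 * 1 + 2 * (p * r) * corr a c (psi2 \o psi1)
   + - (2 * (p * q)) * corr a b psi1 + - (2 * (q * r)) * corr b c psi2.
  by rewrite !mulNr !mulr1 /corr => h; apply: le_trans h _; rewrite le_eqVlt; apply/orP; left; apply/eqP; ring.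
rewrite -[X in r ^+ 2 * X]ed3 -[X in q ^+ 2 * X]ed1 /corr -e2 -[X in X + r ^+ 2 * _]Rintegral_unitI_cst.
rewrite -k1 -k2 -k3 -k4 -k5.
apply: Rintegral_ge0_ae => //.
apply: filterS3 (in_G_gt0 G1) (in_G_gt0 G3) chain => s + + + sI.
move=> /(_ sI) d1 /(_ sI) d3 /(_ sI) ch.
set v := Num.sqrt (derive1 psi1 s); set w := Num.sqrt (derive1 (psi2 \o psi1) s).
have v2 : v ^+ 2 = derive1 psi1 s by rewrite sqr_sqrtr// ltW.
have w2 : w ^+ 2 = derive1 (psi2 \o psi1) s by rewrite sqr_sqrtr// ltW.
have d2 : 0 < derive1 psi2 (psi1 s) by move: d3; rewrite ch pmulr_lgt0.
have vw : Num.sqrt (derive1 psi2 (psi1 s)) * derive1 psi1 s = v * w.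
  by rewrite /w ch sqrtrM ?ltW// -/v -v2; ring.
have s1 : unitI (psi1 s) by exact: in_G_range.
have t1 := div2sigma_range (omega_range a b G1 sI).
have t2 := div2sigma_range (omega_range b c G2 s1).
have t3 := div2sigma_range (omega_range a c G3 sI).
have t123 : omega a c (psi2 \o psi1) s / (2 * sigma) <=
    omega a b psi1 s / (2 * sigma) + omega b c psi2 (psi1 s) / (2 * sigma).
  rewrite -mulrDl ler_pM2r ?invr_gt0 ?mulr_gt0//.
  apply: acos_dot_triangle; apply: sphere_fun_unit => //; exact: (in_G_range G3).
have := cone_triangle p0 q0 r0 ler01 (sqrtr_ge0 (derive1 psi1 s))
  (sqrtr_ge0 (derive1 (psi2 \o psi1) s)) t1 t2 t3 t123.
rewrite -/v -/w [_ * cos (omega b c psi2 (psi1 s) / _) * derive1 psi1 s]mulrAC vw -v2 -w2.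
rewrite (_ : cst (p ^+ 2) s = p ^+ 2)//.
set c1 := cos (omega a b psi1 s / _); set c2 := cos (omega b c psi2 _ / _).
set c3 := cos (omega a c _ s / _) => h.
apply: le_trans h _; rewrite le_eqVlt; apply/orP; left; apply/eqP; ring.
Qed.

(** Almost optimal reparametrizations are composed; when the angles add up to
more than pi the bound is trivial. *)
Lemma d_sigma_triangle a b c : d_sigma sigma a c <= d_sigma sigma a b + d_sigma sigma b c.
Proof.
apply/ler_addgt0Pr => e e0.
have [|psi1 G1 h1] := @d_sigma_lt a b (d_sigma sigma a b / 2 + e / 4).
  by lra.
have [|psi2 G2 h2] := @d_sigma_lt b c (d_sigma sigma b c / 2 + e / 4).
  by lra.
have [G3 _] := in_G_comp G1 G2.
apply: (le_trans (d_sigma_le a c G3)).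
have g1 : 0 < d_sigma sigma a b / 2 + e / 4 by have := d_sigma_ge0 a b; lra.
have g2 : 0 < d_sigma sigma b c / 2 + e / 4 by have := d_sigma_ge0 b c; lra.
have [h|h] := ltP ((d_sigma sigma a b / 2 + e / 4) + (d_sigma sigma b c / 2 + e / 4)) pi.
  have := angle_triangle G1 G2 g1 g2 h (ltW h1) (ltW h2); lra.
case/andP: (angle_range a c G3) => _ h3; lra.
Qed.

(** * Separation *)

Lemma norm_sin_mulrn (n : nat) (x : R) : `|sin (n%:R * x)| <= n%:R * `|sin x|.
Proof.
elim: n => [|n IH]; first by rewrite !mul0r sin0 normr0.
rewrite -natr1 !mulrDl !mul1r sinD (le_trans (ler_normD _ _))// !normrM lerD//.
  by rewrite (le_trans _ IH)// ler_piMr// cos_max.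
by rewrite ler_piMl// cos_max.
Qed.

Lemma cos_half_sin (x : R) : 1 - cos x = 2 * sin (x / 2) ^+ 2.
Proof.
have -> : cos x = cos ((x / 2) *+ 2) by rewrite -mulr_natr divfK.
by rewrite cos_mulr2n cos2sin2 mulr2n; ring.
Qed.

(** Since |sin (n x)| <= n |sin x|, multiplying an angle by n multiplies the
squared chord by at most n^2. It converts the closeness of omega / (2 sigma)
to 0 into that of omega. *)
Lemma cos_mulrn_le (n : nat) (x : R) : 1 - cos (n%:R * x) <= n%:R ^+ 2 * (1 - cos x).
Proof.
rewrite !cos_half_sin [leRHS]mulrCA ler_pM2l// -[X in sin X]mulrA -exprMn -[leLHS]real_normK ?num_real//.
rewrite -[leRHS]real_normK ?num_real// lerXn2r ?nnegrE//.
by rewrite normrM normr_nat; exact: norm_sin_mulrn.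
Qed.

Lemma dot_diff (u v : 'rV[R]_d) (i : 'I_d) : dot u u = 1 -> dot v v = 1 ->
  (u 0 i - v 0 i) ^+ 2 <= 2 * (1 - dot u v).
Proof.
move=> u1 v1; rewrite dot_subE// -[leLHS]sqrrN opprB (bigD1 i)//= lerDl.
by apply: sumr_ge0 => j _; exact: sqr_ge0.
Qed.

Lemma omega_cos_le (n : nat) (x : R) : 2 * sigma <= n%:R -> 0 <= x <= pi ->
  1 - cos x <= n%:R ^+ 2 * (1 - cos (x / (2 * sigma))).
Proof.
move=> hn x0; have s2 : 0 < 2 * sigma by rewrite mulr_gt0.
have n0 : 0 < n%:R :> R by exact: lt_le_trans hn.
have {1}-> : x = n%:R * (x / n%:R) by rewrite mulrC divfK// gt_eqF.
apply: (le_trans (cos_mulrn_le _ _)); rewrite ler_pM2l ?exprn_gt0// lerD2l lerN2.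
have h := div2sigma_range x0; case/andP: (x0) => x00 x0p.
rewrite ler_cos//.
  by rewrite ler_wpM2l// lef_pV2.
rewrite divr_ge0 ?(ltW n0)//= (le_trans _ (_ : x / (2 * sigma) <= pi))//; last by case/andP: h.
by rewrite ler_wpM2l// lef_pV2.
Qed.

(** Here m stands for sqrt(psi'), c for the cosine of omega / (2 sigma), and u, v
for coordinates of a(s) and b(psi s). The first term of B is the integrand of
2 (1 - corr), so its integral is small when the angle is; lam balances it
against the second term, which is only bounded. *)
Lemma pointwise_close (N lam m c u v : R) : 1 <= N -> 0 < lam -> 0 <= m -> c <= 1 ->
  `|u| <= 1 -> `|v| <= 1 -> (u - v) ^+ 2 <= 2 * (N * (1 - c)) ->
  let B := N / (2 * lam) * (1 + m ^+ 2 - 2 * m * c) + 5 * lam / 4 * (1 + m ^+ 2) in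
  `|u - v * m ^+ 2| <= B /\ `|1 - m ^+ 2| <= B.
Proof.
move=> N1 l0 m0 c1 u1 v1 uv /=.
have young (x y : R) : x * y <= x ^+ 2 / (2 * lam) + lam / 2 * y ^+ 2.
  have := sqr_ge0 (x - lam * y); rewrite -(pmulr_rge0 _ (_ : 0 < (2 * lam)^-1)); last first.
    by rewrite invr_gt0 mulr_gt0.
  move=> h; rewrite -subr_ge0; apply: le_trans h _; rewrite le_eqVlt; apply/orP; left.
  by apply/eqP; field; rewrite gt_eqF.
set A := N / _ * _ + _; have A0 : `|1 - m| * (1 + m) + m * `|u - v| <= A.
  have := young `|1 - m| (1 + m); have := young (`|u - v|) 1.
  move=> /(ler_wpM2l m0); rewrite !real_normK ?num_real// expr1n => h1 h2.
  have h3 : m * ((u - v) ^+ 2 / (2 * lam)) <= N / (2 * lam) * (2 * m * (1 - c)).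
    rewrite (_ : N / (2 * lam) * _ = m * (2 * (N * (1 - c)) / (2 * lam))); last by ring.
    by rewrite ler_wpM2l// ler_wpM2r// invr_ge0 mulr_ge0// ltW.
  have h4 : (1 - m) ^+ 2 / (2 * lam) <= N / (2 * lam) * (1 - m) ^+ 2.
    by rewrite [leRHS]mulrAC ler_wpM2r ?invr_ge0 ?mulr_ge0 ?(ltW l0)// ler_peMl// sqr_ge0.
  have h5 : 0 <= lam * (1 - m) ^+ 2 by rewrite mulr_ge0 ?sqr_ge0 ?(ltW l0).
  rewrite /A (_ : 1 + m ^+ 2 - 2 * m * c = (1 - m) ^+ 2 + 2 * m * (1 - c)); last by ring.
  rewrite [N / _ * (_ + _)]mulrDr; move: h1 h2 h3 h4 h5.
  set X := N / (2 * lam) * (2 * m * (1 - c)); set Y := _ * (1 - m) ^+ 2.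
  set Z := (1 - m) ^+ 2 / _; set W := m * ((u - v) ^+ 2 / _).
  rewrite mulrDr -/W mulrA mulr1 => h1 h2 h3 h4 h5.
  nra.
have e1 : `|1 - m ^+ 2| = `|1 - m| * (1 + m).
  by rewrite (_ : 1 - m ^+ 2 = (1 - m) * (1 + m)) ?normrM ?(ger0_norm (_ : 0 <= 1 + m)) ?addr_ge0//; ring.
split; last by rewrite e1 (le_trans _ A0)// lerDl mulr_ge0.
(* The weight m^2 is reached through m, since only 1 - m and m (u - v) are
   controlled. *)
rewrite (_ : u - v * m ^+ 2 = u * (1 - m) + m * (u - v) + m * (1 - m) * v); last by ring.
apply: le_trans A0; rewrite (le_trans (ler_normD _ _))// (le_trans (lerD (ler_normD _ _) (lexx _)))//.
rewrite !normrM (ger0_norm m0).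
have : `|u| * `|1 - m| <= `|1 - m| by rewrite ler_piMl.
have : m * `|1 - m| * `|v| <= m * `|1 - m| by rewrite ler_piMr// mulr_ge0.
lra.
Qed.

Lemma Rintegral_sub_le (f g : R -> R) (x : R) : 0 <= x <= 1 ->
  (@lebesgue_measure R).-integrable unitI (EFin \o f) ->
  (@lebesgue_measure R).-integrable unitI (EFin \o g) ->
  {ae mu, forall s, unitI s -> `|f s| <= g s} ->
  `|\int[mu]_(s in `[0, x]) f s| <= \int[mu]_(s in unitI) g s.
Proof.
move=> x01 iF iG fg; have sub := sub_unitI x01.
have iFx : (@lebesgue_measure R).-integrable `[0, x] (EFin \o f).
  by apply: (integrableS _ _ _ iF).
have iN : (@lebesgue_measure R).-integrable unitI (EFin \o (fun s => `|f s|)).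
  exact: integrable_norm iF.
have iNx : (@lebesgue_measure R).-integrable `[0, x] (EFin \o (fun s => `|f s|)).
  exact: integrable_norm iFx.
apply: (le_trans (le_normr_Rintegral _ iFx)) => //.
apply: (@le_trans _ _ (\int[mu]_(s in unitI) `|f s|)).
  rewrite -lee_fin !EFin_Rintegral//.
  apply: ge0_subset_integral => //; by case/integrableP : iN.
rewrite -subr_ge0; have [j e] := Rintegral_lin (-1) mI iG iN.
rewrite -[X in _ + X]mulN1r -e; apply: Rintegral_ge0_ae => //.
by apply: filterS fg => s + sI => /(_ sI) h; rewrite mulN1r subr_ge0.
Qed.

Lemma sphere_coord_le1 a (i : 'I_d) s : unitI s -> `|a s 0 i| <= 1.
Proof.
move=> sI; rewrite -(@ler_pXn2r _ 2)// ?nnegrE// expr1n real_normK ?num_real//.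
rewrite -(sphere_fun_unit a sI) /dot (bigD1 i)//= -expr2 lerDl sumr_ge0// => j _.
by rewrite -expr2 sqr_ge0.
Qed.

Lemma sphere_coord_integrable a (i : 'I_d) :
  (@lebesgue_measure R).-integrable unitI (EFin \o (fun s => a s 0 i)).
Proof.
apply: (@bounded_itv_integrable _ _ _ 1) => [|s s01]; first exact: sphere_fun_measurable.
by apply: sphere_coord_le1; rewrite /unitI/= in_itv.
Qed.

(** Integrating [pointwise_close] over [0, x]: the integral of b(psi) psi' over
[0, x] is that of b over [0, psi x]. *)
Lemma close_in_mean a b psi (N : nat) (lam x : R) (i : 'I_d) :
  in_G psi -> 2 * sigma <= N%:R -> 0 < lam -> 0 <= x <= 1 ->
  let B := N%:R ^+ 2 * (1 - corr a b psi) / lam + 5 * lam / 2 in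
  `|\int[mu]_(s in `[0, x]) (a s 0 i) - \int[mu]_(s in `[0, psi x]) (b s 0 i)| <= B
  /\ `|x - psi x| <= B.
Proof.
move=> G1 hN l0 x01 /=.
have [id1 ed1] := in_G_derive1_unitI G1.
have [idx edx] := in_G_integrable_derive1 G1 x01.
have coord1 c s := @sphere_coord_le1 c i s; have icoord c := sphere_coord_integrable c i.
have o01 : (0 : R) <= 1 <= (1 : R) by rewrite ler01 lexx.
have [iU _] := in_G_change_of_variables_real G1 o01 (icoord b).
have [ix ex] := in_G_change_of_variables_real G1 x01 (icoord b).
set g := fun s => N%:R ^+ 2 / (2 * lam) * (1 + derive1 psi s -
   2 * (Num.sqrt (derive1 psi s) * cos (omega a b psi s / (2 * sigma)))) +
   5 * lam / 4 * (1 + derive1 psi s).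
have [ig eg] : (@lebesgue_measure R).-integrable unitI (EFin \o g) /\
    \int[mu]_(s in unitI) g s = N%:R ^+ 2 * (1 - corr a b psi) / lam + 5 * lam / 2.
  pose k := N%:R ^+ 2 / (2 * lam); pose l := 5 * lam / 4.
  have [j1 e1] := Rintegral_lin (k + l) mI (integrable_unitI_cst (k + l)) id1.
  have [j2 e2] := Rintegral_lin (- (2 * k)) mI j1 (corr_integrable a b G1).
  have gE : g = fun s => cst (k + l) s + (k + l) * derive1 psi s + - (2 * k) *
      (Num.sqrt (derive1 psi s) * cos (omega a b psi s / (2 * sigma))).
    by apply/funext => s; rewrite /g /= -/k -/l; ring.
  rewrite gE; split => //; rewrite e2 e1 ed1 Rintegral_unitI_cst -/(corr a b psi).
  by rewrite /k /l; field; rewrite gt_eqF.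
have N1 : 1 <= N%:R ^+ 2 :> R by rewrite exprn_ege1// (le_trans sigma1).
have close : {ae mu, forall s, unitI s -> `|a s 0 i - b (psi s) 0 i * derive1 psi s| <= g s
    /\ `|1 - derive1 psi s| <= g s}.
  apply: filterS (in_G_gt0 G1) => s + sI => /(_ sI) d0.
  set m := Num.sqrt (derive1 psi s).
  have m2 : m ^+ 2 = derive1 psi s by rewrite sqr_sqrtr// ltW.
  have psI := in_G_range G1 sI.
  have := @pointwise_close (N%:R ^+ 2) lam m (cos (omega a b psi s / (2 * sigma)))
    (a s 0 i) (b (psi s) 0 i) N1 l0 (sqrtr_ge0 _) (cos_le1 _) (coord1 a _ sI) (coord1 b _ psI).
  rewrite /= m2 /g -/m -[2 * m * _]mulrA; apply.
  apply: (le_trans (dot_diff i (sphere_fun_unit a sI) (sphere_fun_unit b psI))).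
  rewrite ler_wpM2l//; have := omega_cos_le hN (omega_range a b G1 sI).
  by rewrite {1}/omega acosK//; exact: dot_range.
have sub := sub_unitI x01.
have sI f : (@lebesgue_measure R).-integrable unitI (EFin \o f) ->
    (@lebesgue_measure R).-integrable `[0, x] (EFin \o f).
  by move=> h; apply: (integrableS _ _ _ h).
rewrite -eg; split.
  have [j e] := Rintegral_lin (-1) mI (icoord a) iU.
  have [jx e'] := Rintegral_lin (-1) (measurable_itv `[0, x]) (sI _ (icoord a)) ix.
  rewrite -ex -[X in _ + X]mulN1r -e'; apply: Rintegral_sub_le => //.
  by apply: filterS close => s + Is => /(_ Is)[h _]; rewrite mulN1r.
have [j e] := Rintegral_lin (-1) mI (integrable_unitI_cst 1) id1.
have [jx e'] := Rintegral_lin (-1) (measurable_itv `[0, x]) (sI _ (integrable_unitI_cst 1)) idx.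
have -> : x - psi x = \int[mu]_(s in `[0, x]) (cst 1 s + -1 * derive1 psi s).
  rewrite e' edx mulN1r Rintegral_cst// mul1r [X in fine X](lebesgue_measure_itv `[0, x])/= lte_fin.
  case/andP: x01; rewrite le_eqVlt => /predU1P[<-|->] _; first by rewrite ltxx/=.
  by rewrite -EFinB /= subr0.
apply: Rintegral_sub_le => //.
by apply: filterS close => s + Is => /(_ Is)[_ h]; rewrite mulN1r.
Qed.

Lemma abs_continuous_modulus (F : R -> R) (e : R) : abs_continuous 0 1 F -> 0 < e ->
  exists2 delta : R, 0 < delta & forall u v, 0 <= u <= 1 -> 0 <= v <= 1 ->
    `|u - v| < delta -> `|F u - F v| < e.
Proof.
move=> acF e0; have [delta delta0 H] := acF e e0; exists delta => //.
have H' u v : 0 <= u -> u <= v -> v <= 1 -> v - u < delta -> `|F v - F u| < e.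
  move=> u0 uv v1 uvd; have := H 1%N (fun=> u) (fun=> v); rewrite !big_ord1; apply => //.
  by move=> i j _ _ _; rewrite !ord1.
move=> u v /andP[u0 u1] /andP[v0 v1]; have [uv|/ltW uv] := leP u v.
  rewrite distrC (distrC (F u)) ger0_norm ?subr_ge0//; exact: H'.
rewrite ger0_norm ?subr_ge0//; exact: H'.
Qed.

(** Along reparametrizations with angle tending to 0, [close_in_mean] shows that
psi x tends to x and that the primitives of the coordinates of a and b agree
in the limit. Equal primitives have almost everywhere equal derivatives. *)
Lemma d_sigma_eq0 a b : d_sigma sigma a b = 0 -> sphere_ae_eq a b.
Proof.
move=> d0.
have icoord := sphere_coord_integrable.
have eqprim i x : 0 <= x <= 1 ->
    primitive (fun s => a s 0 i) x = primitive (fun s => b s 0 i) x.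
  move=> x01; apply/eqP; rewrite -subr_eq0 -normr_le0; apply/ler_addgt0Pr => e e0.
  have [acb _] := unitI_primitive (icoord b i).
  have [delta delta0 Hd] := abs_continuous_modulus acb (divr_gt0 e0 (ltr0n R 2)).
  have := archi_boundP (ltW (mulr_gt0 (ltr0n R 2) sigma0)).
  set N := Num.bound _ => /ltW hN.
  have N1 : 1 <= N%:R :> R by exact: le_trans hN.
  have N2 : 1 <= N%:R ^+ 2 :> R by rewrite exprn_ege1.
  (* With lam = be / 5 and 1 - corr <= de, the bound of close_in_mean is at most
     be / 4 + be / 2, below both e / 2 and the modulus delta. *)
  pose be := Num.min (delta / 2) (e / 2).
  have be0 : 0 < be by rewrite lt_min !divr_gt0.
  pose lam := be / 5.
  have lam0 : 0 < lam by rewrite divr_gt0.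
  pose de := Num.min 1 (lam * (be / 4) / N%:R ^+ 2).
  have de0 : 0 < de.
    by rewrite lt_min ltr01 divr_gt0 ?mulr_gt0 ?divr_gt0// (lt_le_trans ltr01).
  have de1 : de <= 1 by rewrite ge_min lexx.
  have de2 : N%:R ^+ 2 * de / lam <= be / 4.
    rewrite ler_pdivrMr// mulrC -ler_pdivlMr ?(lt_le_trans ltr01)// [be / 4 * lam]mulrC.
    by rewrite ge_min lexx orbT.
  have de01 : -1 <= 1 - de <= 1 by lra.
  have [|psi G1 hang] := @d_sigma_lt a b (acos (1 - de)).
    rewrite d0 mulr_gt0// lt_neqAle acos_ge0// andbT; apply/negP => /eqP h.
    by have := acosK de01; rewrite -h cos0; lra.
  have hcorr : 1 - corr a b psi <= de.
    have := ltW hang; rewrite /angle le_acos//; last exact: corr_range.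
    by rewrite -/(corr a b psi); lra.
  have [h1 h2] := close_in_mean a b i G1 hN lam0 x01.
  have B : N%:R ^+ 2 * (1 - corr a b psi) / lam + 5 * lam / 2 <= 3 / 4 * be.
    have : N%:R ^+ 2 * (1 - corr a b psi) / lam <= be / 4.
      apply: le_trans de2; rewrite ler_pM2r ?invr_gt0// ler_pM2l//.
      by rewrite (lt_le_trans ltr01).
    by rewrite {3}/lam; lra.
  have px01 := in_G_01 G1 x01.
  have bd : be <= delta / 2 by rewrite ge_min lexx.
  have be2 : be <= e / 2 by rewrite ge_min lexx orbT.
  have := Hd _ _ px01 x01; rewrite distrC => /(_ ltac:(lra)) h3.
  rewrite add0r.
  have -> : primitive (fun s => a s 0 i) x - primitive (fun s => b s 0 i) x =
    (primitive (fun s => a s 0 i) x - primitive (fun s => b s 0 i) (psi x)) +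
    (primitive (fun s => b s 0 i) (psi x) - primitive (fun s => b s 0 i) x) by ring.
  apply: (le_trans (ler_normD _ _)).
  move: h1; rewrite -/(primitive (fun s => a s 0 i) x) -/(primitive (fun s => b s 0 i) (psi x)).
  lra.
have coord i : {ae mu, forall s, unitI s -> a s 0 i = b s 0 i}.
  have [_ da] := unitI_primitive (icoord a i); have [_ db] := unitI_primitive (icoord b i).
  apply: ae_unitI_oo; apply: filterS2 da db => s + + s01.
  have sI : unitI s by rewrite /unitI/= in_itv/=; case/andP: s01 => /ltW -> /ltW.
  move=> /(_ sI)[_ <-] /(_ sI)[_ <-]; rewrite !derive1E; apply: near_eq_derive.
    have : \forall x \near s, 0 < x < 1.
      by apply: near_in_itvoo; rewrite in_itv.
    by apply: filterS => x /andP[x0 x1]; apply: eqprim; rewrite !ltW.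
apply/asboolP.
have : {ae mu, forall s, forall i, unitI s -> a s 0 i = b s 0 i}.
  exact: filter_forall.
by apply: filterS => s h sI; apply/rowP => i; exact: h.
Qed.

Lemma d_sigma_refl a : d_sigma sigma a a = 0.
Proof.
apply/le_anti; rewrite d_sigma_ge0 andbT (le_trans (d_sigma_le a a (in_G_id R)))//.
have -> : angle sigma a a idfun = acos (\int[mu]_(s in unitI) (1 : R)).
  congr acos; apply: eq_Rintegral => s; rewrite inE => sI.
  rewrite /omega sphere_fun_unit// acos1 mul0r cos0 mulr1.
  by rewrite derive1E derive_id sqrtr1.
by rewrite Rintegral_unitI_cst acos1 mulr0.
Qed.
End distance.

Lemma d_sigma_M_pi (R : realType) (d : nat) (sigma : R) (a b : sphere_fun R d) :
  0 < sigma -> 1 <= 2 * sigma ->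
  d_sigma_M sigma (\pi_(M R d)%qT a) (\pi_(M R d)%qT b) = d_sigma sigma a b.
Proof.
move=> s0 s1; apply: d_sigma_ae_eq => //; exact/eqmodP/reprK.
Qed.

Lemma d_sigma_M_distance (R : realType) (d : nat) (sigma : R) :
  0 < sigma -> 1 <= 2 * sigma -> is_distance (@d_sigma_M R d sigma).
Proof.
move=> s0 s1; split.
- by move=> x y; exact: d_sigma_ge0.
- move=> x y; split => [/(d_sigma_eq0 s0 s1) e|<-]; last exact: d_sigma_refl.
  by rewrite -(reprK x) -(reprK y); exact/eqmodP.
- by move=> x y; exact: d_sigma_sym.
- by move=> x y z; exact: d_sigma_triangle.
Qed.

(** * Calculus of absolutely continuous functions on the unit interval *)

Lemma integral_ae_le (d : measure_display) (T : measurableType d) (R : realType)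
    (m : {measure set T -> \bar R}) (D : set T) (f J : T -> \bar R) : measurable D ->
  m.-integrable D f -> measurable_fun D J -> (forall x, D x -> 0%R <= J x)%E ->
  {ae m, forall x, D x -> (f x <= J x)%E} ->
  (\int[m]_(x in D) f x <= \int[m]_(x in D) J x)%E.
Proof.
move=> mD iF mJ J0 fJ; have FF := ae_filter_ringOfSetsType m.
rewrite integralE (@le_trans _ _ (\int[m]_(x in D) (f^\+ x))%E)//.
  by rewrite leeBlDr ?leeDl ?integral_ge0//; apply: integrable_neg_fin_num.
apply: ae_ge0_le_integral => //.
- by apply: measurable_funepos; case/integrableP : iF.
- by apply: filterS fJ => x + Dx => /(_ Dx) h; rewrite funeposE ge_max h J0.
Qed.

Section ac_calculus.
Context {R : realType}.
Implicit Types f g F : R -> R.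

Lemma abs_continuous_cst (k : R) : abs_continuous 0 1 (cst k : R -> R).
Proof.
by apply: (@abs_continuous_lipschitz _ _ _ _ 0) => // u v _ _ _; rewrite subrr normr0 mul0r.
Qed.

Lemma abs_continuousD01 f g : abs_continuous 0 1 f -> abs_continuous 0 1 g ->
  abs_continuous 0 1 (fun t => f t + g t).
Proof.
move=> af ag; apply: (abs_continuous_dominated (K := 1) _ af ag) => // u v _ _ _.
by rewrite mul1r opprD addrACA ler_normD.
Qed.

Lemma abs_continuousM01 f g : abs_continuous 0 1 f -> abs_continuous 0 1 g ->
  abs_continuous 0 1 (fun t => f t * g t).
Proof. exact: abs_continuousM. Qed.

Lemma abs_continuousZ01 (k : R) f : abs_continuous 0 1 f ->
  abs_continuous 0 1 (fun t => k * f t).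
Proof. by move=> af; apply: (abs_continuousM01 (abs_continuous_cst k) af). Qed.

Lemma abs_continuous_lipschitz_comp (k : R) (V : normedModType R) (f : R -> V) F : 0 <= k ->
  abs_continuous 0 1 f ->
  (forall u v, 0 <= u <= 1 -> 0 <= v <= 1 -> `|F v - F u| <= k * `|f v - f u|) ->
  abs_continuous 0 1 F.
Proof.
move=> k0 af H; apply: (abs_continuous_dominated k0 af af) => u v u0 uv v1.
rewrite (le_trans (H _ _ _ _)) ?u0 ?(le_trans uv)//= ?v1 ?(le_trans u0)//.
by rewrite ler_wpM2l// lerDl.
Qed.

Lemma sin_lipschitz (x y : R) : `|sin x - sin y| <= `|x - y|.
Proof.
wlog xy : x y / y <= x => [H|].
  by have [/H//|/ltW/H] := leP y x; rewrite distrC [leRHS]distrC.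
have [|c _ ->] := @MVT_segment _ sin cos _ _ xy (fun z _ => is_derive_sin z).
  by apply: continuous_subspaceT; exact: continuous_sin.
by rewrite normrM ler_piMl// cos_max.
Qed.

Lemma cos_lipschitz (x y : R) : `|cos x - cos y| <= `|x - y|.
Proof.
by rewrite -!sinDpihalf (le_trans (sin_lipschitz _ _))// opprD addrACA subrr addr0.
Qed.

Lemma abs_continuous_affine (k c : R) : abs_continuous 0 1 (fun t : R => k * t + c).
Proof.
apply: (@abs_continuous_lipschitz _ _ _ _ `|k|) => // u v _ uv _.
rewrite (_ : _ - _ = k * (v - u)); last by ring.
by rewrite normrM (ger0_norm (_ : 0 <= v - u))// subr_ge0.
Qed.

Lemma abs_continuous_sin f : abs_continuous 0 1 f -> abs_continuous 0 1 (fun t => sin (f t)).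
Proof.
move=> af; apply: (abs_continuous_lipschitz_comp ler01 af) => u v _ _.
by rewrite mul1r sin_lipschitz.
Qed.

Lemma abs_continuous_cos f : abs_continuous 0 1 f -> abs_continuous 0 1 (fun t => cos (f t)).
Proof.
move=> af; apply: (abs_continuous_lipschitz_comp ler01 af) => u v _ _.
by rewrite mul1r cos_lipschitz.
Qed.

Lemma abs_continuousV01 (c : R) f : 0 < c -> (forall t, 0 <= t <= 1 -> c <= f t) ->
  abs_continuous 0 1 f -> abs_continuous 0 1 (fun t => (f t)^-1).
Proof.
move=> c0 cf af.
have k0 : 0 <= c^-1 ^+ 2 by exact: sqr_ge0.
apply: (abs_continuous_lipschitz_comp k0 af) => u v u01 v01.
have fu := lt_le_trans c0 (cf _ u01); have fv := lt_le_trans c0 (cf _ v01).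
rewrite (_ : _ - _ = ((f v)^-1 * (f u)^-1) * - (f v - f u)); last first.
  by field; rewrite !gt_eqF.
rewrite normrM normrN ler_wpM2r// ger0_norm ?mulr_ge0 ?invr_ge0 ?(ltW fu) ?(ltW fv)//.
by rewrite expr2 ler_pM ?invr_ge0 ?(ltW fu) ?(ltW fv)// lef_pV2// ?posrE// cf.
Qed.

Lemma abs_continuous_sqrt (c : R) f : 0 < c -> (forall t, 0 <= t <= 1 -> c <= f t) ->
  abs_continuous 0 1 f -> abs_continuous 0 1 (fun t => Num.sqrt (f t)).
Proof.
move=> c0 cf af; have sc0 : 0 < Num.sqrt c by rewrite sqrtr_gt0.
have k0 : 0 <= (Num.sqrt c)^-1 by rewrite invr_ge0 ltW.
apply: (abs_continuous_lipschitz_comp k0 af) => u v u01 v01.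
have fu := lt_le_trans c0 (cf _ u01); have fv := lt_le_trans c0 (cf _ v01).
rewrite -{2}(sqr_sqrtr (ltW fv)) -{2}(sqr_sqrtr (ltW fu)) subr_sqr normrM mulrCA ler_peMr//.
rewrite mulrC ler_pdivlMr// mul1r ger0_norm ?addr_ge0// (le_trans (_ : _ <= Num.sqrt (f v)))//.
  by rewrite ler_sqrt ?cf// ltW.
by rewrite lerDl.
Qed.

Lemma abs_continuous_ge_pos f : abs_continuous 0 1 f ->
  (forall t, 0 <= t <= 1 -> 0 < f t) ->
  exists2 c : R, 0 < c & forall t, 0 <= t <= 1 -> c <= f t.
Proof.
move=> af f0.
have [|c c01 H] := @EVT_min _ f 0 1 ler01; first exact: abs_continuous_within.
by exists (f c) => [|t t01]; [apply: f0; rewrite in_itv in c01|apply: H; rewrite in_itv].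
Qed.

(** The integral of a nonnegative function, measurable or not, is a supremum over
the simple functions below it. *)
Lemma ge0_le_integral_any (d : measure_display) (T : measurableType d)
    (m : {measure set T -> \bar R}) (D : set T) (f g : T -> \bar R) :
  (forall x, D x -> 0%R <= f x)%E -> (forall x, D x -> f x <= g x)%E ->
  (\int[m]_(x in D) f x <= \int[m]_(x in D) g x)%E.
Proof.
move=> f0 fg; have g0 x : D x -> (0%R <= g x)%E by move=> Dx; rewrite (le_trans (f0 _ Dx))// fg.
rewrite !ge0_integralE//; apply: le_ereal_sup => _ [h hf <-]; exists h => // x.
rewrite (le_trans (hf x))// /patch; case: ifPn => //; rewrite inE; exact: fg.
Qed.

Lemma abs_continuous_le_integral F (e : R -> \bar R) :
  abs_continuous 0 1 F -> measurable_fun unitI e -> (forall t, unitI t -> 0%R <= e t)%E ->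
  {ae mu, forall t, unitI t -> ((derive1 F t)%:E <= e t)%E} ->
  ((F 1 - F 0)%:E <= \int[mu]_(t in unitI) e t)%E.
Proof.
move=> aF me e0 Fe; have [h [ih hF dF]] := abs_continuous_FTC ltr01 aF.
have mI := @measurable_unitI R.
have ihI : (@lebesgue_measure R).-integrable unitI (EFin \o h) by exact: integrableS ih.
rewrite hF ?ler01 ?lexx// addrAC subrr add0r EFin_Rintegral//.
apply: integral_ae_le => //; have dF' := ae_unitI_oo dF.
by apply: filterS2 dF' Fe => t + + tI => /(_ tI)[_ ->] /(_ tI).
Qed.
End ac_calculus.

(** * A one-dimensional inequality of Wirtinger type *)

Section derivative_rules.
Context {R : realType} (t : R).
Implicit Types f g : R -> R.

Lemma is_derive_add f g (df dg : R) : is_derive t 1 f df -> is_derive t 1 g dg ->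
  is_derive t 1 (fun t => f t + g t) (df + dg).
Proof. by move=> hf hg; apply: is_deriveD. Qed.

Lemma is_derive_mul f g (df dg : R) : is_derive t 1 f df -> is_derive t 1 g dg ->
  is_derive t 1 (fun t => f t * g t) (df * g t + f t * dg).
Proof.
move=> hf hg; apply: (is_derive_eq (is_deriveM hf hg)).
by rewrite /GRing.scale/= addrC mulrC.
Qed.

Lemma is_derive_const (k : R) : is_derive t 1 (fun _ : R => k) 0.
Proof. exact: is_derive_cst. Qed.

Lemma is_derive_scale (k : R) f (df : R) : is_derive t 1 f df ->
  is_derive t 1 (fun t => k * f t) (k * df).
Proof.
by move=> hf; apply: (is_derive_eq (is_derive_mul (is_derive_const k) hf)); rewrite mul0r add0r.
Qed.

Lemma is_derive_affine (k c : R) : is_derive t 1 (fun t => k * t + c) k.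
Proof.
apply: (is_derive_eq (is_derive_add (is_derive_scale k (is_derive_id t 1)) (is_derive_const c))).
by rewrite mulr1 addr0.
Qed.

Lemma is_derive_sin_comp f (df : R) : is_derive t 1 f df ->
  is_derive t 1 (fun t => sin (f t)) (cos (f t) * df).
Proof. by move=> hf; apply: (@is_derive1_comp _ sin f). Qed.

Lemma is_derive_cos_comp f (df : R) : is_derive t 1 f df ->
  is_derive t 1 (fun t => cos (f t)) (- sin (f t) * df).
Proof. by move=> hf; apply: (@is_derive1_comp _ cos f). Qed.

Lemma is_derive_inv f (df : R) : f t != 0 -> is_derive t 1 f df ->
  is_derive t 1 (fun t => (f t)^-1) (- df / f t ^+ 2).
Proof.
move=> f0 hf; apply: (is_derive_eq (is_deriveV f0 hf)).
by rewrite /GRing.scale/= mulNr mulNr mulrC.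
Qed.

End derivative_rules.

(** With g the solution of g'' = - r^2 g with the same end values as x, and
q = x - g, the function
F = A q^2 + 2 g' q + g' g + r^2 (primitive of x^2)
satisfies x'^2 - F' = (q' - A q)^2 as soon as A' = - r^2 - A^2. Integrating F'
over [0, 1] gives a sharp lower bound for the integral of x'^2 by the integral
of x^2 and the end values. *)
Lemma wirtinger (R : realType) (r : R) (x : R -> R) : 0 < r < pi -> abs_continuous 0 1 x ->
  exists F : R -> R, [/\ abs_continuous 0 1 F,
    {ae mu, forall t, unitI t -> derivable x t 1 -> derive1 F t <= derive1 x t ^+ 2} &
    F 1 - F 0 = r ^+ 2 * (\int[mu]_(t in unitI) (x t ^+ 2)) +
      r / sin r * ((x 0 ^+ 2 + x 1 ^+ 2) * cos r - 2 * (x 0 * x 1))].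
Proof.
move=> /andP[r0 rpi] ax.
have sr0 : 0 < sin r by apply: sin_gt0_pi; rewrite r0.
pose k := (x 1 - x 0 * cos r) / sin r.
pose g (t : R) := x 0 * cos (r * t + 0) + k * sin (r * t + 0).
pose gd (t : R) := r * (k * cos (r * t + 0) - x 0 * sin (r * t + 0)).
(* A = - r tan (r (t - 1/2)) solves the Riccati equation on the whole interval
   because r < pi keeps the argument inside ]-pi/2, pi/2[. *)
pose C (t : R) := cos (r * t + - (r / 2)).
pose A (t : R) := (- r) * (sin (r * t + - (r / 2)) * (C t)^-1).
have C0 t : 0 <= t <= 1 -> cos (r / 2) <= C t.
  move=> /andP[t0 t1]; rewrite /C -[leRHS]cos_norm ler_cos.
  - by rewrite ler_norml; nra.
  - by lra.
  - by rewrite normr_ge0/= ler_norml; nra.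
have c0 : 0 < cos (r / 2) by apply: cos_gt0_pihalf; lra.
pose q (t : R) := x t + -1 * g t.
have ag : abs_continuous 0 1 g.
  apply: abs_continuousD01; apply: abs_continuousZ01.
  - exact: abs_continuous_cos (abs_continuous_affine _ _).
  - exact: abs_continuous_sin (abs_continuous_affine _ _).
have agd : abs_continuous 0 1 gd.
  apply: abs_continuousZ01; apply: abs_continuousD01.
  - apply: abs_continuousZ01; exact: abs_continuous_cos (abs_continuous_affine _ _).
  - rewrite (_ : (fun t : R => _) = (fun t => - x 0 * sin (r * t + 0))); last by apply/funext => t; rewrite mulNr.
    apply: abs_continuousZ01; exact: abs_continuous_sin (abs_continuous_affine _ _).
have aA : abs_continuous 0 1 A.
  apply: abs_continuousZ01; apply: abs_continuousM01.
    exact: abs_continuous_sin (abs_continuous_affine _ _).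
  apply: (abs_continuousV01 c0 C0); exact: abs_continuous_cos (abs_continuous_affine _ _).
have aq : abs_continuous 0 1 q by apply: abs_continuousD01 => //; exact: abs_continuousZ01.
have ax2 : abs_continuous 0 1 (fun t => x t ^+ 2) by exact: (abs_continuousM01 ax ax).
have ix2 : (@lebesgue_measure R).-integrable unitI (EFin \o (fun t => x t ^+ 2)).
  apply: continuous_compact_integrable; first exact: segment_compact.
  exact: abs_continuous_within.
have [aP dP] := unitI_primitive ix2.
pose F (t : R) := A t * (q t * q t) + 2 * (gd t * q t) + gd t * g t + r ^+ 2 * primitive (fun t => x t ^+ 2) t.
exists F; split.
- apply: abs_continuousD01; last exact: abs_continuousZ01.
  apply: abs_continuousD01; last exact: abs_continuousM01.
  apply: abs_continuousD01; last by apply: abs_continuousZ01; exact: abs_continuousM01.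
  by apply: abs_continuousM01 => //; exact: abs_continuousM01.
- apply: filterS dP => t + tI => /(_ tI)[dP1 dP2] dx.
  have hx : is_derive t 1 x (derive1 x t) by rewrite derive1E; exact/derivableP.
  have hP : is_derive t 1 (primitive (fun t => x t ^+ 2)) (x t ^+ 2).
    by rewrite -dP2 derive1E; exact/derivableP.
  have hu := is_derive_affine t r 0; have hv := is_derive_affine t r (- (r / 2)).
  have Ct : 0 < C t by apply: lt_le_trans c0 (C0 _ _); move: tI; rewrite /unitI/= in_itv.
  have hg : is_derive t 1 g (gd t).
    apply: (is_derive_eq (is_derive_add (is_derive_scale _ (is_derive_cos_comp hu))
      (is_derive_scale _ (is_derive_sin_comp hu)))).
    by rewrite /gd; ring.
  have hgd : is_derive t 1 gd (- r ^+ 2 * g t).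
    have h1 := is_derive_scale k (is_derive_cos_comp hu).
    have h2 := is_derive_scale (- x 0) (is_derive_sin_comp hu).
    rewrite /gd (_ : (fun t : R => _) = (fun t => r * (k * cos (r * t + 0) + - x 0 * sin (r * t + 0)))).
      apply: (is_derive_eq (is_derive_scale r (is_derive_add h1 h2))); rewrite /g; ring.
    by apply/funext => z; rewrite mulNr.
  have hA : is_derive t 1 A (- r ^+ 2 - A t ^+ 2).
    have hC := is_derive_cos_comp hv.
    apply: (is_derive_eq (is_derive_scale _ (is_derive_mul (is_derive_sin_comp hv)
      (is_derive_inv (lt0r_neq0 Ct) hC)))).
    by rewrite /A /C; field; exact: lt0r_neq0.
  have hq : is_derive t 1 q (derive1 x t + -1 * gd t).
    exact: is_derive_add hx (is_derive_scale _ hg).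
  have hF := is_derive_add (is_derive_add (is_derive_add (is_derive_mul hA (is_derive_mul hq hq))
    (is_derive_scale 2 (is_derive_mul hgd hq))) (is_derive_mul hgd hg)) (is_derive_scale (r ^+ 2) hP).
  rewrite derive1E (@derive_val _ _ _ _ _ _ _ hF).
  have xE : x t = q t + g t by rewrite /q; ring.
  have := sqr_ge0 ((derive1 x t + -1 * gd t) - A t * q t).
  rewrite xE => h; rewrite -subr_ge0.
  apply: (le_trans h); rewrite le_eqVlt; apply/orP; left; apply/eqP; ring.
- have q00 : q 0 = 0 by rewrite /q /g mulr0 addr0 cos0 sin0; ring.
  have q10 : q 1 = 0.
    by rewrite /q /g mulr1 addr0 /k; field; exact: lt0r_neq0.
  have g0 : g 0 = x 0 by move: q00; rewrite /q; lra.
  have g1 : g 1 = x 1 by move: q10; rewrite /q; lra.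
  have P0 : primitive (fun t => x t ^+ 2) 0 = 0 by rewrite /primitive set_itv1 Rintegral_set1.
  rewrite /F q00 q10 g0 g1 P0 -/(primitive (fun t => x t ^+ 2) 1).
  rewrite /gd !mulr0 !mulr1 !addr0 cos0 sin0 !mulr0 !add0r subr0 mulr1.
  have := cos2Dsin2 r => e; rewrite /k; apply/eqP; rewrite -subr_eq0; apply/eqP.
  transitivity (r * x 0 * x 1 / sin r * (1 - (cos r ^+ 2 + sin r ^+ 2))).
    by field; exact: lt0r_neq0.
  by rewrite e subrr mulr0.
Qed.

(** * Speed of a spherical curve *)

Section spherical_speed.
Context {R : realType}.

Lemma ler_mul_cos_sin (x : R) : 0 <= x <= pi / 2 -> x * cos x <= sin x.
Proof.
move=> /andP[x0 xp]; have [|c] := @MVT_segment _ sin cos _ _ x0 (fun z _ => is_derive_sin z).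
  by apply: continuous_subspaceT; exact: continuous_sin.
rewrite in_itv/= => /andP[c0 cx]; rewrite sin0 !subr0 => ->.
have pp := pi_gt0 R.
by rewrite mulrC ler_wpM2r// ler_cos//; lra.
Qed.

Lemma ler_half_sin (x : R) : 0 <= x <= pi / 2 -> x / 2 <= sin x.
Proof.
move=> /andP[x0 xp]; have pp := pi_gt0 R.
have h1 : x / 2 * cos (x / 2) <= sin (x / 2) by apply: ler_mul_cos_sin; lra.
have c0 : 0 <= cos (x / 2) by apply: cos_ge0_pihalf; lra.
have cx0 : 0 <= cos x by apply: cos_ge0_pihalf; lra.
have sx : sin x = 2 * (sin (x / 2) * cos (x / 2)).
  have -> : sin x = sin ((x / 2) *+ 2) by rewrite -mulr_natr divfK.
  by rewrite sin_mulr2n mulr2n; ring.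
have cx : cos x = 2 * cos (x / 2) ^+ 2 - 1.
  have -> : cos x = cos ((x / 2) *+ 2) by rewrite -mulr_natr divfK.
  by rewrite cos_mulr2n mulr2n; ring.
have := ler_wpM2r c0 h1; rewrite sx; nra.
Qed.

Context {d : nat}.
Implicit Types u v : 'rV[R]_d.

(** A chord of angle 2 x has length 2 sin x. The first bound is asymptotically
sharp and yields the speed, the second one is a global Lipschitz bound. *)
Lemma chord_angle u v : dot u u = 1 -> dot v v = 1 ->
  acos (dot u v) ^+ 2 * ((1 + dot u v) / 2) <= \sum_(j < d) (v 0 j - u 0 j) ^+ 2 /\
  acos (dot u v) ^+ 2 <= 4 * \sum_(j < d) (v 0 j - u 0 j) ^+ 2.
Proof.
move=> u1 v1; rewrite -dot_subE//; have uv := dot_unit u1 v1.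
set ph := acos _; have ph0 : 0 <= ph <= pi by rewrite acos_ge0// acos_lepi.
have cE : dot u v = cos ph by rewrite acosK.
have pp := pi_gt0 R.
have hx : 0 <= ph / 2 <= pi / 2 by lra.
have h1 := ler_mul_cos_sin hx; have h2 := ler_half_sin hx.
have c0 : 0 <= cos (ph / 2) by apply: cos_ge0_pihalf; lra.
have cx : cos ph = 2 * cos (ph / 2) ^+ 2 - 1.
  have -> : cos ph = cos ((ph / 2) *+ 2) by rewrite -mulr_natr divfK.
  by rewrite cos_mulr2n mulr2n; ring.
have := cos2Dsin2 (ph / 2); move: h1 h2 c0; rewrite cE cx.
set c := cos (ph / 2); set s := sin (ph / 2); set x := ph / 2.
have -> : ph = 2 * x by rewrite mulrC divfK.
move=> h1 h2 c0 e; have x0 : 0 <= x by case/andP: hx.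
have s0 : 0 <= s by lra.
have : (x * c) ^+ 2 <= s ^+ 2 by apply: lerXn2r => //; rewrite nnegrE mulr_ge0.
have : (x / 2) ^+ 2 <= s ^+ 2 by apply: lerXn2r => //; rewrite nnegrE divr_ge0.
by rewrite !exprMn => h3 h4; split; nra.
Qed.

Lemma acos_dot_dist (a u v : 'rV[R]_d) : dot a a = 1 -> dot u u = 1 -> dot v v = 1 ->
  (acos (dot a v) - acos (dot a u)) ^+ 2 <= acos (dot u v) ^+ 2.
Proof.
move=> a1 u1 v1; rewrite -[leLHS]real_normK ?num_real// ler_sqr ?nnegrE ?acos_ge0 ?dot_unit//.
have h1 := acos_dot_triangle a1 u1 v1; have h2 := acos_dot_triangle a1 v1 u1.
by rewrite ler_norml; move: h2; rewrite (dotC v); lra.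
Qed.

Lemma sum_sqr_le_norm (w : 'rV[R]_d) : \sum_(j < d) w 0 j ^+ 2 <= d%:R * `|w| ^+ 2.
Proof.
rewrite (@le_trans _ _ (\sum_(j < d) `|w| ^+ 2))//; last first.
  by rewrite sumr_const card_ord [leRHS]mulr_natl.
apply: ler_sum => j _; rewrite -[leLHS]real_normK ?num_real// ler_sqr ?nnegrE//.
by rewrite [leRHS]/Num.Def.normr/= mx_normrE; apply/bigmax_geP; right => /=; exists (0, j).
Qed.

Lemma abs_continuous_coord (al : R -> 'rV[R]_d) (j : 'I_d) :
  abs_continuous 0 1 al -> abs_continuous 0 1 (fun t => al t 0 j).
Proof.
move=> aal; apply: (abs_continuous_lipschitz_comp ler01 aal) => u v _ _.
rewrite mul1r [leRHS]/Num.Def.normr/= mx_normrE; apply/bigmax_geP; right => /=.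
by exists (0, j) => //=; rewrite !mxE.
Qed.

Lemma abs_continuous_angle (a : 'rV[R]_d) (al : R -> 'rV[R]_d) : dot a a = 1 ->
  (forall t, 0 <= t <= 1 -> dot (al t) (al t) = 1) -> abs_continuous 0 1 al ->
  abs_continuous 0 1 (fun t => acos (dot a (al t))).
Proof.
move=> a1 al1 aal; have k0 : 0 <= 2 * (1 + d%:R) :> R by rewrite mulr_ge0// addr_ge0.
apply: (abs_continuous_lipschitz_comp k0 aal) => u v u01 v01.
rewrite -[leLHS]ger0_norm// -[leRHS]ger0_norm ?mulr_ge0 ?addr_ge0// -ler_sqr ?nnegrE ?normr_ge0//.
rewrite !real_normK ?num_real// (le_trans (acos_dot_dist a1 (al1 _ u01) (al1 _ v01)))//.
have [_ h] := chord_angle (al1 _ u01) (al1 _ v01); apply: (le_trans h).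
have := sum_sqr_le_norm (al v - al u).
rewrite (eq_bigr (fun j => (al v 0 j - al u 0 j) ^+ 2)); last by move=> j _; rewrite !mxE.
move=> h'; have := sqr_ge0 `|al v - al u|; set X := `|al v - al u| ^+ 2 => X0.
have d0 : 0 <= d%:R :> R by [].
rewrite exprMn -/X (@le_trans _ _ (4 * (d%:R * X)))// ?ler_wpM2l//.
rewrite mulrA ler_wpM2r//; nra.
Qed.

Lemma derivable1_cvg (V : normedModType R) (f : R -> V) (t : R) : derivable f t 1 ->
  h^-1 *: (f (h + t) - f t) @[h --> 0^'] --> derive1 f t.
Proof.
move=> df; rewrite derive1E.
have -> : (fun h : R => h^-1 *: (f (h + t) - f t)) = (fun h : R => h^-1 *: (f (h *: 1 + t) - f t)).
  by apply/funext => h; rewrite /GRing.scale/= mulr1.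
exact: df.
Qed.

Lemma derive1_row (al : R -> 'rV[R]_d) (t : R) :
  (forall j, derivable (fun t => al t 0 j) t 1) ->
  derivable al t 1 /\ forall j, derive1 al t 0 j = derive1 (fun t => al t 0 j) t.
Proof.
move=> dj; have D : derivable al t 1 by apply/derivable_mxP => i j; rewrite ord1.
by split => // j; rewrite derive1E derive_mx// mxE derive1E.
Qed.

Lemma cvg_sumr (T : Type) (F : set_system T) (I : finType) (f : I -> T -> R) (l : I -> R) :
  Filter F -> (forall j, f j x @[x --> F] --> l j) ->
  \sum_j f j x @[x --> F] --> \sum_j l j.
Proof. by move=> FF fl; apply: cvg_big => //; exact: add_continuous. Qed.

(** The spherical distance to a fixed point varies no faster than the curve moves:
its increments are at most the angles between successive points, which are
equivalent to chords by [chord_angle]. *)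
Lemma angle_speed (a : 'rV[R]_d) (al : R -> 'rV[R]_d) (t : R) : dot a a = 1 ->
  (\forall h \near t, dot (al h) (al h) = 1) ->
  (forall j, derivable (fun t => al t 0 j) t 1) ->
  derivable (fun t => acos (dot a (al t))) t 1 ->
  derive1 (fun t => acos (dot a (al t))) t ^+ 2 <= dot (derive1 al t) (derive1 al t).
Proof.
move=> a1 al1 dj dT; have [D Dj] := derive1_row dj.
have alt1 := nbhs_singleton al1.
pose th t := acos (dot a (al t)).
have ht : (h + t) @[h --> 0^'] --> t.
  rewrite -[X in _ --> X]add0r; apply: cvgD; last exact: cvg_cst.
  by apply: cvg_within_filter; exact: cvg_id.
have c1 : (h^-1 *: (th (h + t) - th t)) ^+ 2 * ((1 + dot (al t) (al (h + t))) / 2) @[h --> 0^'] -->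
    derive1 th t ^+ 2.
  have -> : derive1 th t ^+ 2 = derive1 th t ^+ 2 * ((1 + dot (al t) (al t)) / 2).
    by rewrite alt1 -(natrD _ 1 1) divff// mulr1.
  apply: cvgM.
    by have h := derivable1_cvg dT; apply: (cvgM h h).
  apply: cvgM; last exact: cvg_cst.
  apply: cvgD; first exact: cvg_cst.
  apply: cvg_sumr => j; apply: cvgM; first exact: cvg_cst.
  have cj : {for t, continuous (fun t => al t 0 j)}.
    by apply: differentiable_continuous; apply/derivable1_diffP.
  exact: (cvg_comp _ _ ht cj).
have c2 : \sum_(j < d) (h^-1 *: (al (h + t) 0 j - al t 0 j)) ^+ 2 @[h --> 0^'] -->
    dot (derive1 al t) (derive1 al t).
  rewrite /dot; apply: cvg_sumr => j; rewrite Dj.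
  by have h := derivable1_cvg (dj j); apply: (cvgM h h).
apply: (ler_cvg_to c1 c2); near=> h.
have h0 : h != 0 by near: h; exact: nbhs_dnbhs_neq.
have alh1 : dot (al (h + t)) (al (h + t)) = 1.
  by near: h; exact: (ht _ al1).
rewrite /GRing.scale/= exprMn -mulrA.
rewrite (eq_bigr (fun j => h^-1 ^+ 2 * (al (h + t) 0 j - al t 0 j) ^+ 2)); last first.
  by move=> j _; rewrite exprMn.
rewrite -mulr_sumr ler_wpM2l ?sqr_ge0//.
have [h1 _] := chord_angle alt1 alh1; apply: le_trans h1.
have /andP[l1 l2] := dot_unit alt1 alh1.
by rewrite ler_wpM2r ?acos_dot_dist// divr_ge0//; lra.
Unshelve. all: by end_near.
Qed.

End spherical_speed.

(** * Energy at a fixed arc-length parameter *)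

Lemma is_derive_sqrt_comp (R : realType) (t : R) (f : R -> R) (df : R) : 0 < f t ->
  is_derive t 1 f df ->
  is_derive t 1 (fun t => Num.sqrt (f t)) ((2 * Num.sqrt (f t))^-1 * df).
Proof. by move=> f0 hf; apply: (@is_derive1_comp _ Num.sqrt f _ _ _ (is_derive1_sqrt f0)). Qed.

Lemma abs_continuous_ae_derivable (R : realType) (f : R -> R) : abs_continuous 0 1 f ->
  {ae mu, forall t, unitI t -> derivable f t 1}.
Proof.
move=> af; have [h [_ _ H]] := abs_continuous_FTC ltr01 af.
by apply: ae_unitI_oo; apply: filterS H => t + t01 => /(_ t01)[].
Qed.

Lemma ae_and (R : realType) (P Q : R -> Prop) : {ae mu, forall t, P t} ->
  {ae mu, forall t, Q t} -> {ae mu, forall t, P t /\ Q t}.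
Proof. by apply: filterS2 => t; split. Qed.

(** The plane curve sqrt(m) (cos th, sin th), where th is the angle from al(0) to
al(t) divided by 2 sigma, has squared speed
m'^2 / (4 m) + m th'^2, at most a quarter of the energy density by
[angle_speed]. The inequality of [wirtinger] applies to its two coordinates,
whose squares add up to m. *)
Lemma polar_energy (R : realType) (d : nat) (sigma r : R) (m : R -> R)
    (al : R -> 'rV[R]_d) (e : R -> \bar R) :
  0 < sigma -> 1 <= 2 * sigma -> 0 < r < pi ->
  abs_continuous 0 1 m -> (forall t, 0 <= t <= 1 -> 0 < m t) -> m 0 = 1 ->
  abs_continuous 0 1 al -> (forall t, 0 <= t <= 1 -> dot (al t) (al t) = 1) ->
  measurable_fun unitI e -> (forall t, unitI t -> 0%R <= e t)%E ->
  {ae mu, forall t, unitI t -> derivable m t 1 ->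
    (forall j, derivable (fun t => al t 0 j) t 1) ->
    ((derive1 m t ^+ 2 / m t
      + sigma ^- 2 * (dot (derive1 al t) (derive1 al t) * m t))%:E <= e t)%E} ->
  ((4 * (r ^+ 2 * (\int[mu]_(t in unitI) m t) + r / sin r * ((1 + m 1) * cos r -
     2 * (Num.sqrt (m 1) * cos (acos (dot (al 0) (al 1)) / (2 * sigma))))))%:E
   <= \int[mu]_(t in unitI) e t)%E.
Proof.
move=> s0 s1 rpi am m0 m01 aal al1 me e0 He; have s2 : 0 < 2 * sigma by rewrite mulr_gt0.
have I0 : 0 <= (0 : R) <= 1 by rewrite lexx ler01.
have I1 : 0 <= (1 : R) <= 1 by rewrite lexx ler01.
have [c c0 cm] := abs_continuous_ge_pos am m0.
pose th t := (2 * sigma)^-1 * acos (dot (al 0) (al t)).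
have aT := abs_continuous_angle (al1 _ I0) al1 aal.
have ath : abs_continuous 0 1 th by exact: abs_continuousZ01.
have asm := abs_continuous_sqrt c0 cm am.
pose x t := Num.sqrt (m t) * cos (th t); pose y t := Num.sqrt (m t) * sin (th t).
have ax : abs_continuous 0 1 x by apply: abs_continuousM01 => //; exact: abs_continuous_cos.
have ay : abs_continuous 0 1 y by apply: abs_continuousM01 => //; exact: abs_continuous_sin.
have [Fx [aFx dFx Fx1]] := wirtinger rpi ax.
have [Fy [aFy dFy Fy1]] := wirtinger rpi ay.
pose F t := 4 * (Fx t + Fy t).
have aF : abs_continuous 0 1 F by apply: abs_continuousZ01; exact: abs_continuousD01.
have sqs : x 0 ^+ 2 + y 0 ^+ 2 = 1 /\ forall t, 0 <= t <= 1 -> x t ^+ 2 + y t ^+ 2 = m t.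
  have h t : 0 <= t <= 1 -> x t ^+ 2 + y t ^+ 2 = m t.
    by move=> t01; rewrite /x /y !exprMn -mulrDr cos2Dsin2 mulr1 sqr_sqrtr// ltW// m0.
  by split => //; rewrite h.
have [xy0 xyt] := sqs.
have th0 : th 0 = 0 by rewrite /th al1// acos1 mulr0.
have ix (g : R -> R) : abs_continuous 0 1 g ->
    (@lebesgue_measure R).-integrable unitI (EFin \o (fun t => g t ^+ 2)).
  move=> ag; apply: continuous_compact_integrable; first exact: segment_compact.
  by apply: abs_continuous_within => //; exact: (abs_continuousM01 ag ag).
have -> : 4 * (r ^+ 2 * (\int[mu]_(t in unitI) m t) + r / sin r * ((1 + m 1) * cos r -
     2 * (Num.sqrt (m 1) * cos (acos (dot (al 0) (al 1)) / (2 * sigma))))) = F 1 - F 0.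
  have -> : F 1 - F 0 = 4 * ((Fx 1 - Fx 0) + (Fy 1 - Fy 0)) by rewrite /F; ring.
  have -> : \int[mu]_(t in unitI) m t =
      \int[mu]_(t in unitI) (x t ^+ 2) + \int[mu]_(t in unitI) (y t ^+ 2).
    rewrite -RintegralD; [|exact: measurable_unitI|exact: (ix x ax)|exact: (ix y ay)].
    by apply: eq_Rintegral => t; rewrite inE /unitI/= in_itv/= => t01; rewrite xyt.
  rewrite Fx1 Fy1.
  have -> : y 0 = 0 by rewrite /y th0 sin0 mulr0.
  have -> : x 0 = 1 by rewrite /x th0 cos0 m01 sqrtr1 mulr1.
  rewrite [acos _ / _]mulrC -/(th 1) -/(x 1) -(xyt _ I1).
  by ring.
apply: abs_continuous_le_integral => //.
have dm := abs_continuous_ae_derivable am.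
have dT := abs_continuous_ae_derivable aT.
have dFxy := ae_and (abs_continuous_ae_derivable aFx) (abs_continuous_ae_derivable aFy).
have dj : {ae mu, forall t, forall j, unitI t -> derivable (fun t => al t 0 j) t 1}.
  apply: filter_forall => j; apply: abs_continuous_ae_derivable; exact: abs_continuous_coord.
have inner : {ae mu, forall t : R, unitI t -> 0 < t < 1}.
  by apply: (@ae_unitI_oo _ (fun t => 0 < t < 1)); exact: aeW.
have all1 := ae_and (ae_and dm dT) (ae_and dFxy dj).
have all2 := ae_and (ae_and dFx dFy) (ae_and He inner).
apply: filterS2 all1 all2 => t [[dm1 dT1] [[dFx1 dFy1] dj1]] [[dFx2 dFy2] [He1 in1]] tI.
have {dm1} dm1 := dm1 tI; have {dT1} dT1 := dT1 tI.
have {dFx1} dFx1 := dFx1 tI; have {dFy1} dFy1 := dFy1 tI.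
have {dj1} dj1 j := dj1 j tI; have {in1} in1 := in1 tI.
have t01 : 0 <= t <= 1 by move: tI; rewrite /unitI/= in_itv.
apply: le_trans (He1 tI dm1 dj1); rewrite lee_fin.
have mt := m0 _ t01.
have hm : is_derive t 1 m (derive1 m t) by rewrite derive1E; exact/derivableP.
have hT : is_derive t 1 (fun t => acos (dot (al 0) (al t)))
    (derive1 (fun t => acos (dot (al 0) (al t))) t) by rewrite derive1E; exact/derivableP.
have hth := is_derive_scale (2 * sigma)^-1 hT.
have hs := is_derive_sqrt_comp mt hm.
have hx := is_derive_mul hs (is_derive_cos_comp hth).
have hy := is_derive_mul hs (is_derive_sin_comp hth).
have hF : is_derive t 1 F (4 * (derive1 Fx t + derive1 Fy t)).
  by apply: is_derive_scale; apply: is_derive_add; rewrite derive1E; exact/derivableP.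
rewrite derive1E (@derive_val _ _ _ _ _ _ _ hF).
have := dFx2 tI (@ex_derive _ _ _ _ _ _ _ hx); have := dFy2 tI (@ex_derive _ _ _ _ _ _ _ hy).
rewrite [derive1 x t]derive1E [derive1 y t]derive1E (@derive_val _ _ _ _ _ _ _ hx) (@derive_val _ _ _ _ _ _ _ hy).
have unear : \forall h \near t, dot (al h) (al h) = 1.
  have : \forall h \near t, h \in `]0, 1[%R by apply: near_in_itvoo; rewrite in_itv.
  by apply: filterS => h; rewrite in_itv/= => /andP[h0 h1]; rewrite al1// !ltW.
have := angle_speed (al1 _ I0) unear dj1 dT1.
set dT0 := derive1 (fun t => acos _) t; set C := cos (th t); set S := sin (th t).
set w := Num.sqrt (m t) => hsp hFy hFx.
have w0 : 0 < w by rewrite sqrtr_gt0.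
have mE : m t = w ^+ 2 by rewrite sqr_sqrtr// ltW.
apply: (@le_trans _ _ (derive1 m t ^+ 2 / m t + sigma ^- 2 * (dT0 ^+ 2 * m t))); last first.
  rewrite lerD2l ler_wpM2l ?invr_ge0 ?exprn_ge0 ?(ltW s0)//.
  by rewrite ler_wpM2r// ltW.
have := lerD hFx hFy; rewrite -(ler_pM2l (_ : 0 < 4))// => h; apply: (le_trans h).
rewrite mE le_eqVlt; apply/orP; left; apply/eqP.
have CS : S ^+ 2 = 1 - C ^+ 2 by rewrite sin2cos2.
rewrite -[LHS](_ : 4 * (C ^+ 2 + S ^+ 2) * ((2 * w)^-1 ^+ 2 * derive1 m t ^+ 2 + w ^+ 2 * ((2 * sigma)^-1 * dT0) ^+ 2) = _); last by rewrite -/C -/S; ring.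
by rewrite CS; field; rewrite !gt_eqF.
Qed.

(** * Functions on the unit square *)

Section square.
Context {R : realType}.
Let mI := @measurable_unitI R.

Let clampI : R -> R := clamp 0 1.

Let clampI_unitI t : unitI (clampI t).
Proof. by rewrite /unitI/= in_itv/=; exact: clamp_itv. Qed.

Let clampIK t : unitI t -> clampI t = t.
Proof. by rewrite /unitI/= in_itv/=; exact: clampE. Qed.

Let measurable_clampI : measurable_fun setT clampI.
Proof. by apply: continuous_measurable_fun; exact: continuous_clamp. Qed.

(** Time is clamped and the space variable is cut to a set G of full measure: when
the function is well behaved for the parameters in G, the result is measurable
on the plane and continuous in time for every parameter. *)
Definition cutI (G : set R) (f : R -> R -> R) (t s : R) : R := f (clamp 0 1 t) s * \1_G s.

Lemma cutI_measurable (G : set R) (f : R -> R -> R) : measurable G -> G `<=` unitI ->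
  measurable_fun (unitI `*` unitI : set (R * R)) (fun p : R * R => f p.1 p.2) ->
  measurable_fun setT (fun p : R * R => cutI G f p.1 p.2).
Proof.
move=> mG GI mf.
have mII : measurable (unitI `*` unitI : set (R * R)) by exact: measurableX.
pose g := (fun p : R * R => f p.1 p.2) \_ (unitI `*` unitI).
have mg : measurable_fun setT g by apply/(measurable_restrict _ mII) => //; rewrite setTI.
have -> : (fun p : R * R => cutI G f p.1 p.2) =
    (fun p : R * R => (g \o (fun p : R * R => (clampI p.1, p.2))) p * \1_G p.2).
  apply/funext => -[t s] /=; rewrite /cutI indicE; case: (boolP (s \in G)) => sG; last by rewrite !mulr0.
  rewrite /g patchE ifT// inE; split => /=; first exact: clampI_unitI.
  by apply: GI; rewrite inE in sG.
apply: measurable_funM.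
  apply: measurableT_comp => //; apply/measurable_fun_pairP; split.
    exact: (measurableT_comp measurable_clampI measurable_fst).
  exact: measurable_snd.
by apply: (measurableT_comp _ measurable_snd); exact: measurable_indic.
Qed.

Lemma cutI_continuous (G : set R) (f : R -> R -> R) (s : R) :
  (G s -> {within unitI, continuous (f ^~ s)}) -> continuous (cutI G f ^~ s).
Proof.
move=> cf; have [Gs|nGs] := pselect (G s); last first.
  rewrite (_ : cutI G f ^~ s = cst 0); first exact: cst_continuous.
  by apply/funext => t; rewrite /cutI indicE memNset ?mulr0.
rewrite (_ : cutI G f ^~ s = (f ^~ s) \o clampI); last first.
  by apply/funext => t; rewrite /cutI indicE mem_set ?mulr1.
move=> t; have /subspace_continuousP cfs := cf Gs.
have cft := cfs (clampI t) (clampI_unitI t).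
have ct : clampI @ t --> within unitI (nbhs (clampI t)).
  move=> B wB; have h : \forall t' \near t, unitI (clampI t') -> B (clampI t').
    exact: (@continuous_clamp _ 0 1 t _ wB).
  rewrite /nbhs/=; apply: (@filterS _ _ _ _ _ _ h) => t'; apply; exact: clampI_unitI.
exact: (cvg_comp _ _ ct cft).
Qed.

Lemma cutI_in (G : set R) (f : R -> R -> R) (t s : R) : unitI t -> G s -> cutI G f t s = f t s.
Proof. by move=> tI Gs; rewrite /cutI indicE mem_set// mulr1 -/(clampI t) clampIK. Qed.

Lemma cutI_out (G : set R) (f : R -> R -> R) (t s : R) : ~ G s -> cutI G f t s = 0.
Proof. by move=> Gs; rewrite /cutI indicE memNset// mulr0. Qed.

Lemma cutI_near (G : set R) (f : R -> R -> R) (t s : R) : 0 < t < 1 -> G s ->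
  \forall t' \near t, cutI G f t' s = f t' s.
Proof.
move=> t01 Gs; have : \forall h \near t, h \in `]0, 1[%R by apply: near_in_itvoo; rewrite in_itv.
apply: filterS => h; rewrite in_itv/= => /andP[h0 h1]; apply: cutI_in => //.
by rewrite /unitI/= in_itv/= !ltW.
Qed.

End square.

Lemma integral_unitI_ext (R : realType) (f : R -> \bar R) :
  (forall t, ~ unitI t -> f t = 0%R%:E)%E ->
  (\int[mu]_(t in unitI) f t = \int[mu]_t f t)%E.
Proof.
move=> f0; rewrite integral_mkcond; apply: eq_integral => t _.
by rewrite patchE; case: ifPn => // /negP h; rewrite f0// => tI; apply: h; rewrite inE.
Qed.

Lemma section_measurable (R : realType) (f : R -> R -> R) (t : R) : unitI t ->
  measurable_fun (unitI `*` unitI : set (R * R)) (fun p : R * R => f p.1 p.2) ->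
  measurable_fun unitI (f t).
Proof.
move=> tI mf; have mI := @measurable_unitI R.
have h := @measurable_fun_pair2 _ _ _ _ _ _ _ t (cutI_measurable mI (@subset_refl _ unitI) mf).
apply: (eq_measurable_fun (cutI unitI f t)); first by move=> s; rewrite inE => sI; rewrite cutI_in.
exact: measurable_funTS.
Qed.

(** The representative dphi(t, .) has phi(t, .) as primitive, so it agrees almost
everywhere with the derivative of any function equal to phi(t, .) on [0, 1]. *)
Lemma adm_dphi_derive (R : realType) (d : nat) (phi dphi : R -> R -> R)
    (alpha : R -> R -> 'rV[R]_d) (psi : R -> R) (t : R) : admissible phi dphi alpha ->
  unitI t -> (forall s, unitI s -> phi t s = psi s) ->
  [/\ (@lebesgue_measure R).-integrable unitI (EFin \o dphi t),
    \int[mu]_(s in unitI) dphi t s = 1 &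
    {ae mu, forall s, unitI s -> dphi t s = derive1 psi s}].
Proof.
move=> ad tI tpsi; have mI := @measurable_unitI R.
have md : measurable_fun unitI (dphi t) by apply: section_measurable => //; exact: adm_dphi_measurable ad.
have I1 : unitI (1 : R) by rewrite /unitI/= in_itv/= lexx ler01.
have d0 : {ae mu, forall s, unitI s -> 0 < dphi t s}.
  by apply: filterS (adm_dphi_gt0 ad) => s + sI => /(_ sI); exact.
have int1 : (\int[mu]_(s in unitI) (dphi t s)%:E = 1%:E)%E.
  by rewrite -(adm_dphi_integral ad tI I1) (in_G_1 (adm_phi_G ad tI)).
have id1 : (@lebesgue_measure R).-integrable unitI (EFin \o dphi t).
  apply/integrableP; split; first exact/measurable_EFinP.
  rewrite (_ : (\int[mu]_(x in unitI) _ = 1%:E)%E) ?ltry// -int1.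
  apply: ae_eq_integral => //.
  - by apply: measurableT_comp => //; exact/measurable_EFinP.
  - exact/measurable_EFinP.
  - by apply: filterS d0 => s + sI => /(_ sI) h /=; rewrite gtr0_norm.
split => //; first by rewrite /Rintegral int1.
have [_ dP] := unitI_primitive id1.
apply: ae_unitI_oo; apply: filterS dP => s + s01.
have sI : unitI s by rewrite /unitI/= in_itv/=; case/andP: s01 => /ltW -> /ltW.
move=> /(_ sI)[_ <-]; rewrite !derive1E; apply: near_eq_derive.
have : \forall h \near s, h \in `]0, 1[%R by apply: near_in_itvoo; rewrite in_itv.
apply: filterS => x; rewrite in_itv/= => /andP[x0 x1].
have xI : unitI x by rewrite /unitI/= in_itv/= !ltW.
by rewrite -(tpsi _ xI) /primitive /Rintegral -(adm_dphi_integral ad tI xI).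
Qed.

(** * Lower bound for the energy *)

(** The integrands of the energy are controlled only off a null set of parameters
and their measurability is unknown; comparison with a measurable e still holds
because the negative part lives on a null set. *)
Lemma integral_ge_any (R : realType) (D N : set R) (e f : R -> \bar R) :
  measurable D -> measurable N -> (@lebesgue_measure R N = 0)%E ->
  (forall x, D x -> 0%R <= e x)%E -> (forall x, D x -> N x -> e x = 0%R)%E ->
  (forall x, D x -> ~ N x -> e x <= f x)%E ->
  (\int[mu]_(x in D) e x <= \int[mu]_(x in D) f x)%E.
Proof.
move=> mD mN N0 e0 eN ef.
rewrite [leRHS]integralE (@le_trans _ _ (\int[mu]_(x in D) (f^\+ x))%E)//.
  apply: ge0_le_integral_any => // x Dx; rewrite funeposE le_max.
  by have [Nx|Nx] := pselect (N x); [rewrite eN// lexx orbT|rewrite ef].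
rewrite [X in (_ <= _ - X)%E](_ : _ = 0)%E ?sube0//.
apply/le_anti/andP; split; last by apply: integral_ge0.
pose g (x : R) : \bar R := ((\1_N x : R)%:E * +oo)%E.
have mg : measurable_fun D g.
  by apply: emeasurable_funM => //; apply/measurable_EFinP; exact: measurable_indic.
rewrite (@le_trans _ _ (\int[mu]_(x in D) g x)%E)//.
  apply: ge0_le_integral_any => [x Dx|x Dx]; first exact: funeneg_ge0.
  rewrite funenegE /g indicE; have [Nx|Nx] := pselect (N x).
    by rewrite mem_set// mul1e leey.
  rewrite memNset// mul0e ge_max lexx andbT leeNl oppe0.
  by rewrite (le_trans (e0 _ Dx))// ef.
rewrite -(integral0 mu D) le_eqVlt; apply/orP; left; apply/eqP.
apply: ae_eq_integral => //; exists N; split => // x /= h; apply: contrapT => Nx; apply: h => Dx.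
by rewrite /g indicE memNset// mul0e.
Qed.

Lemma tonelli_sum (R : realType) (F1 F2 : R * R -> R) (c : R) : 0 <= c ->
  measurable_fun setT F1 -> measurable_fun setT F2 ->
  (forall p, 0 <= F1 p) -> (forall p, 0 <= F2 p) ->
  (\int[mu]_t \int[mu]_s (F1 (t, s))%:E + c%:E * \int[mu]_t \int[mu]_s (F2 (t, s))%:E =
   \int[mu]_s \int[mu]_t (F1 (t, s) + c * F2 (t, s))%:E)%E.
Proof.
move=> c0 m1 m2 p1 p2.
have mE1 : measurable_fun setT (EFin \o F1) by exact/measurable_EFinP.
have mE2 : measurable_fun setT (EFin \o F2) by exact/measurable_EFinP.
have q1 p : (0%R <= (EFin \o F1) p)%E by rewrite lee_fin.
have q2 p : (0%R <= (EFin \o F2) p)%E by rewrite lee_fin.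
rewrite (fubini_tonelli (m1 := mu) (m2 := mu) (EFin \o F1))//=.
rewrite (fubini_tonelli (m1 := mu) (m2 := mu) (EFin \o F2))//=.
have mG1 := measurable_fun_fubini_tonelli_G (m1 := @lebesgue_measure R) (EFin \o F1) mE1 q1.
have mG2 := measurable_fun_fubini_tonelli_G (m1 := @lebesgue_measure R) (EFin \o F2) mE2 q2.
rewrite -ge0_integralZl_EFin//; last by move=> s _; apply: integral_ge0 => t _; exact: q2.
rewrite -ge0_integralD//; last 3 first.
- by move=> s _; apply: integral_ge0 => t _; exact: q1.
- by move=> s _; rewrite mule_ge0 ?lee_fin//; apply: integral_ge0 => t _; exact: q2.
- exact: measurable_funeM.
apply: eq_integral => s _.
have n1 : measurable_fun setT (fun t => (F1 (t, s))%:E).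
  exact: (@measurable_fun_pair1 _ _ _ _ _ _ _ s mE1).
have n2 : measurable_fun setT (fun t => (F2 (t, s))%:E).
  exact: (@measurable_fun_pair1 _ _ _ _ _ _ _ s mE2).
rewrite -ge0_integralZl_EFin//; last by move=> t _; exact: q2.
rewrite -ge0_integralD//.
- by move=> t _; exact: q1.
- by move=> t _; rewrite mule_ge0 ?lee_fin//; exact: p2.
- exact: measurable_funeM.
Qed.

(** Both derivatives take the same default value when f is not derivable, so this
difference is the indicator of derivability. As a derivative it is jointly
measurable. *)
Lemma derive1_add_id (R : realType) (f : R -> R) (t : R) :
  (derivable f t 1 -> derive1 (fun t => f t + t) t - derive1 f t = 1) /\
  (~ derivable f t 1 -> derive1 (fun t => f t + t) t - derive1 f t = 0).
Proof.
have add (g : R -> R) (k : R) : derivable g t 1 ->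
    is_derive t 1 (fun t => g t + k * t) (derive1 g t + k).
  move=> dg; have hg : is_derive t 1 g (derive1 g t) by rewrite derive1E; exact/derivableP.
  apply: (is_derive_eq (is_derive_add hg (is_derive_scale k (is_derive_id t 1)))).
  by rewrite mulr1.
have e : (fun t => f t + t) = (fun t => f t + 1 * t) by apply/funext => z; rewrite mul1r.
split => df; first by rewrite e derive1E (@derive_val _ _ _ _ _ _ _ (add f 1 df)) addrAC subrr add0r.
have ndf : ~ derivable (fun t => f t + t) t 1.
  move=> dg; apply: df; have := @ex_derive _ _ _ _ _ _ _ (add _ (-1) dg).
  by rewrite (_ : (fun t => _) = f)//; apply/funext => z; rewrite mulN1r addrK.
rewrite !derive1E /derive (dvgP df) (dvgP ndf) subrr//.
Qed.

Section lower_bound.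
Context {R : realType} {d : nat} (sigma : R).
Hypotheses (sigma0 : 0 < sigma) (sigma1 : 1 <= 2 * sigma).
Variables (a0 a1 : sphere_fun R d) (phi1 : R -> R) (G1 : in_G phi1).
Variables (phi dphi : R -> R -> R) (alpha : R -> R -> 'rV[R]_d).
Hypotheses (ad : admissible phi dphi alpha) (jn : joins a0 a1 phi1 phi alpha).

Let mI := @measurable_unitI R.
Let I0 : unitI (0 : R). Proof. by rewrite /unitI/= in_itv/= lexx ler01. Qed.
Let I1 : unitI (1 : R). Proof. by rewrite /unitI/= in_itv/= lexx ler01. Qed.

Record regular_at (s : R) : Prop := RegularAt {
  reg_gt0 : forall t, unitI t -> 0 < dphi t s ;
  reg_dphi : abs_continuous 0 1 (dphi ^~ s) ;
  reg_alpha : abs_continuous 0 1 (alpha ^~ s) ;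
  reg_alpha0 : alpha 0 s = a0 s ;
  reg_alpha1 : alpha 1 s = a1 (phi1 s) ;
  reg_dphi0 : dphi 0 s = 1 ;
  reg_dphi1 : dphi 1 s = derive1 phi1 s }.

Lemma ae_regular : exists N : set R, [/\ measurable N, (@lebesgue_measure R N = 0)%E &
  forall s, unitI s -> ~ N s -> regular_at s].
Proof.
have [j0 j1 j2 j3] := jn.
have [_ _ d0] := adm_dphi_derive ad I0 j0; have [_ _ d1] := adm_dphi_derive ad I1 j1.
have /(ae_and (ae_and j2 j3)) := ae_and d0 d1.
move=> /(ae_and (ae_and (adm_dphi_gt0 ad) (ae_and (adm_dphi_ac ad) (adm_alpha_ac ad)))).
move=> [N [mN N0 HN]]; exists N; split => // s sI Ns.
have [] : (unitI s -> regular_at s) by apply: contrapT => h; apply: Ns; apply: HN => /= H; apply: h => {}sI;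
  case: H => -[/(_ sI) h1 [/(_ sI) h2 /(_ sI) h3]] [[/(_ sI) h4 /(_ sI) h5] [/(_ sI) h6 /(_ sI) h7]];
  split => //; rewrite h6 derive1E derive_id.
all: by [].
Qed.

Lemma energy_ge0 : (0%R <= energy sigma dphi alpha)%E.
Proof.
have [N [mN N0 HN]] := ae_regular.
have c0 : 0 <= sigma ^- 2 by rewrite invr_ge0 sqr_ge0.
have dotpos (v : 'rV[R]_d) : 0 <= dot v v by apply: sumr_ge0 => i _; rewrite -expr2 sqr_ge0.
have pos (f : R -> R -> R) : (forall t s, unitI t -> unitI s -> ~ N s -> 0 <= f t s) ->
    (0%R <= \int[mu]_(t in unitI) \int[mu]_(s in unitI) (f t s)%:E)%E.
  move=> f0; apply: integral_ge0 => t tI; rewrite -(integral0 mu unitI).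
  by apply: (integral_ge_any mI mN N0) => // s sI Ns; rewrite lee_fin f0.
apply: adde_ge0; last apply: mule_ge0; rewrite ?lee_fin//; apply: pos => t s tI sI Ns.
  by rewrite mulr_ge0 ?sqr_ge0// invr_ge0 ltW// (reg_gt0 (HN _ sI Ns)).
by rewrite mulr_ge0// ltW// (reg_gt0 (HN _ sI Ns)).
Qed.

(** The inequality of [polar_energy] is integrated in s. The masses of dphi(t, .)
and phi1' are 1, so the right-hand side becomes
4 (r^2 + 2 (r / sin r) (cos r - cos rho)), rho being the angle, and the last
term is nonnegative for r <= rho. *)
Lemma energy_ge_sqr (r : R) : 0 < r < pi -> r <= angle sigma a0 a1 phi1 ->
  ((4 * r ^+ 2)%:E <= energy sigma dphi alpha)%E.
Proof.
move=> /andP[r0 rpi] rang; have [N [mN N0 HN]] := ae_regular.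
pose G := unitI `\` N.
have mG : measurable G by exact: measurableD.
have GI : G `<=` unitI by move=> s [].
have reg s : G s -> regular_at s by move=> [sI Ns]; exact: HN.
pose D := cutI G dphi; pose A j := cutI G (fun t s => alpha t s 0 j).
have mD : measurable_fun setT (fun p : R * R => D p.1 p.2).
  by apply: cutI_measurable => //; exact: adm_dphi_measurable ad.
have mA j : measurable_fun setT (fun p : R * R => A j p.1 p.2).
  by apply: (cutI_measurable (f := fun t s => alpha t s 0 j)) => //; exact: adm_alpha_measurable ad j.
have cD s : continuous (D ^~ s).
  apply: cutI_continuous => /reg Q; apply: abs_continuous_within => //; exact: reg_dphi Q.
have cA j s : continuous (A j ^~ s).
  apply: (cutI_continuous (f := fun t s => alpha t s 0 j)) => /reg Q; apply: abs_continuous_within => //.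
  by apply: abs_continuous_coord; exact: reg_alpha Q.
have mdD := measurable_derive1 mD cD.
have mdA j := measurable_derive1 (mA j) (cA j).
pose A' j t s := A j t s + t.
have mdA' j : measurable_fun setT (fun p : R * R => derive1 (A' j ^~ p.2) p.1).
  apply: measurable_derive1; first exact: (measurable_funD (mA j) measurable_fst).
  by move=> s t; apply: cvgD; [exact: cA|exact: cvg_id].
pose ind j (p : R * R) := derive1 (A' j ^~ p.2) p.1 - derive1 (A j ^~ p.2) p.1.
have ind1 j t s : derivable (A j ^~ s) t 1 -> ind j (t, s) = 1.
  by have [h _] := derive1_add_id (A j ^~ s) t; exact: h.
have ind0 j t s : ~ derivable (A j ^~ s) t 1 -> ind j (t, s) = 0.
  by have [_ h] := derive1_add_id (A j ^~ s) t; exact: h.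
pose oo (p : R * R) : R := \1_(`]0%R, 1%R[%classic : set R) p.1.
(* On G, E1 and E2 are jointly measurable minorants of the two energy densities. The
   product of the ind j makes E2 vanish where the derivative of alpha takes its
   default value. *)
pose E1 (p : R * R) := derive1 (D ^~ p.2) p.1 ^+ 2 / D p.1 p.2 * oo p.
pose E2 (p : R * R) := (\sum_(j < d) derive1 (A j ^~ p.2) p.1 ^+ 2) * (\prod_(j < d) ind j p)
  * D p.1 p.2 * oo p.
have moo : measurable_fun setT oo.
  by apply: (measurableT_comp _ measurable_fst); exact: measurable_indic.
have mE1 : measurable_fun setT E1.
  apply: measurable_funM => //; apply: measurable_funM; first exact: measurable_funX.
  exact: (measurableT_comp (@measurable_invr R) mD).
have mE2 : measurable_fun setT E2.
  apply: measurable_funM => //; apply: measurable_funM => //; apply: measurable_funM.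
    by apply: measurable_sum => j; exact: measurable_funX.
  by apply: measurable_prod => j _; exact: measurable_funB.
have ind_ge0 j p : 0 <= ind j p.
  case: p => t s; have [h|h] := pselect (derivable (A j ^~ s) t 1).
    by rewrite ind1.
  by rewrite ind0.
have oo0 p : 0 <= oo p by rewrite /oo indicE.
have D0 t s : 0 <= D t s.
  have [Gs|Gs] := pselect (G s); last by rewrite /D cutI_out.
  by rewrite /D /cutI mulr_ge0// ltW// (reg_gt0 (reg _ Gs))//; by rewrite /unitI/= in_itv/=; exact: clamp_itv.
have E10 p : 0 <= E1 p by rewrite mulr_ge0// mulr_ge0 ?sqr_ge0// invr_ge0.
have E20 p : 0 <= E2 p.
  apply: mulr_ge0 => //; apply: mulr_ge0 => //; apply: mulr_ge0; last exact: prodr_ge0.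
  by apply: sumr_ge0 => j _; exact: sqr_ge0.
have out p : ~ (0 < p.1 < 1 /\ G p.2) -> E1 p = 0 /\ E2 p = 0.
  move=> h; rewrite /E1 /E2 /oo indicE; have [p01|p01] := boolP (0 < p.1 < 1).
    have nG : ~ G p.2 by move=> Gs; apply: h.
    by rewrite /D !cutI_out// invr0 !mulr0 !mul0r.
  by rewrite memNset ?mulr0// => /=; rewrite in_itv/=; exact/negP.
have in1 (t s : R) : 0 < t < 1 -> G s -> [/\ D t s = dphi t s,
    derive1 (D ^~ s) t = derive1 (dphi ^~ s) t & oo (t, s) = 1].
  move=> t01 Gs; split.
  - by rewrite /D cutI_in// /unitI/= in_itv/=; case/andP: t01 => /ltW -> /ltW.
  - by rewrite !derive1E; apply: near_eq_derive; exact: cutI_near.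
  - by rewrite /oo indicE mem_set//= in_itv.
have in2 j (t s : R) : 0 < t < 1 -> G s -> \forall h \near t, A j h s = alpha h s 0 j.
  by move=> t01 Gs; exact: (cutI_near (fun t s => alpha t s 0 j)).
have in3 (t s : R) : 0 < t < 1 -> G s ->
    (forall j, derivable (fun t => alpha t s 0 j) t 1) ->
    E2 (t, s) = dot (derive1 (alpha ^~ s) t) (derive1 (alpha ^~ s) t) * dphi t s.
  move=> t01 Gs dj; have [DE _ ooE] := in1 _ _ t01 Gs.
  rewrite /E2 ooE mulr1 DE /=; have [_ dE] := derive1_row dj.
  have dAj j : derivable (A j ^~ s) t 1.
    by apply: near_eq_derivable (dj j); have := in2 j _ _ t01 Gs; apply: filterS => h ->.
  rewrite [X in _ * X * _]big1 ?mulr1; last by move=> j _; exact: ind1.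
  congr (_ * _); apply: eq_bigr => j _; rewrite dE -expr2; congr (_ ^+ 2).
  by rewrite !derive1E; apply: near_eq_derive; exact: in2.
have dotpos (v : 'rV[R]_d) : 0 <= dot v v by apply: sumr_ge0 => i _; rewrite -expr2 sqr_ge0.
have sandwich (E : R * R -> R) (f : R -> R -> R) : (forall p, 0 <= E p) ->
    (forall p, ~ (0 < p.1 < 1 /\ G p.2) -> E p = 0) ->
    (forall t s, unitI t -> G s -> 0 <= f t s) ->
    (forall t s, 0 < t < 1 -> G s -> E (t, s) <= f t s) ->
    (\int[mu]_t \int[mu]_s (E (t, s))%:E <=
     \int[mu]_(t in unitI) \int[mu]_(s in unitI) (f t s)%:E)%E.
  move=> E0 Eout f0 Ef.
  have inner t : (\int[mu]_s (E (t, s))%:E = \int[mu]_(s in unitI) (E (t, s))%:E)%E.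
    by rewrite -integral_unitI_ext// => s sI; rewrite Eout// => -[_ /GI].
  rewrite -integral_unitI_ext; last first.
    move=> t tI; rewrite integral0_eq// => s _; rewrite Eout// => -[/andP[t0 t1] _]; apply: tI.
    by rewrite /unitI/= in_itv/= !ltW.
  apply: ge0_le_integral_any => t tI; first by apply: integral_ge0 => s _; rewrite lee_fin.
  rewrite inner; apply: (integral_ge_any mI mN N0) => s sI.
  - by rewrite lee_fin.
  - by move=> Ns; rewrite Eout// => -[_ [_]].
  - move=> Ns; rewrite lee_fin; have [t01|t01] := boolP (0 < t < 1); first by apply: Ef.
    by rewrite Eout ?f0// => -[h _]; rewrite h in t01.
have le1 := sandwich E1 (fun t s => derive1 (dphi ^~ s) t ^+ 2 / dphi t s) E10 (fun p h => (out p h).1).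
have le2 := sandwich E2 (fun t s => dot (derive1 (alpha ^~ s) t) (derive1 (alpha ^~ s) t) * dphi t s)
  E20 (fun p h => (out p h).2).
have c0 : 0 <= sigma ^- 2 by rewrite invr_ge0 sqr_ge0.
have {le1 le2} : (\int[mu]_s \int[mu]_t (E1 (t, s) + sigma ^- 2 * E2 (t, s))%:E <=
    energy sigma dphi alpha)%E.
  rewrite -tonelli_sum//; apply: leeD; last apply: lee_wpmul2l; rewrite ?lee_fin//.
  - apply: le1 => t s tx Gs.
      by rewrite mulr_ge0 ?sqr_ge0// invr_ge0 ltW// (reg_gt0 (reg _ Gs)).
    by have [DE dDE ooE] := in1 _ _ tx Gs; rewrite /E1 /= ooE DE dDE mulr1.
  - apply: le2 => t s tx Gs.
      by rewrite mulr_ge0// ltW// (reg_gt0 (reg _ Gs)).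
    have tI : unitI t by rewrite /unitI/= in_itv/=; case/andP: tx => /ltW -> /ltW.
    have [dj|ndj] := pselect (forall j, derivable (A j ^~ s) t 1).
      have daj j : derivable (fun t => alpha t s 0 j) t 1.
        by apply: near_eq_derivable (dj j); have := in2 j _ _ tx Gs; apply: filterS => h ->.
      by rewrite in3.
    have [j ndj'] : exists j, ~ derivable (A j ^~ s) t 1 by apply/existsNP.
    rewrite /E2 [X in _ * X * _ * _ <= _](bigD1 j)//= ind0// mul0r mulr0 !mul0r.
    by rewrite mulr_ge0// ltW// (reg_gt0 (reg _ Gs)).
apply: le_trans.
pose l s := \int[mu]_(t in unitI) D t s.
pose kk s := r / sin r * ((1 + derive1 phi1 s) * cos r -
     2 * (Num.sqrt (derive1 phi1 s) * cos (omega a0 a1 phi1 s / (2 * sigma)))).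
pose J s := (\int[mu]_t (E1 (t, s) + sigma ^- 2 * E2 (t, s))%:E)%E.
have J0 s : (0%R <= J s)%E.
  by apply: integral_ge0 => t _; rewrite lee_fin addr_ge0// mulr_ge0.
have mE : measurable_fun setT (fun p => (E1 p + sigma ^- 2 * E2 p)%:E).
  by apply/measurable_EFinP; apply: measurable_funD => //; exact: measurable_funM.
have mJ : measurable_fun setT J.
  apply: (measurable_fun_fubini_tonelli_G (m1 := @lebesgue_measure R)
    (fun p => (E1 p + sigma ^- 2 * E2 p)%:E)) => // p.
  by rewrite lee_fin addr_ge0// mulr_ge0.
have lJ s : G s -> ((4 * (r ^+ 2 * l s + kk s))%:E <= J s)%E.
  move=> Gs; have Q := reg _ Gs.
  have tIE (t : R) : 0 <= t <= 1 -> unitI t by rewrite /unitI/= in_itv.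
  have lE : l s = \int[mu]_(t in unitI) dphi t s.
    by apply: eq_Rintegral => t; rewrite inE => tI; rewrite /D cutI_in.
  have -> : J s = (\int[mu]_(t in unitI) (E1 (t, s) + sigma ^- 2 * E2 (t, s))%:E)%E.
    rewrite integral_unitI_ext// => t tI.
    have [] := out (t, s); last by move=> -> ->; rewrite mulr0 addr0.
    by move=> [/andP[t0 t1] _]; apply: tI; rewrite /unitI/= in_itv/= !ltW.
  rewrite lE /kk /omega -(reg_dphi1 Q) -(reg_alpha0 Q) -(reg_alpha1 Q).
  apply: (@polar_energy R d sigma r (dphi ^~ s) (alpha ^~ s)) => //; first by rewrite r0.
  - exact: reg_dphi Q.
  - by move=> t /tIE; exact: (reg_gt0 Q).
  - exact: reg_dphi0 Q.
  - exact: reg_alpha Q.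
  - by move=> t /tIE tI; apply: (adm_alpha_unit ad) => //; exact: GI.
  - apply: measurable_funTS; exact: (@measurable_fun_pair1 _ _ _ _ _ _ _ s mE).
  - by move=> t _; rewrite lee_fin addr_ge0// mulr_ge0.
  - apply: ae_unitI_oo; apply: aeW => t t01 _ dj; rewrite in3// /E1/=.
    by have [-> -> ->] := in1 _ _ t01 Gs; rewrite mulr1.
have [id1 ed1] := in_G_derive1_unitI G1.
have ic := corr_integrable sigma a0 a1 G1.
(* Tonelli again: l s is the time integral of dphi(., s). *)
pose h (p : R * R) := D p.1 p.2 * \1_(@unitI R) p.1.
have mh : measurable_fun setT (EFin \o h).
  apply/measurable_EFinP; apply: measurable_funM => //.
  by apply: (measurableT_comp _ measurable_fst); exact: measurable_indic.
have h0 p : (0%R <= (EFin \o h) p)%E by rewrite lee_fin mulr_ge0// indicE.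
have lh s : ((l s)%:E = \int[mu]_t (h (t, s))%:E)%E.
  rewrite EFin_Rintegral//; last first.
    apply: continuous_compact_integrable; first exact: segment_compact.
    by apply: continuous_subspaceT; exact: cD.
  rewrite -integral_unitI_ext => [|t tI]; last by rewrite /h/= indicE memNset// mulr0.
  by apply: eq_integral => t tI; rewrite /h indicE tI mulr1.
have mlE : measurable_fun setT (EFin \o l).
  rewrite (_ : EFin \o l = fun s => (\int[mu]_t (h (t, s))%:E)%E); last by apply/funext => s; exact: lh.
  exact: (measurable_fun_fubini_tonelli_G (m1 := @lebesgue_measure R) (EFin \o h)).
have l1 : (\int[mu]_(s in unitI) (l s)%:E = 1%:E)%E.
  rewrite integral_unitI_ext; last first.
    by move=> s sI; rewrite /l /Rintegral integral0_eq// => t _; rewrite /D cutI_out// => /GI.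
  under eq_integral do rewrite lh.
  rewrite -(fubini_tonelli (m1 := @lebesgue_measure R) (m2 := @lebesgue_measure R) (EFin \o h))//=.
  rewrite -integral_unitI_ext; last first.
    by move=> t tI; rewrite integral0_eq// => s _; rewrite /h indicE memNset// mulr0.
  transitivity (\int[mu]_(t in unitI) (cst 1%E t : \bar R))%E; last first.
    rewrite integral_cst// mul1e [X in (X = _)%E](lebesgue_measure_itv `[0, 1])/= lte_fin ltr01.
    by rewrite oppr0 adde0.
  apply: eq_integral => t; rewrite inE => tI.
  rewrite -integral_unitI_ext; last first.
    by move=> s sI; rewrite /h/= /D cutI_out ?mul0r// => /GI.
  rewrite /= -(in_G_1 (adm_phi_G ad tI)) (adm_dphi_integral ad tI I1).
  apply: ae_eq_integral => //.
  - by apply: measurable_funTS; exact: (@measurable_fun_pair2 _ _ _ _ _ _ _ t mh).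
  - by apply/measurable_EFinP; apply: section_measurable => //; exact: adm_dphi_measurable ad.
  - exists N; split => // s /= hs; apply: contrapT => Ns; apply: hs => sI.
    by rewrite /h/= indicE mem_set// mulr1 /D cutI_in.
have l0 s : 0 <= l s by rewrite -lee_fin lh; apply: integral_ge0 => t _; exact: h0.
have il : (@lebesgue_measure R).-integrable unitI (EFin \o l).
  apply/integrableP; split; first exact: measurable_funTS.
  under eq_integral do rewrite /= ger0_norm//.
  by rewrite l1 ltry.
have el : \int[mu]_(s in unitI) l s = 1 by rewrite /Rintegral l1.
pose K := 4 * (r / sin r * cos r).
have [j1 e1] := Rintegral_lin (4 * r ^+ 2) mI (integrable_unitI_cst K) il.
have [j2 e2] := Rintegral_lin K mI j1 id1.
have [j3 e3] := Rintegral_lin (- (8 * (r / sin r))) mI j2 ic.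
have fE : (fun s => 4 * (r ^+ 2 * l s + kk s)) = (fun s => cst K s + 4 * r ^+ 2 * l s +
    K * derive1 phi1 s + - (8 * (r / sin r)) *
      (Num.sqrt (derive1 phi1 s) * cos (omega a0 a1 phi1 s / (2 * sigma)))).
  by apply/funext => s; rewrite /kk /= /K; ring.
apply: (@le_trans _ _ (\int[mu]_(s in unitI) (4 * (r ^+ 2 * l s + kk s))%:E)%E).
  rewrite -[leRHS](@EFin_Rintegral _ _ _ mu _ (fun s => 4 * (r ^+ 2 * l s + kk s)))//; last first.
    by have := j3; rewrite -fE.
  rewrite fE e3 e2 e1 el ed1 Rintegral_unitI_cst lee_fin.
  rewrite -/(corr sigma a0 a1 phi1).
  have cr : -1 <= corr sigma a0 a1 phi1 <= 1 by exact: corr_range.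
  have cang : cos (angle sigma a0 a1 phi1) = corr sigma a0 a1 phi1.
    by rewrite /angle -/(corr sigma a0 a1 phi1) acosK.
  have angr : 0 <= angle sigma a0 a1 phi1 <= pi by exact: angle_range.
  have : corr sigma a0 a1 phi1 <= cos r.
    by rewrite -cang ler_cos// (ltW r0) (ltW rpi).
  have rs : 0 <= r / sin r by rewrite divr_ge0 ?(ltW r0)// ltW// sin_gt0_pi// r0.
  by rewrite /K => hc; have := ler_wpM2l rs hc; lra.
apply: (@le_trans _ _ (\int[mu]_(s in unitI) J s)%E); last first.
  by apply: ge0_subset_integral.
apply: integral_ae_le => //.
- by have := j3; rewrite -fE.
- exact: measurable_funTS.
- exists N; split => // s /= hs; apply: contrapT => Ns; apply: hs => sI.
  exact: lJ.
Qed.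
End lower_bound.

(** The angle may be 0 or pi, values that [energy_ge_sqr] excludes, whence a passage
to the limit. *)
Lemma energy_ge (R : realType) (d : nat) (sigma : R) (a0 a1 : sphere_fun R d)
    (phi1 : R -> R) (phi dphi : R -> R -> R) (alpha : R -> R -> 'rV[R]_d) :
  0 < sigma -> 1 <= 2 * sigma -> in_G phi1 ->
  admissible phi dphi alpha -> joins a0 a1 phi1 phi alpha ->
  ((4 * angle sigma a0 a1 phi1 ^+ 2)%:E <= energy sigma dphi alpha)%E.
Proof.
move=> s0 s1 G1 ad jn; have /andP[a_ge0 a_pi] := angle_range sigma a0 a1 G1.
set rho := angle _ _ _ _ in a_ge0 a_pi *.
have lb (r : R) : 0 < r < rho -> ((4 * r ^+ 2)%:E <= energy sigma dphi alpha)%E.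
  move=> /andP[r0 rr]; apply: (energy_ge_sqr s0 s1 G1 ad jn); last exact: ltW.
  by rewrite r0 (lt_le_trans rr).
have := energy_ge0 sigma ad jn; move: lb.
case: (energy sigma dphi alpha) => [x| |] // lb x0; last by rewrite leey.
rewrite lee_fin leNgt; apply/negP => xr; rewrite lee_fin in x0.
have sx := sqr_sqrtr x0; have sx0 := sqrtr_ge0 x; set w := Num.sqrt x in sx sx0.
have wr : w / 2 < rho.
  by rewrite ltNge; apply/negP => h; nra.
have := lb ((w / 2 + rho) / 2); rewrite lee_fin => /(_ ltac:(lra)); nra.
Qed.

(** * Polar angle in the plane *)

Section polar.
Context {R : realType}.

(** The half-angle formula tan (eta / 2) = y / (w + x) gives a determination of the
polar angle which is smooth off the negative half-axis. The quotient is 0 at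
the origin, where any angle is suitable. *)
Lemma polar_half (x y w : R) : 0 <= w -> w ^+ 2 = x ^+ 2 + y ^+ 2 -> y != 0 \/ 0 <= x ->
  x = w * cos (2 * atan (y / (w + x))) /\ y = w * sin (2 * atan (y / (w + x))).
Proof.
move=> w0 wE xy; have [wx0|wx0] := eqVneq (w + x) 0.
  have wx : w = - x by lra.
  have y0 : y = 0.
    by apply/eqP; rewrite -sqrf_eq0; apply/eqP; move: wE; rewrite wx; lra.
  have x0 : 0 <= x by case: xy => //; rewrite y0 eqxx.
  have -> : x = 0 by lra.
  by have -> : w = 0 by [lra]; rewrite y0 !mul0r.
set q := y / (w + x).
have q2 : 1 + q ^+ 2 = 2 * w / (w + x).
  have -> : 1 + q ^+ 2 = ((w + x) ^+ 2 + y ^+ 2) / (w + x) ^+ 2 by rewrite /q; field.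
  have -> : y ^+ 2 = w ^+ 2 - x ^+ 2 by rewrite wE; ring.
  by field.
have q0 : 0 < 1 + q ^+ 2 by rewrite ltr_wpDr// sqr_ge0.
have wn0 : w != 0 by apply/negP => /eqP w00; move: q0; rewrite q2 w00 mulr0 mul0r ltxx.
have e : 2 * atan q = atan q *+ 2 by rewrite mulr_natl.
have sn : Num.sqrt (1 + q ^+ 2) != 0 by rewrite gt_eqF// sqrtr_gt0.
have s2 : Num.sqrt (1 + q ^+ 2) ^+ 2 = 1 + q ^+ 2 by rewrite sqr_sqrtr// ltW.
have y2 : y ^+ 2 = w ^+ 2 - x ^+ 2 by rewrite wE; ring.
split.
  rewrite e cos_mulr2n cos_atan exprVn s2 q2; field.
  by rewrite wn0 wx0.
have ca : cos (atan q) != 0 by rewrite cos_atan invr_neq0.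
have sa : sin (atan q) = q * cos (atan q).
  by rewrite -[X in X * _](atanK q) /tan divfK.
have -> : sin (2 * atan q) = q * 2 / (1 + q ^+ 2).
  by rewrite e sin_mulr2n sa cos_atan mulr2n -[in RHS]s2; field.
by rewrite q2 /q; field; rewrite wn0 wx0.
Qed.

Lemma is_derive_atan_comp (t : R) (f : R -> R) (df : R) : is_derive t 1 f df ->
  is_derive t 1 (fun t => atan (f t)) ((1 + f t ^+ 2)^-1 * df).
Proof. by move=> hf; apply: (@is_derive1_comp _ atan f). Qed.

Lemma is_derive_polar_angle (t : R) (x y : R -> R) (dx dy : R) :
  is_derive t 1 x dx -> is_derive t 1 y dy -> 0 < x t \/ y t != 0 ->
  is_derive t 1 (fun t => 2 * atan (y t / (Num.sqrt (x t ^+ 2 + y t ^+ 2) + x t)))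
    ((x t * dy - y t * dx) / (x t ^+ 2 + y t ^+ 2)).
Proof.
move=> hx hy xy.
have N0 : 0 < x t ^+ 2 + y t ^+ 2.
  case: xy => [x0|y0]; first by rewrite ltr_wpDr ?sqr_ge0// exprn_gt0.
  by rewrite ltr_wpDl ?sqr_ge0// lt_neqAle sqr_ge0 andbT eq_sym sqrf_eq0.
have hN : is_derive t 1 (fun t => x t ^+ 2 + y t ^+ 2) (2 * (x t * dx + y t * dy)).
  apply: (is_derive_eq (is_derive_add (is_derive_mul hx hx) (is_derive_mul hy hy))); ring.
have hw := @is_derive_sqrt_comp _ t (fun t => x t ^+ 2 + y t ^+ 2) _ N0 hN; set w := Num.sqrt (x t ^+ 2 + y t ^+ 2) in hw *.
have w0 : 0 < w by rewrite sqrtr_gt0.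
have w2 : w ^+ 2 = x t ^+ 2 + y t ^+ 2 by rewrite sqr_sqrtr// ltW.
have wx : w + x t != 0.
  case: xy => [x0|y0]; first by rewrite gt_eqF// addr_gt0.
  apply/negP => /eqP wx; move/eqP: y0; apply; apply/eqP; rewrite -sqrf_eq0.
  by rewrite (_ : y t ^+ 2 = w ^+ 2 - x t ^+ 2); [rewrite subr_sqr wx mulr0|rewrite w2; ring].
have hv := is_derive_add hw hx.
have hq := is_derive_mul hy (@is_derive_inv _ t (fun t => Num.sqrt (x t ^+ 2 + y t ^+ 2) + x t) _ wx hv).
apply: (is_derive_eq (is_derive_scale 2 (is_derive_atan_comp hq))).
rewrite -/w.
have -> : 1 + (y t / (w + x t)) ^+ 2 = 2 * w / (w + x t).
  have -> : 1 + (y t / (w + x t)) ^+ 2 = ((w + x t) ^+ 2 + y t ^+ 2) / (w + x t) ^+ 2 by field.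
  rewrite (_ : y t ^+ 2 = w ^+ 2 - x t ^+ 2); last by rewrite w2; ring.
  by field.
have wn0 : w != 0 by rewrite gt_eqF.
rewrite -w2.
have y2 : y t * y t = w ^+ 2 - x t * x t by rewrite w2; ring.
transitivity (((dy * (w + x t) - y t * dx) * w - x t * y t * dx - (y t * y t) * dy) / (w ^+ 2 * (w + x t))).
  by field; rewrite wn0 wx.
by rewrite y2; field; rewrite wn0 wx.
Qed.

Lemma atan_lipschitz (x y : R) : `|atan x - atan y| <= `|x - y|.
Proof.
wlog xy : x y / y <= x => [H|].
  by have [/H//|/ltW/H] := leP y x; rewrite distrC [leRHS]distrC.
have [|c _ ->] := @MVT_segment _ (@atan R) (fun z => (1 + z ^+ 2)^-1) _ _ xy (fun z _ => is_derive1_atan z).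
  by apply: continuous_subspaceT; exact: continuous_atan.
rewrite normrM ler_piMl// ger0_norm ?invr_ge0 ?addr_ge0 ?sqr_ge0//.
by rewrite invf_le1 ?lerDl ?sqr_ge0// ltr_wpDr ?sqr_ge0.
Qed.

End polar.

(** The positive part of f is at most e plus an infinite value on the null set N,
where f is uncontrolled. *)
Lemma integral_le_any (R : realType) (D N : set R) (e f : R -> \bar R) :
  measurable D -> measurable N -> (@lebesgue_measure R N = 0)%E ->
  measurable_fun D e -> (forall x, D x -> 0%R <= e x)%E ->
  (forall x, D x -> ~ N x -> f x <= e x)%E ->
  (\int[mu]_(x in D) f x <= \int[mu]_(x in D) e x)%E.
Proof.
move=> mD mN N0 me e0 fe.
pose g (x : R) : \bar R := ((\1_N x : R)%:E * +oo)%E.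
have g0 x : (0%R <= g x)%E by rewrite /g indicE mule_ge0// lee_fin.
have mg : measurable_fun D g.
  by apply: emeasurable_funM => //; apply/measurable_EFinP; exact: measurable_indic.
rewrite integralE (@le_trans _ _ (\int[mu]_(x in D) (f^\+ x))%E)//.
  rewrite -[leRHS]sube0 leeB// integral_ge0//.
rewrite (@le_trans _ _ (\int[mu]_(x in D) (e x + g x))%E)//.
  apply: ge0_le_integral_any => [x Dx|x Dx]; first exact: funepos_ge0.
  rewrite funeposE; have [Nx|Nx] := pselect (N x).
    have -> : (e x + g x = +oo)%E.
      by rewrite /g indicE mem_set// mul1e addey// gt_eqF// (lt_le_trans _ (e0 _ Dx))// ltNy0.
    exact: leey.
  by rewrite /g indicE memNset// mul0e adde0 ge_max e0// fe.
rewrite le_eqVlt; apply/orP; left; apply/eqP; apply: ae_eq_integral => //.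
  exact: emeasurable_funD.
exists N; split => // x /= h; apply: contrapT => Nx; apply: h => Dx.
by rewrite /g indicE memNset// mul0e adde0.
Qed.

(** * Trajectories deduced from a plane-valued arc *)

(** The plane-valued path is gamma(t, s) = A(t) (1, 0) + B(t) q(s), with
q = sqrt(phi1') (cos theta, sin theta); A and B are the coefficients of an arc
of the unit sphere of L2 run at constant speed rho. Taking theta = omega / (2
sigma) and kappa = 0 gives the trajectory deduced from the geodesic. In general
theta may be smaller, and alpha makes up for the missing rotation kappa at
constant speed. *)
Section candidate.
Context {R : realType} {d : nat} (sigma : R).
Hypotheses (sigma0 : 0 < sigma) (sigma1 : 1 <= 2 * sigma).
Variables (a0 a1 : sphere_fun R d) (phi1 : R -> R) (G1 : in_G phi1).
Variables (theta kappa : R -> R) (a0p : sphere_fun R d).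
Hypotheses (mtheta : measurable_fun unitI theta)
  (theta0 : forall s, unitI s -> 0 <= theta s < pi)
  (kappaE : forall s, unitI s -> omega a0 a1 phi1 s = 2 * sigma * theta s + kappa s)
  (perp : is_perp a0 a1 phi1 a0p).

Let mI := @measurable_unitI R.
Let I1 : unitI (1 : R). Proof. by rewrite /unitI/= in_itv/= lexx ler01. Qed.
Let I0 : unitI (0 : R). Proof. by rewrite /unitI/= in_itv/= lexx ler01. Qed.

(** The square root of the end density; mc and ms are the two coordinates of q. *)
Definition speed s := Num.sqrt (derive1 phi1 s).
Let mc s := speed s * cos (theta s).
Let ms s := speed s * sin (theta s).

Variables (A B dA dB : R -> R) (rho : R).
Hypotheses (hA : forall t : R, is_derive t (1 : R) A (dA t))
  (hB : forall t : R, is_derive t (1 : R) B (dB t))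
  (acA : abs_continuous 0 1 A) (acB : abs_continuous 0 1 B)
  (mdA : measurable_fun setT dA) (mdB : measurable_fun setT dB)
  (A_ge0 : forall t, unitI t -> 0 <= A t) (B_ge0 : forall t, unitI t -> 0 <= B t)
  (A0 : A 0 = 1) (B0 : B 0 = 0)
  (sphere : forall t, A t ^+ 2 + 2 * A t * B t * (\int[mu]_(s in unitI) mc s) + B t ^+ 2 = 1)
  (length : forall t,
     dA t ^+ 2 + 2 * dA t * dB t * (\int[mu]_(s in unitI) mc s) + dB t ^+ 2 = rho ^+ 2)
  (end1 : {ae mu, forall s, unitI s -> A 1 + B 1 * mc s = mc s /\ B 1 * ms s = ms s}).

(** The components gx, gy of gamma, its squared norm gN, its polar angle geta, and
the total rotation angle gbeta from a0 towards a0p. *)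
Definition gx t s := A t + B t * mc s.
Definition gy t s := B t * ms s.
Definition gN t s := gx t s ^+ 2 + gy t s ^+ 2.
Definition geta t s := 2 * atan (gy t s / (Num.sqrt (gN t s) + gx t s)).
Definition gbeta t s := 2 * sigma * geta t s + t * kappa s.
Definition galpha t s := cos (gbeta t s) *: a0 s + sin (gbeta t s) *: a0p s.
Definition gphi t s := primitive (gN t) s.

Lemma speed_ge0 s : 0 <= speed s. Proof. exact: sqrtr_ge0. Qed.

Lemma speed_measurable : measurable_fun unitI speed.
Proof.
by apply: (measurableT_comp (@measurable_sqrtr R)); exact: in_G_derive1_measurable.
Qed.

Lemma mc_measurable : measurable_fun unitI mc.
Proof.
apply: measurable_funM; first exact: speed_measurable.
exact: (measurableT_comp (@measurable_cosr R)).
Qed.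

Lemma measurable_sinr : measurable_fun setT (@sin R).
Proof. by apply: continuous_measurable_fun; exact: continuous_sin. Qed.

Lemma ms_measurable : measurable_fun unitI ms.
Proof.
apply: measurable_funM; first exact: speed_measurable.
exact: (measurableT_comp measurable_sinr).
Qed.

Lemma mc_integrable : (@lebesgue_measure R).-integrable unitI (EFin \o mc).
Proof.
have [] := sqrt_derive1_integrable G1 (k := fun s => cos (theta s)) => //.
  exact: (measurableT_comp (@measurable_cosr R)).
by move=> s _; exact: cos_max.
Qed.

Lemma speed_sqr : {ae mu, forall s, unitI s -> 0 < speed s /\ speed s ^+ 2 = derive1 phi1 s}.
Proof.
apply: filterS (in_G_gt0 G1) => s + sI => /(_ sI) d0.
by rewrite /speed sqrtr_gt0 sqr_sqrtr// ltW.
Qed.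

Lemma speed_sqr_integrable x : 0 <= x <= 1 ->
  (@lebesgue_measure R).-integrable `[0, x] (EFin \o (fun s => speed s ^+ 2)) /\
  \int[mu]_(s in `[0, x]) (speed s ^+ 2) = phi1 x.
Proof.
move=> x01; have [ix ex] := in_G_integrable_derive1 G1 x01.
have sub := sub_unitI x01.
have ms2 : measurable_fun `[0, x] (fun s => speed s ^+ 2).
  by apply: measurable_funX; apply: (measurable_funS mI sub); exact: speed_measurable.
have eqd : {ae mu, forall s, `[0, x]%classic s -> speed s ^+ 2 = derive1 phi1 s}.
  by apply: filterS speed_sqr => s + /sub sI => /(_ sI)[].
split; last first.
  rewrite -ex; apply: Rintegral_ae_eq => //.
  by apply: (measurable_funS mI sub); exact: in_G_derive1_measurable.
apply: (@integrable_dominated _ _ _ (@lebesgue_measure R) _ _ (fun s => `|derive1 phi1 s|)) => //.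
  move=> s _; rewrite ger0_norm ?sqr_ge0// /speed; have [h|h] := leP 0 (derive1 phi1 s).
    by rewrite sqr_sqrtr// ger0_norm.
  by rewrite (ltr0_sqrtr h) expr2 mul0r normr_ge0.
exact: integrable_norm ix.
Qed.

Lemma gN_expand t s : gN t s = A t ^+ 2 + 2 * A t * B t * mc s + B t ^+ 2 * speed s ^+ 2.
Proof.
have e : mc s ^+ 2 + ms s ^+ 2 = speed s ^+ 2 by rewrite /mc /ms !exprMn -mulrDr cos2Dsin2 mulr1.
by rewrite -e /gN /gx /gy; ring.
Qed.

Lemma quad_integral (u v w x : R) : 0 <= x <= 1 ->
  (@lebesgue_measure R).-integrable `[0, x] (EFin \o (fun s => u + v * mc s + w * speed s ^+ 2)) /\
  \int[mu]_(s in `[0, x]) (u + v * mc s + w * speed s ^+ 2) =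
    u * x + v * primitive mc x + w * phi1 x.
Proof.
move=> x01; have [i2 e2] := speed_sqr_integrable x01.
have sub := sub_unitI x01.
have ic : (@lebesgue_measure R).-integrable `[0, x] (EFin \o mc).
  by apply: (integrableS _ _ _ mc_integrable).
have iu : (@lebesgue_measure R).-integrable `[0, x] (EFin \o cst u).
  by apply: (integrableS _ _ _ (integrable_unitI_cst u)).
have [j1 e1] := Rintegral_lin v (measurable_itv `[0, x]) iu ic.
have [j3 e3] := Rintegral_lin w (measurable_itv `[0, x]) j1 i2.
split; first exact: j3.
rewrite e3 e1 e2 Rintegral_cst// [X in fine X](lebesgue_measure_itv `[0, x])/= lte_fin.
case/andP: x01; rewrite le_eqVlt => /predU1P[<-|->] _; first by rewrite ltxx/=.
by rewrite -EFinB /= subr0.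
Qed.

(** gN(t, .) is a combination of 1, mc and phi1' with coefficients depending on t,
which gives the joint measurability of gphi and its boundary values. *)
Lemma gphiE t x : unitI x ->
  gphi t x = A t ^+ 2 * x + 2 * A t * B t * primitive mc x + B t ^+ 2 * phi1 x.
Proof.
move=> xI; have x01 : 0 <= x <= 1 by move: xI; rewrite /unitI/= in_itv.
have [_ <-] := quad_integral (A t ^+ 2) (2 * A t * B t) (B t ^+ 2) x01.
by apply: eq_Rintegral => s _; rewrite gN_expand.
Qed.

Lemma gN_integrable t : (@lebesgue_measure R).-integrable unitI (EFin \o gN t).
Proof.
have [i _] := quad_integral (A t ^+ 2) (2 * A t * B t) (B t ^+ 2) (x := 1) (ltac:(by rewrite lexx ler01)).
rewrite (_ : gN t = fun s => A t ^+ 2 + 2 * A t * B t * mc s + B t ^+ 2 * speed s ^+ 2)//.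
by apply/funext => s; exact: gN_expand.
Qed.

Lemma gphi1 t : gphi t 1 = 1.
Proof. by rewrite gphiE// mulr1 (in_G_1 G1) mulr1; exact: sphere. Qed.

(** As theta < pi, the path avoids the negative half-axis, along which the polar
angle would jump. *)
Lemma g_pos t s : unitI t -> unitI s -> 0 < speed s -> 0 < gx t s \/ gy t s != 0.
Proof.
move=> tI sI m0; have At := A_ge0 tI; have Bt := B_ge0 tI; have st := sphere t.
case/andP: (theta0 sI) => th0 thpi.
have [B00|Bn0] := eqVneq (B t) 0.
  left; rewrite /gx B00 mul0r addr0 lt_neqAle At andbT eq_sym; apply/negP => /eqP A00.
  by move: st; rewrite A00 B00 => /eqP; rewrite !mulr0 !mul0r !expr0n/= !addr0 eq_sym oner_eq0.
have Bp : 0 < B t by rewrite lt_neqAle eq_sym Bn0.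
have [t0|tn0] := eqVneq (theta s) 0.
  by left; rewrite /gx /mc t0 cos0 mulr1 ltr_wpDl// mulr_gt0.
right; rewrite /gy /ms !mulf_neq0 ?gt_eqF//.
by apply: sin_gt0_pi; rewrite lt_neqAle eq_sym tn0 th0.
Qed.

Lemma gN_gt0 t s : unitI t -> unitI s -> 0 < speed s -> 0 < gN t s.
Proof.
move=> tI sI m0; rewrite /gN; case: (g_pos tI sI m0) => [x0|y0].
  by rewrite ltr_wpDr ?sqr_ge0// exprn_gt0.
by rewrite ltr_wpDl ?sqr_ge0// lt_neqAle sqr_ge0 andbT eq_sym sqrf_eq0.
Qed.

Lemma gN_ge0 t s : 0 <= gN t s. Proof. by rewrite addr_ge0 ?sqr_ge0. Qed.

Lemma gphi_G t : unitI t -> in_G (gphi t).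
Proof.
move=> tI; have [ac dP] := unitI_primitive (gN_integrable t).
split.
- move=> x xI; have x01 : 0 <= x <= 1 by move: xI; rewrite /unitI/= in_itv.
  rewrite /unitI/= in_itv/= /gphi; apply/andP; split.
    by apply: Rintegral_ge0 => s _; exact: gN_ge0.
  rewrite -(gphi1 t) -[leLHS]ger0_norm; last by apply: Rintegral_ge0 => s _; exact: gN_ge0.
  apply: Rintegral_sub_le => //; [exact: gN_integrable|exact: gN_integrable|].
  by apply: aeW => s _; rewrite ger0_norm// gN_ge0.
- exact: ac.
- by rewrite /gphi /primitive set_itv1 Rintegral_set1.
- exact: gphi1.
- apply: filterS2 dP speed_sqr => s + + sI => /(_ sI)[_ dE] /(_ sI)[m0 _].
  by rewrite dE gN_gt0.
Qed.

Lemma w_add_x_gt0 t s : unitI t -> unitI s -> 0 < speed s ->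
  0 < Num.sqrt (gN t s) + gx t s.
Proof.
move=> tI sI m0; have N0 := gN_gt0 tI sI m0.
have w0 : 0 < Num.sqrt (gN t s) by rewrite sqrtr_gt0.
case: (g_pos tI sI m0) => [x0|y0]; first by rewrite addr_gt0.
have w2 := sqr_sqrtr (ltW N0); set w := Num.sqrt _ in w0 w2 *.
have y2 : 0 < gy t s ^+ 2 by rewrite lt_neqAle sqr_ge0 andbT eq_sym sqrf_eq0.
by move: w2; rewrite /gN; nra.
Qed.

Lemma gx_ac s : abs_continuous 0 1 (gx ^~ s).
Proof.
apply: abs_continuousD01 => //; apply: abs_continuousM01 => //; exact: abs_continuous_cst.
Qed.

Lemma gy_ac s : abs_continuous 0 1 (gy ^~ s).
Proof. apply: abs_continuousM01 => //; exact: abs_continuous_cst. Qed.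

Lemma gN_ac s : abs_continuous 0 1 (gN ^~ s).
Proof.
apply: abs_continuousD01; first exact: (abs_continuousM01 (gx_ac s) (gx_ac s)).
exact: (abs_continuousM01 (gy_ac s) (gy_ac s)).
Qed.

Lemma unitI01 (t : R) : 0 <= t <= 1 -> unitI t. Proof. by rewrite /unitI/= in_itv. Qed.

Lemma speed0 s : ~~ (0 < speed s) -> mc s = 0 /\ ms s = 0.
Proof.
by rewrite -leNgt => h; have m0 : speed s = 0; [apply/le_anti; rewrite h speed_ge0|rewrite /mc /ms m0 !mul0r].
Qed.

Lemma geta_ac s : unitI s -> abs_continuous 0 1 (geta ^~ s).
Proof.
move=> sI; have [m0|/speed0[c00 s00]] := boolP (0 < speed s); last first.
  rewrite (_ : geta ^~ s = cst 0); first exact: abs_continuous_cst.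
  by apply/funext => t; rewrite /geta /gy s00 mulr0 mul0r atan0 mulr0.
have N0 t : 0 <= t <= 1 -> 0 < gN t s by move=> /unitI01 tI; exact: gN_gt0.
have [c c0 cN] := abs_continuous_ge_pos (gN_ac s) N0.
have acv := abs_continuousD01 (abs_continuous_sqrt c0 cN (gN_ac s)) (gx_ac s).
have v0 t : 0 <= t <= 1 -> 0 < Num.sqrt (gN t s) + gx t s.
  by move=> /unitI01 tI; exact: w_add_x_gt0.
have [c' c'0 cv] := abs_continuous_ge_pos acv v0.
have acq := abs_continuousM01 (gy_ac s) (abs_continuousV01 c'0 cv acv).
apply: abs_continuousZ01; apply: (abs_continuous_lipschitz_comp ler01 acq) => u v _ _.
by rewrite mul1r atan_lipschitz.
Qed.

Lemma gpolar t s : unitI t -> unitI s ->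
  gx t s = Num.sqrt (gN t s) * cos (geta t s) /\ gy t s = Num.sqrt (gN t s) * sin (geta t s).
Proof.
move=> tI sI; apply: polar_half; [exact: sqrtr_ge0|by rewrite sqr_sqrtr ?gN_ge0|].
have [m0|/speed0[c00 s00]] := boolP (0 < speed s).
  by case: (g_pos tI sI m0) => h; [right; exact: ltW|left].
by right; rewrite /gx c00 mulr0 addr0 A_ge0.
Qed.

Lemma geta0 s : geta 0 s = 0.
Proof. by rewrite /geta /gy B0 mul0r mul0r atan0 mulr0. Qed.

(** At time 1 the path is at q, whose polar angle is theta by the half-angle
formula. *)
Lemma geta1 : {ae mu, forall s, unitI s -> geta 1 s = theta s}.
Proof.
apply: filterS2 end1 speed_sqr => s + + sI => /(_ sI)[e1 e2] /(_ sI)[m0 _].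
have /andP[t0 tp] := theta0 sI.
have c0 : 0 < cos (theta s / 2) by apply: cos_gt0_pihalf; have := pi_gt0 R; lra.
have cE : cos (theta s) = 2 * cos (theta s / 2) ^+ 2 - 1.
  have -> : cos (theta s) = cos ((theta s / 2) *+ 2) by rewrite -mulr_natr divfK.
  by rewrite cos_mulr2n mulr2n; ring.
have sE : sin (theta s) = 2 * (sin (theta s / 2) * cos (theta s / 2)).
  have -> : sin (theta s) = sin ((theta s / 2) *+ 2) by rewrite -mulr_natr divfK.
  by rewrite sin_mulr2n mulr2n; ring.
have NE : gN 1 s = speed s ^+ 2.
  by rewrite /gN /gx /gy e1 e2 /mc /ms !exprMn -mulrDr cos2Dsin2 mulr1.
rewrite /geta NE sqrtr_sqr ger0_norm ?speed_ge0// /gx /gy e1 e2 /mc /ms.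
have -> : speed s * sin (theta s) / (speed s + speed s * cos (theta s)) = tan (theta s / 2).
  rewrite cE sE /tan; field.
  rewrite !gt_eqF//=.
  by rewrite (_ : _ + _ = speed s * 2 * cos (theta s / 2) ^+ 2) ?mulr_gt0 ?exprn_gt0//; ring.
rewrite tanK; first by rewrite mulrC divfK.
by rewrite in_itv/=; have := pi_gt0 R => pp; apply/andP; split; lra.
Qed.

Lemma dot_comb2 (u v : 'rV[R]_d) (p q p' q' : R) : dot u u = 1 -> dot v v = 1 -> dot v u = 0 ->
  dot (p *: u + q *: v) (p' *: u + q' *: v) = p * p' + q * q'.
Proof.
move=> u1 v1 uv.
transitivity (p * p' * dot u u + q * q' * dot v v + (p * q' + q * p') * dot v u).
  by rewrite /dot !mulr_sumr -!big_split/=; apply: eq_bigr => i _; rewrite !mxE; ring.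
by rewrite u1 v1 uv; ring.
Qed.

Lemma galpha_unit t s : unitI s -> dot (galpha t s) (galpha t s) = 1.
Proof.
move=> sI; rewrite /galpha dot_comb2 ?sphere_fun_unit//; last by have [] := perp sI.
by rewrite -!expr2 cos2Dsin2.
Qed.

Lemma gbeta_ac s : unitI s -> abs_continuous 0 1 (gbeta ^~ s).
Proof.
move=> sI; apply: abs_continuousD01; first by apply: abs_continuousZ01; exact: geta_ac.
apply: (@abs_continuous_lipschitz _ _ _ _ `|kappa s|) => // u v _ uv _.
by rewrite -mulrBl normrM mulrC (ger0_norm (_ : 0 <= v - u))// subr_ge0.
Qed.

Lemma galpha_ac s : unitI s -> abs_continuous 0 1 (galpha ^~ s).
Proof.
move=> sI; have K0 : 0 <= `|a0 s| + `|a0p s| by rewrite addr_ge0.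
apply: (abs_continuous_dominated K0 (abs_continuous_cos (gbeta_ac sI))
  (abs_continuous_sin (gbeta_ac sI))) => u v _ _ _.
rewrite /galpha opprD addrACA -!scalerBl (le_trans (ler_normD _ _))// !normrZ.
have cross (P Q p q : R) : 0 <= P -> 0 <= Q -> 0 <= p -> 0 <= q -> p * P + q * Q <= (P + Q) * (p + q).
  by nra.
by apply: cross; exact: normr_ge0.
Qed.

Lemma measurable_fst_sq (f : R -> R) : measurable_fun setT f ->
  measurable_fun (unitI `*` unitI : set (R * R)) (fun p => f p.1).
Proof.
by move=> mf; apply: measurable_funTS; exact: (measurableT_comp mf measurable_fst).
Qed.

Lemma measurable_snd_sq (f : R -> R) : measurable_fun unitI f ->
  measurable_fun (unitI `*` unitI : set (R * R)) (fun p => f p.2).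
Proof.
move=> mf; apply: (measurable_comp mI _ mf); last by apply: measurable_funTS; exact: measurable_snd.
by move=> _ [[t s] [/= _ sI] <-].
Qed.

Lemma measurable_is_derive (f df : R -> R) : (forall t : R, is_derive t (1 : R) f (df t)) ->
  measurable_fun setT f.
Proof.
move=> hf; apply: continuous_measurable_fun => t.
by apply: differentiable_continuous; apply/derivable1_diffP; exact: (@ex_derive _ _ _ _ _ _ _ (hf t)).
Qed.

Let mA := measurable_fst_sq (measurable_is_derive hA).
Let mB := measurable_fst_sq (measurable_is_derive hB).

Lemma gx_measurable : measurable_fun (unitI `*` unitI : set (R * R)) (fun p => gx p.1 p.2).
Proof.
apply: measurable_funD; first exact: mA.
by apply: measurable_funM; [exact: mB|apply: measurable_snd_sq; exact: mc_measurable].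
Qed.

Lemma gy_measurable : measurable_fun (unitI `*` unitI : set (R * R)) (fun p => gy p.1 p.2).
Proof. by apply: measurable_funM; [exact: mB|apply: measurable_snd_sq; exact: ms_measurable]. Qed.

Lemma gN_measurable : measurable_fun (unitI `*` unitI : set (R * R)) (fun p => gN p.1 p.2).
Proof.
apply: measurable_funD; apply: measurable_funX; [exact: gx_measurable|exact: gy_measurable].
Qed.

Lemma kappa_measurable : measurable_fun unitI kappa.
Proof.
apply: (eq_measurable_fun (fun s => omega a0 a1 phi1 s - 2 * sigma * theta s)).
  by move=> s; rewrite inE => sI; rewrite kappaE// addrAC subrr add0r.
apply: measurable_funB; first exact: omega_measurable.
exact: measurable_funM.
Qed.

Lemma gbeta_measurable : measurable_fun (unitI `*` unitI : set (R * R)) (fun p => gbeta p.1 p.2).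
Proof.
have mv : measurable_fun (unitI `*` unitI : set (R * R)) (fun p => Num.sqrt (gN p.1 p.2) + gx p.1 p.2).
  apply: measurable_funD; last exact: gx_measurable.
  exact: (measurableT_comp (@measurable_sqrtr R) gN_measurable).
have mat : measurable_fun setT (@atan R) by apply: continuous_measurable_fun; exact: continuous_atan.
apply: measurable_funD.
  apply: measurable_funM => //; apply: measurable_funM => //; apply: (measurableT_comp mat).
  by apply: measurable_funM; [exact: gy_measurable|exact: (measurableT_comp (@measurable_invr R) mv)].
apply: measurable_funM; last by apply: measurable_snd_sq; exact: kappa_measurable.
exact: (measurable_fst_sq (f := id)).
Qed.

Lemma g_admissible : admissible gphi gN galpha.
Proof.
have mII : measurable (unitI `*` unitI : set (R * R)) by exact: measurableX.
split.
- apply: (eq_measurable_fun (fun p : R * R => A p.1 ^+ 2 * p.2 + 2 * A p.1 * B p.1 * primitive mc p.2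
    + B p.1 ^+ 2 * phi1 p.2)).
    by move=> [t s]; rewrite inE => -[/= _ sI]; rewrite gphiE.
  have [acP _] := unitI_primitive mc_integrable.
  have mP : measurable_fun unitI (primitive mc).
    by apply: subspace_continuous_measurable_fun => //; apply: abs_continuous_within.
  apply: measurable_funD; first apply: measurable_funD; apply: measurable_funM.
  + by apply: measurable_funX; exact: mA.
  + exact: (measurable_snd_sq (f := id)).
  + by apply: measurable_funM; [apply: measurable_funM => //; exact: mA|exact: mB].
  + exact: measurable_snd_sq.
  + by apply: measurable_funX; exact: mB.
  + by apply: measurable_snd_sq; exact: in_G_measurable.
- exact: gN_measurable.
- move=> i; rewrite (_ : (fun p : R * R => _) = (fun p => cos (gbeta p.1 p.2) * a0 p.2 0 i
    + sin (gbeta p.1 p.2) * a0p p.2 0 i)); last by apply/funext => p; rewrite /galpha !mxE.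
  apply: measurable_funD; apply: measurable_funM.
  + exact: (measurableT_comp (@measurable_cosr R) gbeta_measurable).
  + by apply: (measurable_snd_sq (f := fun s => a0 s 0 i)); exact: sphere_fun_measurable.
  + exact: (measurableT_comp measurable_sinr gbeta_measurable).
  + by apply: (measurable_snd_sq (f := fun s => a0p s 0 i)); exact: sphere_fun_measurable.
- by move=> t s _; exact: galpha_unit.
- exact: gphi_G.
- move=> t s tI sI; rewrite /gphi /primitive EFin_Rintegral//.
  apply: (integrableS _ _ _ (gN_integrable t)) => //.
  by apply: sub_unitI; move: sI; rewrite /unitI/= in_itv.
- apply: filterS speed_sqr => s + sI => /(_ sI)[m0 _] t tI; exact: gN_gt0.
- by apply: aeW => s _; exact: gN_ac.
- by apply: aeW => s sI; exact: galpha_ac.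
Qed.

Lemma g_joins : joins a0 a1 phi1 gphi galpha.
Proof.
split.
- by move=> s sI; rewrite gphiE// A0 B0 expr1n mul1r mulr0 mul0r addr0 expr0n/= mul0r addr0.
- move=> s sI; have s01 : 0 <= s <= 1 by move: sI; rewrite /unitI/= in_itv.
  have [i2 <-] := speed_sqr_integrable s01.
  have sub := sub_unitI s01.
  apply: Rintegral_ae_eq => //.
  + by case/integrableP : (gN_integrable 1) => /measurable_EFinP h _; exact: (measurable_funS mI sub h).
  + by case/integrableP : i2 => /measurable_EFinP.
  + apply: filterS end1 => u + /sub uI => /(_ uI)[e1 e2].
    by rewrite /gN /gx /gy e1 e2 /mc /ms !exprMn -mulrDr cos2Dsin2 mulr1.
- by apply: aeW => s _; rewrite /galpha /gbeta geta0 mulr0 mul0r addr0 cos0 sin0 scale1r scale0r addr0.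
- apply: filterS geta1 => s + sI => /(_ sI) e.
  by rewrite /galpha /gbeta e mul1r -kappaE//; have [_ <-] := perp sI.
Qed.

Definition gdx t s := dA t + dB t * mc s.
Definition gdy t s := dB t * ms s.
Definition gE1 t s := 4 * (gx t s * gdx t s + gy t s * gdy t s) ^+ 2 / gN t s.
Definition gE2 t s :=
  (2 * sigma * ((gx t s * gdy t s - gy t s * gdx t s) / gN t s) + kappa s) ^+ 2 * gN t s.

Lemma gE1E t s : unitI t -> unitI s -> 0 < speed s ->
  derive1 (gN ^~ s) t ^+ 2 / gN t s = gE1 t s.
Proof.
move=> tI sI m0.
have hx : is_derive t (1 : R) (gx ^~ s) (gdx t s).
  apply: (is_derive_eq (is_derive_add (hA t) (is_derive_mul (hB t) (is_derive_const t (mc s))))).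
  by rewrite /gdx mulr0 addr0.
have hy : is_derive t (1 : R) (gy ^~ s) (gdy t s).
  apply: (is_derive_eq (is_derive_mul (hB t) (is_derive_const t (ms s)))).
  by rewrite /gdy mulr0 addr0.
have hN : is_derive t (1 : R) (gN ^~ s) (2 * (gx t s * gdx t s + gy t s * gdy t s)).
  apply: (is_derive_eq (is_derive_add (is_derive_mul hx hx) (is_derive_mul hy hy))); ring.
by rewrite derive1E (@derive_val _ _ _ _ _ _ _ hN) /gE1; congr (_ / _); ring.
Qed.

Lemma gE2E t s : unitI t -> unitI s -> 0 < speed s ->
  dot (derive1 (galpha ^~ s) t) (derive1 (galpha ^~ s) t) * gN t s = gE2 t s.
Proof.
move=> tI sI m0.
have hx : is_derive t (1 : R) (gx ^~ s) (gdx t s).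
  apply: (is_derive_eq (is_derive_add (hA t) (is_derive_mul (hB t) (is_derive_const t (mc s))))).
  by rewrite /gdx mulr0 addr0.
have hy : is_derive t (1 : R) (gy ^~ s) (gdy t s).
  apply: (is_derive_eq (is_derive_mul (hB t) (is_derive_const t (ms s)))).
  by rewrite /gdy mulr0 addr0.
have heta := is_derive_polar_angle hx hy (g_pos tI sI m0).
have hb : is_derive t (1 : R) (gbeta ^~ s)
    (2 * sigma * ((gx t s * gdy t s - gy t s * gdx t s) / gN t s) + kappa s).
  apply: (is_derive_eq (is_derive_add (is_derive_scale (2 * sigma) heta)
    (is_derive_mul (is_derive_id t 1) (is_derive_const t (kappa s))))).
  by rewrite mulr0 addr0 mul1r.
set b' := _ + kappa s in hb.
have hc j : is_derive t (1 : R) (fun t => galpha t s 0 j)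
    ((- sin (gbeta t s) * b') * a0 s 0 j + (cos (gbeta t s) * b') * a0p s 0 j).
  rewrite (_ : (fun t : R => _) = (fun t => cos (gbeta t s) * a0 s 0 j + sin (gbeta t s) * a0p s 0 j)).
    apply: (is_derive_eq (is_derive_add
      (is_derive_mul (is_derive_cos_comp hb) (is_derive_const t _))
      (is_derive_mul (is_derive_sin_comp hb) (is_derive_const t _)))).
    by rewrite !mulr0 !addr0.
  by apply/funext => u; rewrite /galpha !mxE.
have [_ dE] := derive1_row (fun j => @ex_derive _ _ _ _ _ _ _ (hc j)).
have -> : derive1 (galpha ^~ s) t = (- sin (gbeta t s) * b') *: a0 s + (cos (gbeta t s) * b') *: a0p s.
  apply/rowP => j; rewrite dE derive1E (@derive_val _ _ _ _ _ _ _ (hc j)).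
  by rewrite !mxE.
rewrite dot_comb2 ?sphere_fun_unit//; last by have [] := perp sI.
rewrite /gE2 -/b'; congr (_ * _).
rewrite -[RHS]mul1r -(cos2Dsin2 (gbeta t s)); ring.
Qed.

(** Writing z for the angular velocity,
(d gN)^2 / gN + 4 gN z^2 is four times the squared speed of gamma. The term
kappa is absorbed at the price of the factor 1 + e and of C. *)
Lemma gE_bound (e C : R) t s : 0 <= e -> 0 <= C ->
  (forall z, (2 * sigma * z + kappa s) ^+ 2 <= (1 + e) * (2 * sigma * z) ^+ 2 + C) ->
  gE1 t s + sigma ^- 2 * gE2 t s <=
    4 * (1 + e) * (gdx t s ^+ 2 + gdy t s ^+ 2) + sigma ^- 2 * C * gN t s.
Proof.
move=> e0 C0 hk; have c0 : 0 <= sigma ^- 2 by rewrite invr_ge0 sqr_ge0.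
have sN : sigma != 0 by rewrite gt_eqF.
have [N0|Nn0] := eqVneq (gN t s) 0.
  rewrite /gE1 /gE2 N0 invr0 !mulr0 !addr0; apply: mulr_ge0.
    by rewrite mulr_ge0// addr_ge0.
  by rewrite addr_ge0 ?sqr_ge0.
have Np : 0 < gN t s by rewrite lt_neqAle eq_sym Nn0 gN_ge0.
set z := (gx t s * gdy t s - gy t s * gdx t s) / gN t s.
have h1 : sigma ^- 2 * gE2 t s <= sigma ^- 2 * (((1 + e) * (2 * sigma * z) ^+ 2 + C) * gN t s).
  by rewrite ler_wpM2l// ler_wpM2r// ?gN_ge0//; exact: hk.
apply: (le_trans (lerD (lexx _) h1)).
have -> : sigma ^- 2 * (((1 + e) * (2 * sigma * z) ^+ 2 + C) * gN t s) =
    4 * (1 + e) * (z ^+ 2 * gN t s) + sigma ^- 2 * C * gN t s by field.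
rewrite addrA lerD2r.
have -> : z ^+ 2 * gN t s = (gx t s * gdy t s - gy t s * gdx t s) ^+ 2 / gN t s.
  by rewrite /z; field.
have -> : gdx t s ^+ 2 + gdy t s ^+ 2 = ((gx t s * gdx t s + gy t s * gdy t s) ^+ 2 +
    (gx t s * gdy t s - gy t s * gdx t s) ^+ 2) / gN t s.
  rewrite -[LHS](mulfK Nn0); congr (_ / _); rewrite /gN; ring.
rewrite /gE1 (mulrDl _ _ (gN t s)^-1) -mulrA.
set P := (gx t s * gdx t s + _) ^+ 2 / _; set Q := _ / gN t s.
have P0 : 0 <= P by rewrite mulr_ge0 ?sqr_ge0// invr_ge0 gN_ge0.
nra.
Qed.

(** The integral over s of the squared speed of gamma is rho^2, by [length], and
that of gN is 1, by [sphere], at every time. *)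
Lemma energy_le (e C : R) : 0 <= e -> 0 <= C ->
  (forall s z, unitI s -> (2 * sigma * z + kappa s) ^+ 2 <= (1 + e) * (2 * sigma * z) ^+ 2 + C) ->
  (energy sigma gN galpha <= (4 * (1 + e) * rho ^+ 2 + sigma ^- 2 * C)%:E)%E.
Proof.
move=> e0 C0 hk; have c0 : 0 <= sigma ^- 2 by rewrite invr_ge0 sqr_ge0.
have mII : measurable (unitI `*` unitI : set (R * R)) by exact: measurableX.
have mdxI : measurable_fun (unitI `*` unitI : set (R * R)) (fun p => gdx p.1 p.2).
  apply: measurable_funD; first exact: measurable_fst_sq.
  by apply: measurable_funM; [exact: measurable_fst_sq|apply: measurable_snd_sq; exact: mc_measurable].
have mdyI : measurable_fun (unitI `*` unitI : set (R * R)) (fun p => gdy p.1 p.2).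
  by apply: measurable_funM; [exact: measurable_fst_sq|apply: measurable_snd_sq; exact: ms_measurable].
have mNV : measurable_fun (unitI `*` unitI : set (R * R)) (fun p => (gN p.1 p.2)^-1).
  exact: (measurableT_comp (@measurable_invr R) gN_measurable).
pose F1 := (fun p : R * R => gE1 p.1 p.2) \_ (unitI `*` unitI).
pose F2 := (fun p : R * R => gE2 p.1 p.2) \_ (unitI `*` unitI).
have mF1 : measurable_fun setT F1.
  apply/(measurable_restrict _ mII) => //; rewrite setTI; apply: measurable_funM; last exact: mNV.
  apply: measurable_funM => //; apply: measurable_funX.
  apply: measurable_funD; apply: measurable_funM => //; [exact: gx_measurable|exact: gy_measurable].
have mF2 : measurable_fun setT F2.
  apply/(measurable_restrict _ mII) => //; rewrite setTI; apply: measurable_funM; last exact: gN_measurable.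
  apply: measurable_funX; apply: measurable_funD; last by apply: measurable_snd_sq; exact: kappa_measurable.
  apply: measurable_funM => //; apply: measurable_funM; last exact: mNV.
  apply: measurable_funB; apply: measurable_funM => //; [exact: gx_measurable|exact: gy_measurable].
have F10 p : 0 <= F1 p.
  rewrite /F1 patchE; case: ifP => // _; apply: mulr_ge0; last by rewrite invr_ge0 gN_ge0.
  by apply: mulr_ge0 => //; exact: sqr_ge0.
have F20 p : 0 <= F2 p.
  by rewrite /F2 patchE; case: ifP => // _; apply: mulr_ge0; [exact: sqr_ge0|exact: gN_ge0].
have Fin (f : R -> R -> R) t s : unitI t -> unitI s ->
    ((fun p : R * R => f p.1 p.2) \_ (unitI `*` unitI)) (t, s) = f t s.
  by move=> tI sI; rewrite patchE mem_set.
have Fout (f : R -> R -> R) t s : ~ (unitI t /\ unitI s) ->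
    ((fun p : R * R => f p.1 p.2) \_ (unitI `*` unitI)) (t, s) = 0.
  by move=> h; rewrite patchE memNset.
have [N [mN N0 HN]] := speed_sqr.
have sandwich (E : R -> R -> R) (f : R -> R -> R) :
    let F := (fun p : R * R => E p.1 p.2) \_ (unitI `*` unitI) in
    measurable_fun setT F -> (forall p, 0 <= F p) ->
    (forall t s, unitI t -> unitI s -> 0 < speed s -> f t s = E t s) ->
    (\int[mu]_(t in unitI) \int[mu]_(s in unitI) (f t s)%:E <=
     \int[mu]_t \int[mu]_s (F (t, s))%:E)%E.
  move=> F mF F0 fE.
  have mEF : measurable_fun setT (EFin \o F) by exact/measurable_EFinP.
  have EF0 p : (0%R <= (EFin \o F) p)%E by rewrite lee_fin.
  rewrite -[leRHS]integral_unitI_ext; last first.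
    by move=> t tI; rewrite integral0_eq// => s _; rewrite /F Fout// => -[].
  apply: (integral_le_any mI (N := set0)) => //.
  - by apply: measurable_funTS; exact: (measurable_fun_fubini_tonelli_F (m2 := @lebesgue_measure R) (EFin \o F)).
  - by move=> t _; apply: integral_ge0 => s _; exact: EF0.
  move=> t tI _; rewrite -[leRHS]integral_unitI_ext; last first.
    by move=> s sI; rewrite /F Fout// => -[].
  apply: (integral_le_any mI mN N0).
  - by apply: measurable_funTS; exact: (@measurable_fun_pair2 _ _ _ _ _ _ _ t mEF).
  - by move=> s _; exact: EF0.
  - move=> s sI Ns; rewrite lee_fin /F Fin// fE//.
    by have [] : 0 < speed s /\ speed s ^+ 2 = derive1 phi1 s
      by apply: contrapT => h; apply: Ns; apply: HN => /= h'; apply: h; exact: h'.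
have le1 := sandwich gE1 _ mF1 F10 gE1E.
have le2 := sandwich gE2 _ mF2 F20 gE2E.
apply: (@le_trans _ _ (\int[mu]_t \int[mu]_s (F1 (t, s))%:E +
    (sigma ^- 2)%:E * \int[mu]_t \int[mu]_s (F2 (t, s))%:E)%E).
  by apply: leeD => //; apply: lee_wpmul2l; rewrite ?lee_fin.
rewrite tonelli_sum//.
have mF : measurable_fun setT (fun p => (F1 p + sigma ^- 2 * F2 p)%:E).
  by apply/measurable_EFinP; apply: measurable_funD => //; exact: measurable_funM.
have F0 p : (0%R <= (F1 p + sigma ^- 2 * F2 p)%:E)%E by rewrite lee_fin addr_ge0// mulr_ge0.
rewrite -(fubini_tonelli (m1 := @lebesgue_measure R) (m2 := @lebesgue_measure R)
  (fun p => (F1 p + sigma ^- 2 * F2 p)%:E))//=.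
rewrite -[leLHS]integral_unitI_ext; last first.
  move=> t tI; rewrite integral0_eq// => s _; rewrite /F1 /F2 !Fout ?mulr0 ?addr0// => -[] //.
set K := 4 * (1 + e) * rho ^+ 2 + sigma ^- 2 * C.
have -> : K%:E = (\int[mu]_(t in unitI) (cst K%:E t : \bar R))%E.
  rewrite integral_cst// [X in (_ = _ * X)%E](lebesgue_measure_itv `[0, 1])/= lte_fin ltr01.
  by rewrite oppr0 adde0 mule1.
apply: ge0_le_integral_any => t tI; first by apply: integral_ge0 => s _; exact: F0.
rewrite -[leLHS]integral_unitI_ext; last first.
  by move=> s sI; rewrite /F1 /F2 !Fout ?mulr0 ?addr0// => -[].
pose a := 4 * (1 + e); pose b := sigma ^- 2 * C.
have o01 : (0 : R) <= 1 <= (1 : R) by rewrite ler01 lexx.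
have [iq eq] := quad_integral (a * dA t ^+ 2 + b * A t ^+ 2) (2 * (a * (dA t * dB t) + b * (A t * B t)))
   (a * dB t ^+ 2 + b * B t ^+ 2) o01.
apply: (@le_trans _ _ (\int[mu]_(s in unitI) ((a * dA t ^+ 2 + b * A t ^+ 2) +
   2 * (a * (dA t * dB t) + b * (A t * B t)) * mc s + (a * dB t ^+ 2 + b * B t ^+ 2) * speed s ^+ 2)%:E)%E).
  apply: ge0_le_integral_any => s sI; first exact: F0.
  rewrite lee_fin /F1 /F2 !Fin//.
  apply: (le_trans (gE_bound t e0 C0 (fun z => hk s z sI))).
  rewrite gN_expand -/a -/b le_eqVlt; apply/orP; left; apply/eqP.
  have e' : mc s ^+ 2 + ms s ^+ 2 = speed s ^+ 2 by rewrite /mc /ms !exprMn -mulrDr cos2Dsin2 mulr1.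
  by rewrite -e' /gdx /gdy; ring.
rewrite -[leLHS](@EFin_Rintegral _ _ _ mu _ (fun s => (a * dA t ^+ 2 + b * A t ^+ 2) +
   2 * (a * (dA t * dB t) + b * (A t * B t)) * mc s + (a * dB t ^+ 2 + b * B t ^+ 2) * speed s ^+ 2))//.
rewrite lee_fin eq (in_G_1 G1) !mulr1.
rewrite (_ : _ + _ = a * (dA t ^+ 2 + 2 * dA t * dB t * primitive mc 1 + dB t ^+ 2) +
  b * (A t ^+ 2 + 2 * A t * B t * primitive mc 1 + B t ^+ 2)); last by ring.
by rewrite sphere length mulr1.
Qed.

End candidate.

(** * The direction orthogonal to the initial one *)

Section perpendicular.
Context {R : realType} {d : nat}.
Variables (i0 i1 : 'I_d) (i01 : i0 != i1).
Implicit Types u v : 'rV[R]_d.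

Definition tilt u : R := Num.sqrt (u 0 i0 ^+ 2 + u 0 i1 ^+ 2).

(** The quarter turn of u in the plane of the coordinates i0, i1, normalized; when
these two coordinates of u vanish, the first basis vector. Inverses of 0 being
0, the factor 1 - tilt u * (tilt u)^-1 selects this case by a formula whose
measurability is immediate. *)
Definition quarter_turn u : 'rV[R]_d := \row_j
  (((j == i0)%:R * - u 0 i1 + (j == i1)%:R * u 0 i0) * (tilt u)^-1
   + (j == i0)%:R * (1 - tilt u * (tilt u)^-1)).

Lemma quarter_turn_unit u :
  dot (quarter_turn u) (quarter_turn u) = 1 /\ dot (quarter_turn u) u = 0.
Proof.
have i10 : i1 != i0 by rewrite eq_sym.
have sum (f : 'I_d -> R) : (forall j, j != i0 -> j != i1 -> f j = 0) ->
    \sum_j f j = f i0 + f i1.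
  move=> f0; rewrite (bigD1 i0)//= (bigD1 i1)//= big1 ?addr0// => j /andP[j0 j1]; exact: f0.
have t2 : tilt u ^+ 2 = u 0 i0 ^+ 2 + u 0 i1 ^+ 2 by rewrite sqr_sqrtr// addr_ge0 ?sqr_ge0.
have E0 : quarter_turn u 0 i0 = - u 0 i1 * (tilt u)^-1 + (1 - tilt u * (tilt u)^-1).
  by rewrite mxE eqxx (negbTE i01) !mul1r mul0r addr0.
have E1 : quarter_turn u 0 i1 = u 0 i0 * (tilt u)^-1.
  by rewrite mxE eqxx (negbTE i10) !mul1r !mul0r add0r addr0.
have Ej j : j != i0 -> j != i1 -> quarter_turn u 0 j = 0.
  by move=> /negbTE j0 /negbTE j1; rewrite mxE j0 j1 !mul0r !addr0 mul0r.
rewrite /dot !sum; last 2 first.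
- by move=> j j0 j1; rewrite Ej// mul0r.
- by move=> j j0 j1; rewrite Ej// mul0r.
rewrite E0 E1; have [t0|t0] := eqVneq (tilt u) 0.
  have : u 0 i0 ^+ 2 + u 0 i1 ^+ 2 = 0 by rewrite -t2 t0 expr0n.
  move/eqP; rewrite paddr_eq0 ?sqr_ge0// !sqrf_eq0 => /andP[/eqP u0 /eqP u1].
  by rewrite u0 u1 t0; split; ring.
split; last by field.
transitivity ((u 0 i0 ^+ 2 + u 0 i1 ^+ 2) / tilt u ^+ 2); first by field.
by rewrite -t2 divff// expf_neq0.
Qed.

End perpendicular.

(** Where sin omega is nonzero the orthogonal direction is the normalized component
of a1(phi1 s); elsewhere a1(phi1 s) is a0(s) or its opposite, and any
orthogonal unit vector will do, such as [quarter_turn]. *)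
Lemma exists_perp (R : realType) (d : nat) (a0 a1 : sphere_fun R d) (phi1 : R -> R) :
  (2 <= d)%N -> in_G phi1 -> exists a0p : sphere_fun R d, is_perp a0 a1 phi1 a0p.
Proof.
move=> d2 G1; pose i0 := Ordinal (ltnW d2); pose i1 := Ordinal d2.
have i01 : i0 != i1 by [].
pose om := omega a0 a1 phi1; pose sn s := sin (om s); pose cs s := cos (om s).
pose p s : 'rV[R]_d := (sn s)^-1 *: (a1 (phi1 s) - cs s *: a0 s)
  + (1 - sn s * (sn s)^-1) *: quarter_turn i0 i1 (a0 s).
have mom : measurable_fun unitI om by exact: omega_measurable.
have msn : measurable_fun unitI sn by exact: (measurableT_comp measurable_sinr).
have mcs : measurable_fun unitI cs by exact: (measurableT_comp (@measurable_cosr R)).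
have minv (f : R -> R) : measurable_fun unitI f -> measurable_fun unitI (fun s => (f s)^-1).
  by move=> mf; exact: (measurableT_comp (@measurable_invr R)).
have ma0 j : measurable_fun unitI (fun s => a0 s 0 j) by exact: sphere_fun_measurable.
have ma1 j : measurable_fun unitI (fun s => a1 (phi1 s) 0 j).
  apply: (measurable_comp (@measurable_unitI R) _ (sphere_fun_measurable a1 j) (in_G_measurable G1)).
  by move=> _ [s sI <-]; exact: (in_G_range G1).
have mtilt : measurable_fun unitI (fun s => tilt i0 i1 (a0 s)).
  apply: (measurableT_comp (@measurable_sqrtr R)).
  by apply: measurable_funD; apply: measurable_funX.
have mp (j : 'I_d) : measurable_fun unitI (fun s => p s 0 j).
  rewrite (_ : (fun s => p s 0 j) = fun s => (sn s)^-1 * (a1 (phi1 s) 0 j - cs s * a0 s 0 j)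
    + (1 - sn s * (sn s)^-1) * (((j == i0)%:R * - a0 s 0 i1 + (j == i1)%:R * a0 s 0 i0) * (tilt i0 i1 (a0 s))^-1
   + (j == i0)%:R * (1 - tilt i0 i1 (a0 s) * (tilt i0 i1 (a0 s))^-1))); last first.
    by apply/funext => s; rewrite !mxE.
  apply: measurable_funD; apply: measurable_funM.
  - exact: minv.
  - by apply: measurable_funB => //; exact: measurable_funM.
  - by apply: measurable_funB => //; apply: measurable_funM => //; exact: minv.
  apply: measurable_funD; last first.
    by apply: measurable_funM => //; apply: measurable_funB => //; apply: measurable_funM => //; exact: minv.
  apply: measurable_funM; last exact: minv.
  by apply: measurable_funD; apply: measurable_funM => //; exact: measurable_funN.
have key s : unitI s -> [/\ dot (p s) (p s) = 1, dot (p s) (a0 s) = 0 &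
    a1 (phi1 s) = cs s *: a0 s + sn s *: p s].
  move=> sI; have u0 := sphere_fun_unit a0 sI; have u1 := sphere_fun_unit a1 (in_G_range G1 sI).
  have cE : dot (a0 s) (a1 (phi1 s)) = cs s by rewrite /cs /om /omega acosK//; exact: dot_range.
  have cs2 : cs s ^+ 2 + sn s ^+ 2 = 1 by exact: cos2Dsin2.
  have [qq qa] := quarter_turn_unit i01 (a0 s).
  have [s0|s0] := eqVneq (sn s) 0.
    have pE : p s = quarter_turn i0 i1 (a0 s).
      by rewrite /p s0 invr0 scale0r mul0r subr0 scale1r add0r.
    rewrite pE; split => //; rewrite s0 scale0r addr0.
    move: cs2; rewrite s0 [0 ^+ 2]expr2 mul0r addr0 => /eqP; rewrite sqrf_eq1 => /orP[/eqP c1|/eqP c1].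
      by rewrite c1 scale1r (dot_unit_eq u0 u1)// cE c1.
    rewrite c1 scaleN1r; have un : dot (- a1 (phi1 s)) (- a1 (phi1 s)) = 1.
      by rewrite -u1; apply: eq_bigr => j _; rewrite !mxE mulrNN.
    have dn : dot (a0 s) (- a1 (phi1 s)) = 1.
      rewrite -[RHS]opprK -c1 -cE /dot -sumrN; apply: eq_bigr => j _; rewrite !mxE mulrN//.
    by rewrite (dot_unit_eq u0 un dn) opprK.
  have pE : p s = (sn s)^-1 *: (a1 (phi1 s) - cs s *: a0 s).
    by rewrite /p divff// subrr scale0r addr0.
  have dA0 : dot (a1 (phi1 s)) (a0 s) = cs s by rewrite dotC.
  rewrite pE; split.
  - transitivity ((sn s)^-1 ^+ 2 * (dot (a1 (phi1 s)) (a1 (phi1 s)) - 2 * cs s * dot (a1 (phi1 s)) (a0 s)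
      + cs s ^+ 2 * dot (a0 s) (a0 s))).
      by rewrite /dot !mulr_sumr -sumrB -big_split/= mulr_sumr; apply: eq_bigr => j _; rewrite !mxE; ring.
    rewrite u0 u1 dA0.
    have -> : 1 - 2 * cs s * cs s + cs s ^+ 2 * 1 = sn s ^+ 2 by move: cs2; lra.
    by rewrite exprVn mulVf// expf_neq0.
  - transitivity ((sn s)^-1 * (dot (a1 (phi1 s)) (a0 s) - cs s * dot (a0 s) (a0 s))).
      by rewrite /dot !mulr_sumr -sumrB mulr_sumr; apply: eq_bigr => j _; rewrite !mxE; ring.
    by rewrite u0 dA0 mulr1 subrr mulr0.
  - by rewrite scalerA divff// scale1r addrC subrK.
by exists (SphereFun mp (fun s sI => let: And3 h _ _ := key s sI in h)) => s sI; have [] := key s sI.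
Qed.

(** * Great-circle arcs *)

Section arc.
Context {R : realType} (k : R).
Hypothesis (k1 : -1 < k <= 1).

Let rho := acos k.
Let k1' : -1 <= k <= 1. Proof. by case/andP: k1 => /ltW -> ->. Qed.

(** Coefficients of the great-circle arc between two unit vectors with inner
product k, constant when they coincide. *)
Definition arcA (t : R) : R :=
  if acos k == 0 then 1 else sin ((1 - t) * acos k) / sin (acos k).
Definition arcB (t : R) : R := if acos k == 0 then 0 else sin (t * acos k) / sin (acos k).
Definition arcdA (t : R) : R :=
  if acos k == 0 then 0 else - (acos k * cos ((1 - t) * acos k) / sin (acos k)).
Definition arcdB (t : R) : R :=
  if acos k == 0 then 0 else acos k * cos (t * acos k) / sin (acos k).

Lemma arc_sin_gt0 : rho != 0 -> 0 < rho < pi /\ 0 < sin rho.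
Proof.
move=> r0; have h : 0 < rho < pi.
  rewrite lt_neqAle eq_sym r0 acos_ge0//= lt_neqAle acos_lepi// andbT; apply/negP => /eqP e.
  by have := acosK k1'; rewrite -/rho e cospi => kk; case/andP: k1; rewrite -kk ltxx.
by split => //; exact: sin_gt0_pi.
Qed.

Lemma arcA_derive (t : R) : is_derive t (1 : R) arcA (arcdA t).
Proof.
rewrite /arcA /arcdA; case: ifPn => [_|r0]; first exact: is_derive_const.
have -> : (fun t => sin ((1 - t) * acos k) / sin (acos k)) =
    (fun t => (sin (acos k))^-1 * sin (- acos k * t + acos k)).
  by apply/funext => u; rewrite mulrC; congr (_ * sin _); ring.
have hs := is_derive_scale (sin (acos k))^-1 (is_derive_sin_comp (is_derive_affine t (- acos k) (acos k))).
apply: (is_derive_eq hs).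
by rewrite (_ : - acos k * t + acos k = (1 - t) * acos k); ring.
Qed.

Lemma arcB_derive (t : R) : is_derive t (1 : R) arcB (arcdB t).
Proof.
rewrite /arcB /arcdB; case: ifPn => [_|r0]; first exact: is_derive_const.
have -> : (fun t => sin (t * acos k) / sin (acos k)) =
    (fun t => (sin (acos k))^-1 * sin (acos k * t + 0)).
  by apply/funext => u; rewrite mulrC addr0 [acos k * u]mulrC.
have hs := is_derive_scale (sin (acos k))^-1 (is_derive_sin_comp (is_derive_affine t (acos k) 0)).
apply: (is_derive_eq hs).
by rewrite (_ : acos k * t + 0 = t * acos k); ring.
Qed.

Lemma arcA_ac : abs_continuous 0 1 arcA.
Proof.
have [r0|/negbTE r0] := boolP (acos k == 0).
  rewrite (_ : arcA = cst 1); first exact: abs_continuous_cst.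
  by apply/funext => u; rewrite /arcA r0.
rewrite (_ : arcA = (fun t => (sin (acos k))^-1 * sin (- acos k * t + acos k))).
  by apply: abs_continuousZ01; apply: abs_continuous_sin; exact: abs_continuous_affine.
by apply/funext => u; rewrite /arcA r0 mulrC; congr (_ * sin _); ring.
Qed.

Lemma arcB_ac : abs_continuous 0 1 arcB.
Proof.
have [r0|/negbTE r0] := boolP (acos k == 0).
  rewrite (_ : arcB = cst 0); first exact: abs_continuous_cst.
  by apply/funext => u; rewrite /arcB r0.
rewrite (_ : arcB = (fun t => (sin (acos k))^-1 * sin (acos k * t + 0))).
  by apply: abs_continuousZ01; apply: abs_continuous_sin; exact: abs_continuous_affine.
by apply/funext => u; rewrite /arcB r0 mulrC addr0 [acos k * u]mulrC.
Qed.

Lemma arcdA_measurable : measurable_fun setT arcdA.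
Proof.
have [r0|/negbTE r0] := boolP (acos k == 0).
  rewrite (_ : arcdA = cst 0); first exact: measurable_cst.
  by apply/funext => u; rewrite /arcdA r0.
rewrite (_ : arcdA = (fun t => - (acos k / sin (acos k)) * cos (- acos k * t + acos k))).
  apply: measurable_funM => //; apply: (measurableT_comp (@measurable_cosr R)).
  by apply: measurable_funD => //; exact: measurable_funM.
by apply/funext => u; rewrite /arcdA r0 (_ : - acos k * u + acos k = (1 - u) * acos k); ring.
Qed.

Lemma arcdB_measurable : measurable_fun setT arcdB.
Proof.
have [r0|/negbTE r0] := boolP (acos k == 0).
  rewrite (_ : arcdB = cst 0); first exact: measurable_cst.
  by apply/funext => u; rewrite /arcdB r0.
rewrite (_ : arcdB = (fun t => acos k * cos (t * acos k) / sin (acos k))).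
  apply: measurable_funM => //; apply: measurable_funM => //; apply: (measurableT_comp (@measurable_cosr R)).
  exact: measurable_funM.
by apply/funext => u; rewrite /arcdB r0.
Qed.

Lemma arc_ge0 (t : R) : unitI t -> 0 <= arcA t /\ 0 <= arcB t.
Proof.
rewrite /unitI/= in_itv/= => /andP[t0 t1]; rewrite /arcA /arcB; case: ifPn => // r0.
have [/andP[rp rpi] sp] := arc_sin_gt0 r0; rewrite -/rho in rp rpi sp *.
by split; apply: divr_ge0 (ltW sp); apply: sin_ge0_pi; apply/andP; split; nra.
Qed.

Lemma arc0 : arcA 0 = 1 /\ arcB 0 = 0.
Proof.
rewrite /arcA /arcB; case: ifPn => // r0; have [_ sp] := arc_sin_gt0 r0.
by rewrite subr0 mul1r mul0r sin0 mul0r divff// gt_eqF.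
Qed.

Lemma arc1 : rho != 0 -> arcA 1 = 0 /\ arcB 1 = 1.
Proof.
move=> r0; rewrite /arcA /arcB (negbTE r0); have [_ sp] := arc_sin_gt0 r0.
by rewrite subrr mul0r sin0 mul0r mul1r divff// gt_eqF.
Qed.

Let cos_rho (t : R) : k = cos ((1 - t) * rho) * cos (t * rho) - sin ((1 - t) * rho) * sin (t * rho).
Proof. by rewrite -cosD -mulrDl subrK mul1r acosK. Qed.

Let sin_rho (t : R) : sin rho = sin ((1 - t) * rho) * cos (t * rho) + cos ((1 - t) * rho) * sin (t * rho).
Proof. by rewrite -sinD -mulrDl subrK mul1r. Qed.

(** The addition formulas for the angles (1 - t) rho and t rho, of sum rho. *)
Lemma arc_unit (t : R) : arcA t ^+ 2 + 2 * arcA t * arcB t * k + arcB t ^+ 2 = 1.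
Proof.
rewrite /arcA /arcB; case: ifPn => [_|r0]; first by ring.
have [_ sp] := arc_sin_gt0 r0; have sn0 : sin rho != 0 by rewrite gt_eqF.
rewrite -/rho; have kt := cos_rho t; have st := sin_rho t.
have e1 := cos2Dsin2 ((1 - t) * rho); have e2 := cos2Dsin2 (t * rho).
move: kt st e1 e2; set a := sin ((1 - t) * rho); set b := sin (t * rho).
set c := cos ((1 - t) * rho); set e := cos (t * rho) => kt st e1 e2.
have h : a ^+ 2 + 2 * a * b * k + b ^+ 2 = sin rho ^+ 2.
  have c2 : c ^+ 2 = 1 - a ^+ 2 by rewrite -e1; ring.
  have e2' : e ^+ 2 = 1 - b ^+ 2 by rewrite -e2; ring.
  have -> : sin rho ^+ 2 = a ^+ 2 * e ^+ 2 + 2 * a * b * (c * e) + b ^+ 2 * c ^+ 2 by rewrite st; ring.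
  by rewrite e2' c2 kt; ring.
transitivity ((a ^+ 2 + 2 * a * b * k + b ^+ 2) / sin rho ^+ 2); first by field.
by rewrite h divff// expf_neq0.
Qed.

Lemma arc_speed (t : R) :
  arcdA t ^+ 2 + 2 * arcdA t * arcdB t * k + arcdB t ^+ 2 = acos k ^+ 2.
Proof.
rewrite /arcdA /arcdB; case: ifPn => [/eqP ->|r0]; first by ring.
have [_ sp] := arc_sin_gt0 r0; have sn0 : sin rho != 0 by rewrite gt_eqF.
rewrite -/rho; have kt := cos_rho t; have st := sin_rho t.
have e1 := cos2Dsin2 ((1 - t) * rho); have e2 := cos2Dsin2 (t * rho).
move: kt st e1 e2; set a := sin ((1 - t) * rho); set b := sin (t * rho).
set c := cos ((1 - t) * rho); set e := cos (t * rho) => kt st e1 e2.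
have h : c ^+ 2 - 2 * c * e * k + e ^+ 2 = sin rho ^+ 2.
  have a2 : a ^+ 2 = 1 - c ^+ 2 by rewrite -e1; ring.
  have b2 : b ^+ 2 = 1 - e ^+ 2 by rewrite -e2; ring.
  have -> : sin rho ^+ 2 = a ^+ 2 * e ^+ 2 + 2 * (a * b) * (c * e) + b ^+ 2 * c ^+ 2 by rewrite st; ring.
  by rewrite b2 a2 kt; ring.
transitivity (rho ^+ 2 * ((c ^+ 2 - 2 * c * e * k + e ^+ 2) / sin rho ^+ 2)); first by field.
by rewrite h divff ?mulr1// expf_neq0.
Qed.

End arc.

(** * The infimum of the energy *)

Section arc_trajectory.
Context {R : realType} {d : nat} (sigma : R).
Hypotheses (sigma0 : 0 < sigma).
Variables (a0 a1 : sphere_fun R d) (phi1 : R -> R) (G1 : in_G phi1).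
Variables (theta kappa : R -> R) (a0p : sphere_fun R d) (thmax : R).
Hypotheses (mtheta : measurable_fun unitI theta) (thmax0 : 0 <= thmax < pi)
  (theta0 : forall s, unitI s -> 0 <= theta s <= thmax)
  (kappaE : forall s, unitI s -> omega a0 a1 phi1 s = 2 * sigma * theta s + kappa s)
  (perp : is_perp a0 a1 phi1 a0p).

Definition arc_corr : R := \int[mu]_(s in unitI) (speed phi1 s * cos (theta s)).
Let mI := @measurable_unitI R.

Let theta_pi s : unitI s -> 0 <= theta s < pi.
Proof.
by move=> /theta0 /andP[-> h]; apply: le_lt_trans h _; case/andP: thmax0.
Qed.

(** The correlation exceeds -1 because theta stays away from pi and the integral
of the square root of phi1' is at most 1. *)
Lemma arc_corr_range : -1 < arc_corr <= 1.
Proof.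
have mcos : measurable_fun unitI (fun s => cos (theta s)).
  exact: (measurableT_comp (@measurable_cosr R)).
have [ic /andP[_ ->]] := sqrt_derive1_integrable G1 mcos (fun s _ => cos_max (theta s)).
rewrite andbT -/arc_corr.
have [|i1 /andP[_ i1le]] := sqrt_derive1_integrable G1 (measurable_cst (1 : R)).
  by move=> s _; rewrite normr1.
pose q := Num.max 0 (- cos thmax).
have q0 : 0 <= q by rewrite le_max lexx.
have q1 : q < 1.
  case/andP: thmax0 => t0 tp; rewrite gt_max ltr01 ltrNl -cospi ltr_cos//.
  - by rewrite in_itv/= t0 ltW.
  - by rewrite in_itv/= lexx pi_ge0.
have [j e] := Rintegral_lin q mI ic i1.
apply: (@lt_le_trans _ _ (- q)); first by rewrite ltrN2.
have : 0 <= arc_corr + q * (\int[mu]_(s in unitI) (Num.sqrt (derive1 phi1 s) * cst 1 s)).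
  rewrite /arc_corr -e; apply: Rintegral_ge0_ae => //; apply: aeW => s sI.
  rewrite mulr1 -/(speed phi1 s) [q * _]mulrC -mulrDr mulr_ge0 ?speed_ge0//.
  have /andP[t0 tm] := theta0 sI; case/andP: thmax0 => tm0 tmp.
  have : cos thmax <= cos (theta s).
    by rewrite ler_cos// ?t0 ?tm0 ?(le_trans tm)//= ltW.
  have : - cos thmax <= q by rewrite le_max lexx orbT.
  lra.
have := ler_wpM2l q0 i1le; rewrite mulr1; lra.
Qed.

(** The arc is constant when the correlation is 1. With m the square root of
phi1', the integral of (m - 1)^2 + 2 m (1 - cos theta) then vanishes, so that
q = (1, 0) almost everywhere. *)
Lemma arc_end1 : {ae mu, forall s, unitI s ->
  arcA arc_corr 1 + arcB arc_corr 1 * (speed phi1 s * cos (theta s)) = speed phi1 s * cos (theta s) /\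
  arcB arc_corr 1 * (speed phi1 s * sin (theta s)) = speed phi1 s * sin (theta s)}.
Proof.
have [r0|r0] := eqVneq (acos arc_corr) 0; last first.
  have [-> ->] := arc1 arc_corr_range r0; apply: aeW => s sI.
  by rewrite add0r !mul1r.
have k1 : arc_corr = 1.
  have kr : -1 <= arc_corr <= 1 by case/andP: arc_corr_range => /ltW -> ->.
  by have := acosK kr; rewrite r0 cos0.
have [id1 ed1] := in_G_derive1_unitI G1.
have ic := mc_integrable G1 mtheta.
have [j1 e1] := Rintegral_lin 1 mI (integrable_unitI_cst 1) id1.
have [j2 e2] := Rintegral_lin (-2) mI j1 ic.
pose f s := cst 1 s + 1 * derive1 phi1 s + -2 * (speed phi1 s * cos (theta s)).
have f0 : {ae mu, forall s, unitI s -> 0 <= f s}.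
  apply: filterS (speed_sqr G1) => s + sI => /(_ sI)[m0 m2].
  rewrite /f /= -m2; have := sqr_ge0 (speed phi1 s - 1); have := cos_le1 (theta s).
  by nra.
have intf : (\int[mu]_(s in unitI) `|(EFin \o f) s| = 0%:E)%E.
  transitivity (\int[mu]_(s in unitI) (f s)%:E)%E.
    apply: ae_eq_integral => //.
    - by apply: measurableT_comp => //; case/integrableP : j2.
    - by case/integrableP : j2.
    - by apply: filterS f0 => s + sI => /(_ sI) h /=; rewrite ger0_norm.
  rewrite -(@EFin_Rintegral _ _ _ mu _ f)// e2 e1 ed1 Rintegral_unitI_cst.
  by rewrite -/arc_corr k1; congr EFin; ring.
have mf : measurable_fun unitI (EFin \o f) by case/integrableP : j2.
have /(ae_eq_integral_abs mu mI mf) fz := intf.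
apply: filterS2 fz (speed_sqr G1) => s + + sI => /(_ sI) [] h /(_ sI)[m0 m2].
have cl := cos_le1 (theta s); set m := speed phi1 s in m0 m2 h *.
set c := cos (theta s) in cl h *.
have hh : (m - 1) ^+ 2 + 2 * (m * (1 - c)) = 0 by move: h; rewrite /f /= -/m -/c -m2; lra.
have mc0 : 0 <= m * (1 - c) by rewrite mulr_ge0 ?subr_ge0// ltW.
have m1 : m = 1.
  have /eqP : (m - 1) ^+ 2 = 0 by apply/le_anti; rewrite sqr_ge0 andbT; lra.
  by rewrite sqrf_eq0 subr_eq0 => /eqP.
have c1 : c = 1 by move: hh; rewrite m1; lra.
have s0 : sin (theta s) = 0.
  by apply/eqP; rewrite -sqrf_eq0 sin2cos2 -/c c1 expr1n subrr.
by rewrite /arcA /arcB r0 eqxx m1 c1 s0; split; ring.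
Qed.

Let A := arcA arc_corr.
Let B := arcB arc_corr.
Let hA := arcA_derive arc_corr.
Let hB := arcB_derive arc_corr.
Let acA := arcA_ac arc_corr.
Let acB := arcB_ac arc_corr.
Let mdA := arcdA_measurable arc_corr.
Let mdB := arcdB_measurable arc_corr.
Let A_ge0 t (tI : unitI t) := (arc_ge0 arc_corr_range tI).1.
Let B_ge0 t (tI : unitI t) := (arc_ge0 arc_corr_range tI).2.
Let A0 := (arc0 arc_corr_range).1.
Let B0 := (arc0 arc_corr_range).2.
Let sphere := arc_unit arc_corr_range.
Let length := arc_speed arc_corr_range.

Definition arc_phi := gphi phi1 theta A B.
Definition arc_dphi := gN phi1 theta A B.
Definition arc_alpha := galpha sigma a0 phi1 theta kappa a0p A B.

Lemma arc_admissible : admissible arc_phi arc_dphi arc_alpha.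
Proof.
exact: (g_admissible G1 mtheta theta_pi kappaE perp hA hB acA acB A_ge0 B_ge0 sphere).
Qed.

Lemma arc_joins : joins a0 a1 phi1 arc_phi arc_alpha.
Proof. exact: (g_joins G1 mtheta theta_pi kappaE perp A0 B0 arc_end1). Qed.

Lemma arc_energy_le (e C : R) : 0 <= e -> 0 <= C ->
  (forall s z, unitI s -> (2 * sigma * z + kappa s) ^+ 2 <= (1 + e) * (2 * sigma * z) ^+ 2 + C) ->
  (energy sigma arc_dphi arc_alpha <= (4 * (1 + e) * acos arc_corr ^+ 2 + sigma ^- 2 * C)%:E)%E.
Proof.
exact: (energy_le sigma0 G1 mtheta theta_pi kappaE perp hA hB mdA mdB A_ge0 B_ge0 sphere length).
Qed.

End arc_trajectory.

Section infimum.
Context {R : realType} {d : nat} (sigma : R).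
Hypotheses (d2 : (2 <= d)%N) (sigma0 : 0 < sigma) (sigma1 : 1 <= 2 * sigma).
Variables (a0 a1 : sphere_fun R d) (phi1 : R -> R) (G1 : in_G phi1).

Lemma energy_inf_ge : ((4 * angle sigma a0 a1 phi1 ^+ 2)%:E <= ereal_inf (energies sigma a0 a1 phi1))%E.
Proof.
by apply: le_ereal_inf_tmp => _ [phi [dphi [alpha [ad jn ->]]]]; exact: (energy_ge sigma0 sigma1 G1 ad jn).
Qed.

(** When 2 sigma = 1 the angle theta = omega / (2 sigma) may reach pi, where the
polar angle is not continuous. Cutting it at pi - de only brings the end points
closer, since the cosine decreases, and the missing rotation costs little. *)
Lemma energy_inf_le : (ereal_inf (energies sigma a0 a1 phi1) <= (4 * angle sigma a0 a1 phi1 ^+ 2)%:E)%E.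
Proof.
have [a0p perp] := exists_perp a0 a1 d2 G1.
set rho := angle sigma a0 a1 phi1.
have rho0 : 0 <= rho by case/andP: (angle_range sigma a0 a1 G1).
apply/lee_addgt0Pr => eta eta0; rewrite -EFinD.
(* e makes the multiplicative loss 4 e rho^2 at most eta / 2; given e, de makes the
   additive loss 4 (1 + 1/e) de^2 at most eta / 2. *)
pose e := eta / (8 * (rho ^+ 2 + 1)).
have r1 : 0 < rho ^+ 2 + 1 by rewrite ltr_wpDl ?sqr_ge0.
have e0 : 0 < e by rewrite divr_gt0 ?mulr_gt0.
pose de := Num.min 1 (eta / (8 * (1 + e^-1))).
have ei : 0 < 1 + e^-1 by rewrite addr_gt0 ?invr_gt0.
have de0 : 0 < de by rewrite lt_min ltr01 divr_gt0 ?mulr_gt0.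
have de1 : de <= 1 by rewrite ge_min lexx.
have pp : 2 <= pi :> R by exact: pi_ge2.
have s2 : 0 < 2 * sigma by rewrite mulr_gt0.
pose theta s := Num.min (omega a0 a1 phi1 s / (2 * sigma)) (pi - de).
pose kappa s := omega a0 a1 phi1 s - 2 * sigma * theta s.
have om s : unitI s -> 0 <= omega a0 a1 phi1 s / (2 * sigma) <= pi.
  by move=> sI; apply: div2sigma_range => //; exact: omega_range.
have mom : measurable_fun unitI (fun s => omega a0 a1 phi1 s / (2 * sigma)).
  by apply: measurable_funM => //; exact: omega_measurable.
have mtheta : measurable_fun unitI theta by exact: measurable_minr.
have tm : 0 <= pi - de < pi by apply/andP; split; lra.
have theta0 s : unitI s -> 0 <= theta s <= pi - de.
  move=> sI; rewrite /theta ge_min lexx orbT andbT le_min; case/andP: (om s sI) => -> _.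
  by case/andP: tm.
have kappaE s : unitI s -> omega a0 a1 phi1 s = 2 * sigma * theta s + kappa s.
  by move=> _; rewrite /kappa addrC subrK.
have kap s : unitI s -> 0 <= kappa s <= 2 * sigma * de.
  move=> sI; have -> : kappa s = 2 * sigma * (omega a0 a1 phi1 s / (2 * sigma) - theta s).
    by rewrite /kappa mulrBr [_ * (_ / _)]mulrC divfK// gt_eqF.
  case/andP: (om s sI) => o0 op; rewrite mulr_ge0 ?(ltW s2)//=.
    rewrite ler_pM2l// /theta; case: (leP (omega a0 a1 phi1 s / (2 * sigma)) (pi - de)) => h; lra.
  by rewrite subr_ge0 /theta ge_min lexx.
pose C := (1 + e^-1) * (2 * sigma * de) ^+ 2.
have C0 : 0 <= C by rewrite mulr_ge0 ?sqr_ge0// ltW.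
have young s z : unitI s -> (2 * sigma * z + kappa s) ^+ 2 <= (1 + e) * (2 * sigma * z) ^+ 2 + C.
  move=> sI; have /andP[k0 kd] := kap s sI.
  have : kappa s ^+ 2 <= (2 * sigma * de) ^+ 2 by rewrite lerXn2r ?nnegrE// (le_trans k0).
  move=> /(ler_wpM2l (ltW ei)); rewrite -/C => h; apply: le_trans (lerD (lexx _) h).
  set u := 2 * sigma * z; set v := kappa s; rewrite -subr_ge0.
  rewrite (_ : _ - _ = e * (u - e^-1 * v) ^+ 2); last by field; rewrite gt_eqF.
  by rewrite mulr_ge0 ?sqr_ge0// ltW.
have le := arc_energy_le sigma0 G1 mtheta tm theta0 kappaE perp (ltW e0) C0 young.
apply: (@le_trans _ _ (energy sigma (arc_dphi phi1 theta) (arc_alpha sigma a0 phi1 theta kappa a0p))).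
  apply: ereal_inf_lbound; exists (arc_phi phi1 theta), (arc_dphi phi1 theta),
    (arc_alpha sigma a0 phi1 theta kappa a0p); split => //.
  - exact: (arc_admissible G1 mtheta tm theta0 kappaE perp).
  - exact: (arc_joins G1 mtheta tm theta0 kappaE perp).
apply: (le_trans le); rewrite lee_fin.
have kr := arc_corr_range G1 mtheta tm theta0.
have kr' : -1 <= arc_corr phi1 theta <= 1 by case/andP: kr => /ltW -> ->.
have rle : acos (arc_corr phi1 theta) <= rho.
  have cr : -1 <= corr sigma a0 a1 phi1 <= 1 by exact: corr_range.
  rewrite /rho /angle -/(corr sigma a0 a1 phi1) le_acos//.
  have [ic1 ic2] := (corr_integrable sigma a0 a1 G1, mc_integrable G1 mtheta).
  apply: le_Rintegral; [exact: measurable_unitI|exact: ic1|exact: ic2|].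
  move=> s sI; rewrite ler_wpM2l// ler_cos//; first by rewrite /theta ge_min lexx.
  - exact: om.
  - by have /andP[-> h] := theta0 s sI; apply: (le_trans h); case/andP: tm => _ /ltW.
have r2 : acos (arc_corr phi1 theta) ^+ 2 <= rho ^+ 2.
  by rewrite lerXn2r ?nnegrE// acos_ge0.
have b1 : 4 * e * rho ^+ 2 <= eta / 2.
  have -> : eta / 2 = 4 * e * (rho ^+ 2 + 1) by rewrite /e; field; rewrite gt_eqF.
  by rewrite (ler_pM2l (mulr_gt0 (ltr0n R 4) e0)) lerDl.
have b2 : sigma ^- 2 * C <= eta / 2.
  have -> : sigma ^- 2 * C = 4 * (1 + e^-1) * de ^+ 2.
    by rewrite /C; field; rewrite !gt_eqF.
  have d1 : de ^+ 2 <= de by rewrite expr2 ler_piMr// ltW.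
  have d2' : de <= eta / (8 * (1 + e^-1)) by rewrite ge_min lexx orbT.
  have -> : eta / 2 = 4 * (1 + e^-1) * (eta / (8 * (1 + e^-1))).
    by move: (1 + e^-1) ei => w w0; field; rewrite gt_eqF.
  by rewrite (ler_pM2l (mulr_gt0 (ltr0n R 4) ei)) (le_trans d1).
have b3 : 4 * (1 + e) * acos (arc_corr phi1 theta) ^+ 2 <= 4 * (1 + e) * rho ^+ 2.
  by rewrite (ler_pM2l (mulr_gt0 (ltr0n R 4) (addr_gt0 ltr01 e0))).
lra.
Qed.

Lemma energy_inf : ereal_inf (energies sigma a0 a1 phi1) = (4 * angle sigma a0 a1 phi1 ^+ 2)%:E.
Proof. by apply/le_anti; rewrite energy_inf_le energy_inf_ge. Qed.

(** If 2 sigma > 1 then theta <= pi / (2 sigma) < pi and no cutting is needed: the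
upper bound is exact for the trajectory deduced from the geodesic. *)
Lemma energy_attained : 1 < 2 * sigma ->
  exists (a0p : sphere_fun R d) (phi dphi : R -> R -> R) (alpha : R -> R -> 'rV[R]_d),
    [/\ is_perp a0 a1 phi1 a0p,
        deduced_from sigma (geodesic (@q0 R) (q1 sigma a0 a1 phi1)) a0 a0p phi dphi alpha,
        admissible phi dphi alpha, joins a0 a1 phi1 phi alpha &
        energy sigma dphi alpha = ereal_inf (energies sigma a0 a1 phi1)].
Proof.
move=> s1; have [a0p perp] := exists_perp a0 a1 d2 G1.
have s2 : 0 < 2 * sigma by rewrite mulr_gt0.
have pp : 0 < pi :> R by exact: pi_gt0.
pose theta s := omega a0 a1 phi1 s / (2 * sigma); pose kappa (s : R) : R := 0.
have mtheta : measurable_fun unitI theta.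
  by apply: measurable_funM => //; exact: omega_measurable.
have tm : 0 <= pi / (2 * sigma) < pi.
  by rewrite divr_ge0 ?(ltW s2) ?(ltW pp)//= ltr_pdivrMr// ltr_pMr.
have theta0 s : unitI s -> 0 <= theta s <= pi / (2 * sigma).
  move=> sI; have /andP[w0 wp] := omega_range a0 a1 G1 sI.
  by rewrite divr_ge0 ?(ltW s2)//= ler_pM2r ?invr_gt0.
have theta_pi s : unitI s -> 0 <= theta s < pi.
  by move=> /theta0 /andP[-> h]; apply: le_lt_trans h _; case/andP: tm.
have kappaE s : unitI s -> omega a0 a1 phi1 s = 2 * sigma * theta s + kappa s.
  by move=> _; rewrite /kappa addr0 mulrC divfK// gt_eqF.
have kr := arc_corr_range G1 mtheta tm theta0.
pose k := arc_corr phi1 theta.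
exists a0p, (arc_phi phi1 theta), (arc_dphi phi1 theta), (arc_alpha sigma a0 phi1 theta kappa a0p).
have ad := arc_admissible G1 mtheta tm theta0 kappaE perp.
have jn := arc_joins G1 mtheta tm theta0 kappaE perp.
have Apos t : unitI t -> 0 <= arcA k t by move=> tI; case: (arc_ge0 kr tI).
have Bpos t : unitI t -> 0 <= arcB k t by move=> tI; case: (arc_ge0 kr tI).
have geoE t s : geodesic (@q0 R) (q1 sigma a0 a1 phi1) t s =
    (gx phi1 theta (arcA k) (arcB k) t s, gy phi1 theta (arcB k) t s).
  have -> : geodesic (@q0 R) (q1 sigma a0 a1 phi1) t s = if acos k == 0 then q0 s else
      (sin ((1 - t) * acos k) / sin (acos k) * 1 + sin (t * acos k) / sin (acos k) * (q1 sigma a0 a1 phi1 s).1,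
       sin ((1 - t) * acos k) / sin (acos k) * 0 + sin (t * acos k) / sin (acos k) * (q1 sigma a0 a1 phi1 s).2).
    rewrite /geodesic (_ : L2_dot _ _ = k)// /L2_dot /k /arc_corr.
    by apply: eq_Rintegral => u _; rewrite /= mul1r mul0r addr0.
  rewrite /gx /gy /arcA /arcB; case: ifPn => _; first by rewrite !mul0r addr0.
  by rewrite mulr1 mulr0 add0r.
have nE t s : norm2 (geodesic (@q0 R) (q1 sigma a0 a1 phi1) t s) ^+ 2 =
    gN phi1 theta (arcA k) (arcB k) t s.
  by rewrite geoE /norm2/= sqr_sqrtr ?addr_ge0 ?sqr_ge0.
split => //.
- exists (geta phi1 theta (arcA k) (arcB k)); split.
  + move=> s sI; split; first by rewrite geta0//; case: (arc0 kr).
    apply: abs_continuous_within => //.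
    exact: (geta_ac theta_pi (arcA_ac k) (arcB_ac k) Apos Bpos (arc_unit kr)).
  + move=> t s tI sI; have [xE yE] := gpolar theta_pi Apos Bpos (arc_unit kr) tI sI.
    by rewrite /norm2 geoE/= -/(gN phi1 theta (arcA k) (arcB k) t s) -xE -yE.
  + by move=> t s tI sI; rewrite nE.
  + by move=> t s tI sI; apply: eq_Rintegral => u _; rewrite nE.
  + by move=> t s tI sI; rewrite /arc_alpha /galpha /gbeta /kappa mulr0 addr0.
- apply/le_anti/andP; split; last first.
    by apply: ereal_inf_lbound; exists (arc_phi phi1 theta), (arc_dphi phi1 theta),
      (arc_alpha sigma a0 phi1 theta kappa a0p).
  rewrite energy_inf.
  have le := @arc_energy_le _ _ _ sigma0 _ _ _ G1 _ _ _ _ mtheta tm theta0 kappaE perp 0 0 (lexx _) (lexx _).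
  apply: (le_trans (le _)).
    by move=> s z _; rewrite /kappa !addr0 mul1r.
  by rewrite lee_fin addr0 mulr1 mulr0 addr0.
Qed.
End infimum.

Local Open Scope quotient_scope.

Theorem theorem1 (R : realType) (d : nat) (sigma : R)
    (hd : (2 <= d)%N) (hsigma0 : 0 < sigma) (hsigma : 1 <= 2 * sigma) :
  (forall (a0 a1 : sphere_fun R d) (phi1 : R -> R), in_G phi1 ->
     ereal_inf (energies sigma a0 a1 phi1)
       = (4 * angle sigma a0 a1 phi1 ^+ 2)%:E
     /\ (1 < 2 * sigma ->
         exists (a0p : sphere_fun R d) (phi dphi : R -> R -> R)
                (alpha : R -> R -> 'rV[R]_d),
           [/\ is_perp a0 a1 phi1 a0p,
               deduced_from sigma (geodesic (@q0 R) (q1 sigma a0 a1 phi1))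
                 a0 a0p phi dphi alpha,
               admissible phi dphi alpha,
               joins a0 a1 phi1 phi alpha &
               energy sigma dphi alpha
                 = ereal_inf (energies sigma a0 a1 phi1)]))
  /\ ((forall a b : sphere_fun R d,
         d_sigma_M sigma (\pi_(M R d) a) (\pi_(M R d) b) = d_sigma sigma a b)
      /\ is_distance (@d_sigma_M R d sigma)).
Proof.
split; [move=> a0 a1 phi1 G1; split|split].
- exact: energy_inf.
- exact: energy_attained.
- by move=> a b; exact: d_sigma_M_pi.
- exact: d_sigma_M_distance.
Qed.
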